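(* Let $\{\mathcal{S}_n\}_{n=1}^\infty$ be an inductive sequence of $(\mathrm{el},\mathrm{c})$-nuclear operator systems (equivalently, operator systems with DCEP). Then $\varinjlim\mathcal{S}_n$ is also $(\mathrm{el},\mathrm{c})$-nuclear (equivalently, has DCEP).
   Context: An operator system is a unital self-adjoint subspace of $B(H)$. Inductive sequences of operator systems have unital complete order embeddings $u_n:\mathcal{S}_n\to\mathcal{S}_{n+1}$ as connecting maps; the inductive limit $\varinjlim\mathcal{S}_n$ is the operator system $\mathcal{S}$ with unital complete order embeddings $\lambda_n:\mathcal{S}_n\to\mathcal{S}$ satisfying $\lambda_n=\lambda_{n+1}\circ u_n$ and $\mathcal{S}=\overline{\bigcup_n\lambda_n(\mathcal{S}_n)}$, universal for compatible families of unital completely positive maps. For operator systems $\mathcal{S},\mathcal{T}$, the tensor products are operator system structures on the algebraic tensor product. $\max$: the positive cones are the Archimedeanizations $\{u\in M_n(\mathcal{S}\otimes\mathcal{T}): u+\varepsilon 1\in D_n\ \forall\varepsilon>0\}$ of $D_n=\{\alpha(P\otimes Q)\alpha^*:P\in M_k(\mathcal{S})^+,Q\in M_m(\mathcal{T})^+,\alpha\in M_{n,km}(\mathbb{C}),k,m\in\mathbb{N}\}$. $\mathrm{el}$: the structure inherited from the inclusion $\mathcal{S}\otimes_{\mathrm{el}}\mathcal{T}\subset I(\mathcal{S})\otimes_{\max}\mathcal{T}$, where $I(\mathcal{S})$ is the injective envelope of $\mathcal{S}$. $\mathrm{c}$ (maximal commuting): $u\in M_n(\mathcal{S}\otimes_{\mathrm{c}}\mathcal{T})^+$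 iff $(\varphi\cdot\psi)^{(n)}(u)\ge0$ for all Hilbert spaces $H$ and completely positive maps $\varphi:\mathcal{S}\to B(H)$, $\psi:\mathcal{T}\to B(H)$ with commuting ranges, where $(\varphi\cdot\psi)(s\otimes t)=\varphi(s)\psi(t)$. For operator system tensor products $\alpha,\beta$, $\mathcal{S}$ is $(\alpha,\beta)$-nuclear if the identity map $\mathcal{S}\otimes_\alpha\mathcal{T}\to\mathcal{S}\otimes_\beta\mathcal{T}$ is a complete order isomorphism for every operator system $\mathcal{T}$. $\mathcal{S}$ has the double commutant expectation property (DCEP) if for every unital complete order embedding $\mathcal{S}\subset B(H)$ there is a completely positive map $\varphi:B(H)\to\mathcal{S}''$ (the double commutant of $\mathcal{S}$ in $B(H)$) with $\varphi(s)=s$ for all $s\in\mathcal{S}$. It is known (Kavruk–Paulsen–Todorov–Tomforde) that $\mathcal{S}$ is $(\mathrm{el},\mathrm{c})$-nuclear iff it has DCEP iff $\mathcal{S}\otimes_{\min}C^*(\mathbb{F}_\infty)=\mathcal{S}\otimes_{\max}C^*(\mathbb{F}_\infty)$, where $\otimes_{\min}$ is the spatial operator system tensor product and $C^*(\mathbb{F}_\infty)$ the full $C^*$-algebra of the free group on countably many generators. *)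

(* Defs.v *)
From HB Require Import structures.
From mathcomp Require Import all_boot all_order all_algebra.
From mathcomp Require Import generic_quotient sesquilinear complex mxtens.
From mathcomp Require Import all_classical all_reals all_analysis.

Set Implicit Arguments.
Unset Strict Implicit.
Unset Printing Implicit Defensive.

Import Order.TTheory GRing.Theory Num.Theory.
Import numFieldNormedType.Exports.

Local Open Scope classical_set_scope.
Local Open Scope ring_scope.
Local Open Scope quotient_scope.
Local Open Scope complex_scope.

(* The algebraic tensor product U ⊗ V of two modules: formal sums of pairs,
   two formal sums being identified when no bilinear map separates them. *)
Section TensorProduct.
Variables (K : comNzRingType) (U V : lmodType K).
Implicit Types (s t : seq (U * V)) (W : lmodType K).

Definition tensor_eval W (f : U -> V -> W) s : W := \sum_(p <- s) f p.1 p.2.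

Definition tensor_equiv s t : bool :=
  `[< forall W (f : {bilinear U -> V -> W}),
        tensor_eval f s = tensor_eval f t >].

Lemma tensor_equiv_refl : reflexive tensor_equiv.
Proof. by move=> s; apply/asboolP. Qed.

Lemma tensor_equiv_sym : symmetric tensor_equiv.
Proof.
by move=> s t; apply/asboolP/asboolP => h W f; rewrite h.
Qed.

Lemma tensor_equiv_trans : transitive tensor_equiv.
Proof.
by move=> t s r /asboolP h /asboolP k; apply/asboolP => W f; rewrite h k.
Qed.

Canonical tensor_equiv_rel := EquivRel tensor_equiv
  tensor_equiv_refl tensor_equiv_sym tensor_equiv_trans.

Definition tensor := {eq_quot tensor_equiv}.

HB.instance Definition _ := Choice.on tensor.
HB.instance Definition _ := EqQuotient.on tensor.

Lemma tensor_eqP s t :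
  (forall W (f : {bilinear U -> V -> W}), tensor_eval f s = tensor_eval f t) <->
  \pi_tensor s = \pi_tensor t.
Proof.
split=> [h|/eqP]; first by apply/eqP; rewrite piE; apply/asboolP.
by rewrite piE => /asboolP.
Qed.

Lemma tensor_eval_repr W (f : {bilinear U -> V -> W}) s :
  tensor_eval f (repr (\pi_tensor s)) = tensor_eval f s.
Proof. by move: W f; apply/tensor_eqP; rewrite reprK. Qed.

Definition tensor_scale_seq (a : K) s := [seq (a *: p.1, p.2) | p <- s].

Lemma tensor_eval_nil W (f : {bilinear U -> V -> W}) : tensor_eval f [::] = 0.
Proof. by rewrite /tensor_eval big_nil. Qed.

Lemma tensor_eval_cat W (f : {bilinear U -> V -> W}) s t :
  tensor_eval f (s ++ t) = tensor_eval f s + tensor_eval f t.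
Proof. by rewrite /tensor_eval big_cat. Qed.

Lemma tensor_eval_scale W (f : {bilinear U -> V -> W}) a s :
  tensor_eval f (tensor_scale_seq a s) = a *: tensor_eval f s.
Proof.
rewrite /tensor_eval big_map scaler_sumr; apply: eq_bigr => p _ /=.
by rewrite linearZl_LR.
Qed.

Definition tensor_zero : tensor := \pi_tensor [::].
Definition tensor_add (x y : tensor) : tensor := \pi_tensor (repr x ++ repr y).
Definition tensor_scale (a : K) (x : tensor) : tensor :=
  \pi_tensor (tensor_scale_seq a (repr x)).

Let tensor_evalE := (tensor_eval_repr, tensor_eval_cat, tensor_eval_scale,
  tensor_eval_nil).

Lemma tensor_addA : associative tensor_add.
Proof. by move=> x y z; apply/tensor_eqP => W f; rewrite !tensor_evalE addrA. Qed.

Lemma tensor_addC : commutative tensor_add.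
Proof. by move=> x y; apply/tensor_eqP => W f; rewrite !tensor_evalE addrC. Qed.

Lemma tensor_add0 : left_id tensor_zero tensor_add.
Proof.
move=> x; rewrite -[RHS]reprK; apply/tensor_eqP => W f.
by rewrite !tensor_evalE add0r.
Qed.

Lemma tensor_addN : left_inverse tensor_zero (tensor_scale (-1)) tensor_add.
Proof.
by move=> x; apply/tensor_eqP => W f; rewrite !tensor_evalE scaleN1r addNr.
Qed.

HB.instance Definition _ := GRing.isZmodule.Build tensor
  tensor_addA tensor_addC tensor_add0 tensor_addN.

Lemma tensor_scaleA a b (x : tensor) :
  tensor_scale a (tensor_scale b x) = tensor_scale (a * b) x.
Proof. by apply/tensor_eqP => W f; rewrite !tensor_evalE scalerA. Qed.

Lemma tensor_scale1 : left_id 1 tensor_scale.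
Proof.
move=> x; rewrite -[RHS]reprK; apply/tensor_eqP => W f.
by rewrite !tensor_evalE scale1r.
Qed.

Lemma tensor_scaleDr : right_distributive tensor_scale +%R.
Proof.
by move=> a x y; apply/tensor_eqP => W f; rewrite !tensor_evalE scalerDr.
Qed.

Lemma tensor_scaleDl (x : tensor) :
  {morph tensor_scale^~ x : a b / a + b}.
Proof.
by move=> a b; apply/tensor_eqP => W f; rewrite !tensor_evalE scalerDl.
Qed.

HB.instance Definition _ := GRing.Zmodule_isLmodule.Build K tensor
  tensor_scaleA tensor_scale1 tensor_scaleDr tensor_scaleDl.

Definition tens (x : U) (y : V) : tensor := \pi_tensor [:: (x, y)].

Lemma tensor_eval1 W (f : {bilinear U -> V -> W}) x y :
  tensor_eval f [:: (x, y)] = f x y.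
Proof. by rewrite /tensor_eval big_seq1. Qed.

Lemma tens_is_bilinear : bilinear_for *:%R *:%R tens.
Proof.
split=> [y a x x'|x a y y']; apply/tensor_eqP => W f;
  by rewrite !tensor_evalE !tensor_eval1 ?linearPl ?linearPr.
Qed.

HB.instance Definition _ := bilinear_isBilinear.Build K U V tensor
  *:%R *:%R tens tens_is_bilinear.

Definition tensor_lift W (f : {bilinear U -> V -> W}) (x : tensor) : W :=
  tensor_eval f (repr x).

Lemma tensor_lift_is_linear W (f : {bilinear U -> V -> W}) :
  linear (tensor_lift f).
Proof. by move=> a x y; rewrite /tensor_lift !tensor_evalE. Qed.

HB.instance Definition _ W (f : {bilinear U -> V -> W}) :=
  GRing.isLinear.Build K tensor W *:%R (tensor_lift f)
    (tensor_lift_is_linear f).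

Lemma tensor_liftE W (f : {bilinear U -> V -> W}) x y :
  tensor_lift f (tens x y) = f x y.
Proof. by rewrite /tensor_lift tensor_eval_repr tensor_eval1. Qed.

Lemma tensor_lift_unique W (f : {bilinear U -> V -> W})
    (g : {linear tensor -> W}) :
  (forall x y, g (tens x y) = f x y) -> g =1 tensor_lift f.
Proof.
move=> gE z; rewrite -[in LHS](reprK z) /tensor_lift /tensor_eval.
elim: (repr z) => [|[x y] s IHs].
  rewrite big_nil -[RHS](linear0 g); congr (g _).
rewrite big_cons /= -gE -IHs -linearD; congr (g _).
by apply/tensor_eqP => W' h; rewrite !tensor_evalE -tensor_eval_cat.
Qed.

End TensorProduct.

Record hilbert (R : realType) := Hilbert {
  hilb_space :> completeNormedModType R[i];
  (* linear in the first argument *)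
  hilb_ip : {dot hilb_space for Num.conj};
  hilb_normE : forall x, `|x| ^+ 2 = hilb_ip x x }.

Section BoundedOperators.
Variables (R : realType) (H : hilbert R).

Definition bounded_op : {pred H -> H} :=
  fun f => `[< linear f /\ continuous f >].

Record bop := Bop { bop_fun :> H -> H ; bop_funP : bop_fun \in bounded_op }.

HB.instance Definition _ := [isSub for bop_fun].
HB.instance Definition _ := [Choice of bop by <:].

Lemma bounded_op_submod_closed : submod_closed bounded_op.
Proof.
split=> [|a f g].
  by apply/asboolP; split=> [b x y /=|x]; [rewrite scaler0 addr0 | exact: cvg_cst].
move=> /asboolP[lf cf] /asboolP[lg cg]; apply/asboolP; split=> [b x y|x].
  rewrite -[LHS]/(a *: f (b *: x + y) + g (b *: x + y)) lf lg.
  rewrite -[RHS]/(b *: (a *: f x + g x) + (a *: f y + g y)).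
  by rewrite !scalerDr !scalerA mulrC addrACA.
by apply: cvgD; [apply: cvgZr; exact: cf | exact: cg].
Qed.

HB.instance Definition _ :=
  GRing.isSubmodClosed.Build R[i] (H -> H) bounded_op bounded_op_submod_closed.
HB.instance Definition _ := [SubChoice_isSubLmodule of bop by <:].

Lemma bop_linear (A : bop) : linear A.
Proof. by have /asboolP[] := bop_funP A. Qed.

Lemma bop_continuous (A : bop) : continuous A.
Proof. by have /asboolP[] := bop_funP A. Qed.

Lemma bop1_subproof : idfun \in bounded_op.
Proof. by apply/asboolP; split=> // x; exact: cvg_id. Qed.

Definition bop1 : bop := Bop bop1_subproof.

Lemma bop_comp_subproof (A B : bop) : A \o B \in bounded_op.
Proof.
apply/asboolP; split=> [b x y /=|x]; first by rewrite !bop_linear.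
by apply: continuous_comp; exact: bop_continuous.
Qed.

Definition bop_comp (A B : bop) : bop := Bop (bop_comp_subproof A B).

Definition adjoint_of (A B : bop) : Prop :=
  forall x y : H, hilb_ip H (A x) y = hilb_ip H x (B y).

Definition opnorm_le (A : bop) (r : R) : Prop :=
  forall x : H, `|A x| <= r%:C * `|x|.

(* Positivity of A, acting on the n-fold direct sum of H. *)
Definition bop_pos n (A : 'M[bop]_n) : Prop :=
  forall xi : 'I_n -> H, 0 <= \sum_i \sum_j hilb_ip H (A i j (xi j)) (xi i).

Definition commutant (X : set bop) : set bop :=
  [set A | forall B, X B -> bop_comp A B = bop_comp B A].

Definition op_closure (X : set bop) : set bop :=
  [set A | forall e : R, 0 < e -> exists2 B, X B & opnorm_le (A - B) e].

End BoundedOperators.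

(* Every bounded operator has an adjoint, so os_adj says that the subspace is
   self-adjoint without choosing an adjoint operation on bop. *)
Record opsys (R : realType) := OpSys {
  os_hilb : hilbert R;
  os_pred : {pred bop os_hilb};
  os_submod : submod_closed os_pred;
  os_unit : bop1 os_hilb \in os_pred;
  os_adj : forall A B, A \in os_pred -> adjoint_of A B -> B \in os_pred }.

HB.instance Definition _ (R : realType) (S : opsys R) :=
  GRing.isSubmodClosed.Build R[i] (bop (os_hilb S))
    (@os_pred R S) (@os_submod R S).

Record os_elt (R : realType) (S : opsys R) :=
  OsElt { os_val : bop (os_hilb S) ; _ : os_val \in @os_pred R S }.

HB.instance Definition _ (R : realType) (S : opsys R) :=
  [isSub for @os_val R S].
HB.instance Definition _ (R : realType) (S : opsys R) :=
  [Choice of os_elt S by <:].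
HB.instance Definition _ (R : realType) (S : opsys R) :=
  [SubChoice_isSubLmodule of os_elt S by <:].

Coercion os_elt : opsys >-> Sortclass.

Section OperatorSystems.
Variable R : realType.
Implicit Types (S T I J : opsys R) (H : hilbert R).

Definition os_one S : S := OsElt (@os_unit R S).

Definition os_pos S n (A : 'M[S]_n) : Prop := bop_pos (map_mx (@os_val R S) A).

Definition os_set S : set (bop (os_hilb S)) := [set A | A \in @os_pred R S].
Arguments os_set : clear implicits.

Definition norm_closed S : Prop := op_closure (os_set S) `<=` os_set S.

Lemma fullsys_submod H : submod_closed (predT : {pred bop H}).
Proof. by []. Qed.

Definition fullsys H : opsys R :=
  @OpSys R H predT (fullsys_submod H) isT (fun _ _ _ _ => isT).

Definition cp S T (f : {linear S -> T}) : Prop :=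
  forall n (A : 'M[S]_n), os_pos A -> os_pos (map_mx f A).

Definition ucp S T (f : {linear S -> T}) : Prop := f (os_one S) = os_one T /\ cp f.

(* Unital complete order embedding (injectivity follows from the equivalence). *)
Definition uco_embedding S T (f : {linear S -> T}) : Prop :=
  f (os_one S) = os_one T /\
  forall n (A : 'M[S]_n), os_pos A <-> os_pos (map_mx f A).

Definition os_injective I : Prop :=
  forall S T (j : {linear S -> T}) (f : {linear S -> I}),
    uco_embedding j -> cp f ->
    exists2 g : {linear T -> I}, cp g & forall x, g (j x) = f x.

(* I is an injective extension of S, with no proper injective subsystem J
   between S and I. *)
Definition injective_envelope S I (k : {linear S -> I}) : Prop :=
  [/\ uco_embedding k, os_injective I &
      forall J (j : {linear J -> I}), uco_embedding j -> os_injective J ->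
        (forall x, exists y, j y = k x) -> forall z, exists y, j y = z].

Definition has_DCEP S : Prop :=
  forall H (i : {linear S -> fullsys H}), uco_embedding i ->
    exists f : {linear fullsys H -> fullsys H},
      [/\ cp f,
          forall A, commutant (commutant (range (fun s => os_val (i s))))
                      (os_val (f A))
        & forall s, f (i s) = i s].

Section TensorMaps.
Variables S T : opsys R.

Definition tens_mapl_fun I (k : {linear S -> I}) (s : S) (t : T) : tensor I T :=
  tens (k s) t.

Lemma tens_mapl_is_bilinear I (k : {linear S -> I}) :
  bilinear_for *:%R *:%R (tens_mapl_fun k).
Proof.
by split=> [t a s s'|s a t t']; rewrite /tens_mapl_fun ?linearP ?linearPl ?linearPr.
Qed.

HB.instance Definition _ I (k : {linear S -> I}) :=
  bilinear_isBilinear.Build R[i] S T (tensor I T)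
    *:%R *:%R (tens_mapl_fun k) (tens_mapl_is_bilinear k).

(* k ⊗ id *)
Definition tens_mapl I (k : {linear S -> I}) : tensor S T -> tensor I T :=
  tensor_lift (tens_mapl_fun k).

Definition op_product_fun H (f : {linear S -> fullsys H})
    (g : {linear T -> fullsys H}) (s : S) (t : T) : bop H :=
  bop_comp (os_val (f s)) (os_val (g t)).

Lemma op_product_is_bilinear H (f : {linear S -> fullsys H})
    (g : {linear T -> fullsys H}) : bilinear_for *:%R *:%R (op_product_fun f g).
Proof.
split=> [t a s s'|s a t t']; apply/val_inj/funext => x.
  by rewrite /= linearP.
by rewrite /= linearP /= -[LHS]/(os_val (f s) (a *: _ + _)) bop_linear.
Qed.

HB.instance Definition _ H (f : {linear S -> fullsys H})
    (g : {linear T -> fullsys H}) :=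
  bilinear_isBilinear.Build R[i] S T (bop H)
    *:%R *:%R (op_product_fun f g) (op_product_is_bilinear f g).

(* f · g, with (f · g)(s ⊗ t) = f(s) g(t) *)
Definition op_product H (f : {linear S -> fullsys H})
    (g : {linear T -> fullsys H}) : tensor S T -> bop H :=
  tensor_lift (op_product_fun f g).

End TensorMaps.

(* An operator system structure on the algebraic tensor products, given by its
   matrix cones. *)
Definition tensor_cones :=
  forall S T n, 'M[tensor S T]_n -> Prop.

Definition tens_mx S T k m (P : 'M[S]_k) (Q : 'M[T]_m) : 'M[tensor S T]_(k * m) :=
  \matrix_(p, q) tens (P (mxtens_unindex p).1 (mxtens_unindex q).1)
                      (Q (mxtens_unindex p).2 (mxtens_unindex q).2).

(* a X a^*, for a scalar matrix a *)
Definition conj_mx (V : lmodType R[i]) n m (a : 'M[R[i]]_(n, m)) (X : 'M[V]_m) :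
    'M[V]_n :=
  \matrix_(i, j) \sum_p \sum_q (a i p * Num.conj (a j q)) *: X p q.

(* c (1 ⊗ 1) on the diagonal *)
Definition tens_scalar_mx S T n (c : R[i]) : 'M[tensor S T]_n :=
  \matrix_(i, j) ((c *+ (i == j)) *: tens (os_one S) (os_one T)).

Definition max_precone : tensor_cones := fun S T n u =>
  exists k m (P : 'M[S]_k) (Q : 'M[T]_m) (a : 'M[R[i]]_(n, k * m)),
    [/\ os_pos P, os_pos Q & u = conj_mx a (tens_mx P Q)].

Definition max_cone : tensor_cones := fun S T n u =>
  forall e : R, 0 < e -> max_precone (u + tens_scalar_mx S T n e%:C).

Definition el_cone : tensor_cones := fun S T n u =>
  exists I (k : {linear S -> I}),
    injective_envelope k /\ max_cone (map_mx (@tens_mapl S T I k) u).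

Definition c_cone : tensor_cones := fun S T n u =>
  forall H (f : {linear S -> fullsys H}) (g : {linear T -> fullsys H}),
    cp f -> cp g ->
    (forall s t, bop_comp (os_val (f s)) (os_val (g t)) =
                 bop_comp (os_val (g t)) (os_val (f s))) ->
    bop_pos (map_mx (op_product f g) u).

Definition nuclear (alpha beta : tensor_cones) S : Prop :=
  forall T n (u : 'M[tensor S T]_n), alpha S T n u <-> beta S T n u.

(* The universal property is stated against norm-closed systems T: the limit is
   itself norm closed, and a non-closed T need not receive the extension of a
   compatible family from the union to its closure. *)
Record is_inductive_limit (S_ : nat -> opsys R)
    (u : forall n, {linear S_ n -> S_ n.+1})
    (S : opsys R) (l : forall n, {linear S_ n -> S}) : Prop := {
  indlim_embedding : forall n, uco_embedding (l n);
  indlim_compat : forall n x, l n x = l n.+1 (u n x);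
  indlim_closure :
    os_set S = op_closure (\bigcup_n range (fun x => os_val (l n x)));
  indlim_universal : forall T (f : forall n, {linear S_ n -> T}),
    norm_closed T -> (forall n, ucp (f n)) ->
    (forall n x, f n x = f n.+1 (u n x)) ->
    exists g : {linear S -> T},
      [/\ ucp g, forall n x, g (l n x) = f n x &
          forall g' : {linear S -> T},
            ucp g' -> (forall n x, g' (l n x) = f n x) -> g' =1 g] }.

End OperatorSystems.

(* Main.v *)
Require Import Defs.
From HB Require Import structures.
From mathcomp Require Import all_boot all_order all_algebra.
From mathcomp Require Import generic_quotient sesquilinear complex mxtens.
From mathcomp Require Import all_classical all_reals all_analysis.
From mathcomp Require Import ring lra.

Set Implicit Arguments.
Unset Strict Implicit.
Unset Printing Implicit Defensive.

Import Order.TTheory GRing.Theory Num.Theory.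
Import numFieldNormedType.Exports.

Local Open Scope classical_set_scope.
Local Open Scope ring_scope.
Local Open Scope complex_scope.

Local Notation Re := complex.Re.
Local Notation Im := complex.Im.

(** The limit [S] contains every stage [S_ n] through the complete order
    embedding [l n], and each element of [S] is a norm limit of elements coming
    from the stages.  Both halves of the theorem carry a property of the stages
    over to [S] along this density.

    DCEP.  For a unital complete order embedding [i] of [S] in B(H), each
    composition of [l n] and [i] is again such an embedding, so there are
    completely positive maps [f n] from B(H) to the double commutant of
    [i (l n (S_ n))], hence to that of [i S], fixing [i (l n (S_ n))].  A limit of the
    [f n] along a free ultrafilter, in the topology of the scalars <f(A)x, y>,
    stays completely positive and inside the double commutant; it fixes the
    stages, and therefore [i S] because it is contractive ([DCEP_limit]).

    Nuclearity.  The inclusion of the c-cone in the el-cone holds for every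
    operator system ([c_cone_el_cone]).  For the first factor B(K) the c-cone is
    even contained in the max-cone ([c_cone_fullsys]): otherwise Hahn-Banach
    gives a functional [L] that is nonnegative on the cone D_n and negative at a
    c-positive [u] ([mcone_separation]), while a GNS construction writes [L] as a
    vector functional of a commuting pair of completely positive maps, so that
    [L u] is nonnegative ([gns]).  In general, embed S in its injective
    envelope I and I in B(K): c-positivity passes to B(K), gives max-positivity
    there, and a completely positive projection of B(K) onto I brings
    max-positivity back to I.

    The other inclusion is where the stages enter ([el_cone_c_cone]).  An
    el-positive [u] is a finite real combination of terms a a^* (x) s (x) t with
    s and t positive.  Replacing each s by a nearby hermitian element of a stage
    gives an element [v] over some [S_ m] that is close to [u] both in the order
    of D_n and for any prescribed vector functional of the maps to be tested
    ([rspan_approx]).  The embedding of [S_ m] in its injective envelope extends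
    to I, and the extension shows that [v] plus a small multiple of the unit is
    el-positive over [S_ m]; by nuclearity of [S_ m] it is c-positive, and [u] is
    c-positive in the limit.

    The construction rests on theorems proved on the way: Riesz representation
    and completions, Arveson's extension theorem ([arveson]), and Hamana's
    injective envelopes ([injective_envelope_exists]), the latter because an
    el-positive element over [S_ m] has to be produced by exhibiting an envelope. *)


(** * Scalars and semi-inner products *)

Section Scalars.
Variable R : realType.
Implicit Types (z w : R[i]) (a b c : R).


Lemma cext z w : Re z = Re w -> Im z = Im w -> z = w.
Proof. by case: z w => [a b] [c d] /= -> ->. Qed.

Lemma ReD z w : Re (z + w) = Re z + Re w. Proof. by case: z w => [a b] [c d]. Qed.
Lemma ImD z w : Im (z + w) = Im z + Im w. Proof. by case: z w => [a b] [c d]. Qed.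
Lemma ReN z : Re (- z) = - Re z. Proof. by case: z. Qed.
Lemma ImN z : Im (- z) = - Im z. Proof. by case: z. Qed.
Lemma ReB z w : Re (z - w) = Re z - Re w. Proof. by rewrite ReD ReN. Qed.
Lemma ImB z w : Im (z - w) = Im z - Im w. Proof. by rewrite ImD ImN. Qed.
Lemma ReM z w : Re (z * w) = Re z * Re w - Im z * Im w.
Proof. by case: z w => [a b] [c d]. Qed.
Lemma ImM z w : Im (z * w) = Re z * Im w + Im z * Re w.
Proof. by case: z w => [a b] [c d]. Qed.
Lemma ReC z : Re (conjc z) = Re z. Proof. by case: z. Qed.
Lemma ImC z : Im (conjc z) = - Im z. Proof. by case: z. Qed.
Lemma Re_real a : Re a%:C = a. Proof. by []. Qed.
Lemma Im_real a : Im a%:C = 0. Proof. by []. Qed.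
Lemma Re_i : Re ('i : R[i]) = 0. Proof. by []. Qed.
Lemma Im_i : Im ('i : R[i]) = 1. Proof. by []. Qed.
Lemma Re0 : Re (0 : R[i]) = 0. Proof. by []. Qed.
Lemma Im0 : Im (0 : R[i]) = 0. Proof. by []. Qed.
Lemma Re1 : Re (1 : R[i]) = 1. Proof. by []. Qed.
Lemma Im1 : Im (1 : R[i]) = 0. Proof. by []. Qed.

Definition reim := (ReB, ImB, ReD, ImD, ReN, ImN, ReM, ImM, ReC, ImC, Re_real,
  Im_real, Re_i, Im_i, Re0, Im0, Re1, Im1).

Definition zsimp := (@oppr0 R, @mul0r R, @mulr0 R, @mulr1 R, @mul1r R, @mulrN R,
  @mulNr R, @opprK R, @addr0 R, @add0r R).

Lemma ge0cP z : 0 <= z <-> 0 <= Re z /\ Im z = 0.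
Proof.
rewrite lecE /=; split=> [/andP[/eqP-> ->]//|[-> ->]]; by rewrite eqxx.
Qed.

Lemma ge0cE z : 0 <= z -> z = (Re z)%:C.
Proof. by move=> /ge0cP[_ h]; apply: cext. Qed.

Lemma Re_sum I (r : seq I) (P : pred I) (F : I -> R[i]) :
  Re (\sum_(i <- r | P i) F i) = \sum_(i <- r | P i) Re (F i).
Proof. by elim/big_rec2: _ => // i x y _ <-; rewrite ReD. Qed.

Lemma Im_sum I (r : seq I) (P : pred I) (F : I -> R[i]) :
  Im (\sum_(i <- r | P i) F i) = \sum_(i <- r | P i) Im (F i).
Proof. by elim/big_rec2: _ => // i x y _ <-; rewrite ImD. Qed.

Lemma scale_re_im (V : lmodType R[i]) z (v : V) :
  z *: v = (Re z)%:C *: v + (Im z)%:C *: ('i *: v).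
Proof.
rewrite scalerA -scalerDl; congr (_ *: _); apply: cext; rewrite !reim;
by rewrite ?mulr0 ?mulr1 ?subr0 ?addr0 ?add0r ?mul0r ?addr0.
Qed.

End Scalars.

Section RealSequences.
Variable R : realType.
Implicit Types (u v : nat -> R) (l : R).

Definition dlt (n : nat) : R := n.+1%:R^-1.

Lemma dlt_gt0 n : 0 < dlt n. Proof. by rewrite invr_gt0. Qed.

Lemma dlt_small (e : R) : 0 < e -> exists N, forall n, (N <= n)%N -> dlt n < e.
Proof.
move=> e0; have [N _ h] := near_infty_natSinv_lt (PosNum e0).
by exists N => n /h.
Qed.

End RealSequences.

Section SemiInnerProduct.
Variables (R : realType) (E : lmodType R[i]) (B : E -> E -> R[i]).

(** Degenerate forms are allowed: the completions below start from them. *)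
Definition semi_ip : Prop :=
  [/\ forall a x y z, B (a *: x + y) z = a * B x z + B y z,
      forall x y, B y x = conjc (B x y) & forall x, 0 <= B x x].

Hypothesis hB : semi_ip.

Let q x := Re (B x x).

Lemma sipD x y z : B (x + y) z = B x z + B y z.
Proof. by have [h _ _] := hB; rewrite -{1}[x]scale1r h mul1r. Qed.
Lemma sip0 z : B 0 z = 0.
Proof. by apply: (@addrI _ (B 0 z)); rewrite -sipD !addr0. Qed.
Lemma sipZ a x z : B (a *: x) z = a * B x z.
Proof. by have [h _ _] := hB; rewrite -[a *: x]addr0 h sip0 addr0. Qed.
Lemma sipC x y : B y x = conjc (B x y). Proof. by case: hB. Qed.
Lemma sipDr x y z : B z (x + y) = B z x + B z y.
Proof. by rewrite sipC sipD rmorphD /= -!sipC. Qed.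
Lemma sipZr a x z : B z (a *: x) = conjc a * B z x.
Proof. by rewrite sipC sipZ rmorphM /= -!sipC. Qed.
Lemma sip0r z : B z 0 = 0.
Proof. by rewrite sipC sip0 conjc0. Qed.
Lemma sipN x z : B (- x) z = - B x z.
Proof. by rewrite -scaleN1r sipZ mulN1r. Qed.
Lemma sipNr x z : B z (- x) = - B z x.
Proof. by rewrite sipC sipN rmorphN /= -sipC. Qed.
Lemma sipB x y z : B (x - y) z = B x z - B y z.
Proof. by rewrite sipD sipN. Qed.
Lemma sipBr x y z : B z (x - y) = B z x - B z y.
Proof. by rewrite sipDr sipNr. Qed.
Lemma sip_sum I (r : seq I) (P : pred I) (F : I -> E) z :
  B (\sum_(i <- r | P i) F i) z = \sum_(i <- r | P i) B (F i) z.
Proof. by elim/big_rec2: _ => [|i x y _ <-]; rewrite ?sip0 ?sipD. Qed.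
Lemma sip_sumr I (r : seq I) (P : pred I) (F : I -> E) z :
  B z (\sum_(i <- r | P i) F i) = \sum_(i <- r | P i) B z (F i).
Proof. by elim/big_rec2: _ => [|i x y _ <-]; rewrite ?sip0r ?sipDr. Qed.

Lemma sipq_ge0 x : 0 <= q x.
Proof. by have [_ _ /(_ x)/ge0cP[]] := hB. Qed.
Lemma sipqE x : B x x = (q x)%:C.
Proof. by have [_ _ /(_ x)/ge0cE] := hB. Qed.
Lemma sipImxx x : Im (B x x) = 0. Proof. by rewrite sipqE. Qed.
Lemma Re_sipC x y : Re (B x y) = Re (B y x).
Proof. by rewrite sipC ReC. Qed.

Definition sipE := (sipB, sipBr, sipD, sipDr, sipN, sipNr, sipZ, sipZr).

Lemma sipqD x y : q (x + y) = q x + 2 * Re (B x y) + q y.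
Proof. by rewrite /q !sipE !ReD (Re_sipC y x); ring. Qed.
Lemma sipqN x : q (- x) = q x.
Proof. by rewrite /q sipN sipNr opprK. Qed.
Lemma sipqB x y : q (x - y) = q x - 2 * Re (B x y) + q y.
Proof. by rewrite sipqD sipqN sipNr ReN mulrN. Qed.
Lemma sipqBC x y : q (x - y) = q (y - x).
Proof. by rewrite -sipqN opprB. Qed.
Lemma sipqZ a x : q (a *: x) = (Re a ^+ 2 + Im a ^+ 2) * q x.
Proof. by rewrite /q sipZ sipZr sipqE !reim /q; ring. Qed.
Lemma sipqZr (a : R) x : q (a%:C *: x) = a ^+ 2 * q x.
Proof. by rewrite sipqZ /= expr0n addr0. Qed.

Lemma sipq_par x y : q (x + y) <= 2 * q x + 2 * q y.
Proof.
have := sipq_ge0 (x - y); rewrite sipqB sipqD; lra.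
Qed.

Lemma sip_discr (a b c : R) : 0 <= a -> 0 <= c ->
  (forall t : R, 0 <= a + 2 * t * b + t ^+ 2 * c) -> b ^+ 2 <= a * c.
Proof.
move=> a0 c0 h.
have [cE|cn0] := eqVneq c 0.
  move: h; rewrite cE mulr0 => h; have [->|bn0] := eqVneq b 0; first by rewrite expr0n.
  move: (h (- (a + 1) / (2 * b))).
  have -> : a + 2 * (- (a + 1) / (2 * b)) * b + (- (a + 1) / (2 * b)) ^+ 2 * 0 = - 1.
    by field.
  by rewrite lerNr oppr0 ler10.
have cp : 0 < c by rewrite lt_neqAle eq_sym cn0.
move: (h (- b / c)).
have -> : a + 2 * (- b / c) * b + (- b / c) ^+ 2 * c = (a * c - b ^+ 2) / c.
  by field.
by rewrite pmulr_lge0 ?invr_gt0// subr_ge0.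
Qed.

Lemma sip_CS x y : Re (B x y) ^+ 2 <= q x * q y.
Proof.
apply: sip_discr; rewrite ?sipq_ge0// => t.
have := sipq_ge0 (x + t%:C *: y).
rewrite sipqD sipqZr sipZr !reim; congr (0 <= _); ring.
Qed.

Lemma sip_CSi x y : Im (B x y) ^+ 2 <= q x * q y.
Proof.
have := sip_CS x ('i *: y).
by rewrite sipqZ sipZr !reim expr0n expr1n add0r !mul1r mul0r sub0r mulN1r opprK.
Qed.

(** A maximizing sequence of [2 phi x - q x] is Cauchy for the form, and
    comparing its values at [e n] and at [e n] plus a multiple of [y] shows
    that it represents [phi] in the limit. In a complete space this is the
    theorem of Riesz; in general it approximates functionals by vectors. *)
Lemma riesz_pre (phi : E -> R) (C : R) :
  (forall x y, phi (x + y) = phi x + phi y) ->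
  (forall (t : R) x, phi (t%:C *: x) = t * phi x) ->
  (forall x, phi x ^+ 2 <= C * q x) ->
  exists e : nat -> E,
    (forall m n, q (e m - e n) <= 2 * (dlt R m + dlt R n)) /\
    (forall y n, (phi y - Re (B (e n) y)) ^+ 2 <= dlt R n * (q y + 1)).
Proof.
move=> phiD phiZ phib.
pose F x := 2 * phi x - q x.
pose D := Num.max C 0.
have D0 : 0 <= D by rewrite le_max lexx orbT.
have phiD' x : phi x ^+ 2 <= D * q x.
  apply: (le_trans (phib x)); apply: ler_wpM2r; first exact: sipq_ge0.
  by rewrite le_max lexx.
have FD x : F x <= D.
  rewrite /F lerBlDr.
  have h : (2 * phi x) ^+ 2 <= (D + q x) ^+ 2.
    have := phiD' x; have := sqr_ge0 (D - q x).
    rewrite (_ : (D - q x) ^+ 2 = (D + q x) ^+ 2 - 4 * (D * q x)); last by ring.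
    rewrite (_ : (2 * phi x) ^+ 2 = 4 * phi x ^+ 2); last by ring.
    lra.
  apply: (le_trans (ler_norm _)); rewrite -[leRHS]ger0_norm ?addr_ge0 ?sipq_ge0//.
  by rewrite -ler_sqr ?nnegrE// !real_normK ?num_real.
pose X := [set F x | x in setT].
have supX : has_sup X.
  by split; [exists (F 0); exists 0 | exists D => _ [x _ <-]].
have Fsup x : F x <= sup X by apply: ub_le_sup; [case: supX | exists x].
have /choice[e he] n : exists x, sup X - dlt R n < F x.
  have [_ [x _ <-] hx] := sup_adherent (dlt_gt0 R n) supX.
  by exists x.
exists e; split=> [m n|y n].
  have h1 := he m; have h2 := he n; have := Fsup (2^-1%:C *: (e m + e n)).
  rewrite /F phiZ phiD sipqZr sipqD; rewrite /F in h1 h2.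
  rewrite sipqB.
  have -> : 2 * (2^-1 * (phi (e m) + phi (e n))) = phi (e m) + phi (e n) :> R by field.
  set a := q _; set b := q _; set c := Re _ => h3.
  have : 2^-1 ^+ 2 * (a + 2 * c + b) = (a + 2 * c + b) / 4 by field.
  move=> h4; rewrite h4 in h3; rewrite -/a -/b in h1 h2; lra.
set d := _ - _.
(* The multiple of y is chosen so that the gain, of order d^2 / (q y + 1),
   must stay below the defect of e n. *)
have := Fsup (e n + (d / (q y + 1))%:C *: y).
have := he n.
rewrite /F phiD phiZ sipqD sipqZr sipZr conjc_real !reim mul0r subr0.
have -> : phi y = d + Re (B (e n) y) by rewrite /d subrK.
have Q0 := sipq_ge0 y; set Q := q y in Q0 *.
set r := Re _; move: (phi _) (q (e n)) (sup X) (dlt R n) => u v w z h1 h2.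
have Q1 : 0 < Q + 1 by lra.
rewrite -ler_pdivrMr//.
have dE : d = d / (Q + 1) * (Q + 1) by field; rewrite gt_eqF.
move: (d / (Q + 1)) dE h2 => D' -> h2.
have -> : (D' * (Q + 1)) ^+ 2 / (Q + 1) = D' ^+ 2 * Q + D' ^+ 2 by field; rewrite gt_eqF.
have : 2 * (u + D' * (D' * (Q + 1) + r)) - (v + 2 * (D' * r) + D' ^+ 2 * Q)
   = 2 * u - v + D' ^+ 2 * Q + 2 * D' ^+ 2 by ring.
by have := sqr_ge0 D'; move: (D' ^+ 2 * Q) (D' ^+ 2) h2 => X1 X2; lra.
Qed.

End SemiInnerProduct.

(** * Operators on Hilbert spaces *)

Section HilbertSpaces.
Variables (R : realType) (H : hilbert R).
Implicit Types (x y z : H) (A : bop H).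

Lemma hilb_sip : semi_ip (hilb_ip H).
Proof.
split=> [a x y z|x y|x].
- by rewrite linearPl.
- by rewrite (@hermitian_subproof _ _ _ _ (hilb_ip H)) expr0 mul1r.
- have [->|x0] := eqVneq x 0; first by rewrite linear0l.
  by apply/ltW/neq0_dnorm_gt0.
Qed.

(** Norms take values in R[i]; the squared norm as a real number is what the
    estimates use. *)
Definition hq x : R := Re (hilb_ip H x x).

Lemma hq_ge0 x : 0 <= hq x. Proof. exact: sipq_ge0 hilb_sip x. Qed.

Lemma hq_eq0 x : hq x = 0 -> x = 0.
Proof.
move=> h; apply/eqP/negPn/negP => x0.
have : 0 < hilb_ip H x x by exact: neq0_dnorm_gt0.
by rewrite (sipqE hilb_sip) -/(hq x) h ltxx.
Qed.

Lemma hilb_normE' x : `|x| = (Num.sqrt (hq x))%:C.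
Proof.
have h : `|x| ^+ 2 = ((Num.sqrt (hq x))%:C : R[i]) ^+ 2.
  rewrite hilb_normE (sipqE hilb_sip) -rmorphXn /= sqr_sqrtr//.
  exact: hq_ge0.
apply/eqP; rewrite -(@eqrXn2 _ 2)//; first exact/eqP.
by rewrite ler0c sqrtr_ge0.
Qed.

Lemma hq_lt x (e : R) : 0 < e -> (`|x| < e%:C) = (hq x < e ^+ 2).
Proof.
by move=> e0; rewrite hilb_normE' ltcR -[e in LHS]gtr0_norm// -sqrtr_sqr ltr_sqrt ?exprn_gt0.
Qed.

Lemma hilb_complete (e : nat -> H) :
  (forall eps : R, 0 < eps -> exists N, forall m n, (N <= m)%N -> (N <= n)%N ->
     hq (e m - e n) < eps) ->
  exists x, forall eps : R, 0 < eps -> exists N, forall n, (N <= n)%N ->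
     hq (x - e n) < eps.
Proof.
move=> he.
have posC (eps : R[i]) : 0 < eps -> exists2 r : R, 0 < r & eps = r%:C.
  move=> e0; exists (Re eps); last by apply: ge0cE; apply: ltW.
  by move: e0; rewrite ltcE /= => /andP[].
have ce : cauchy (e @ \oo).
  apply/cauchy_exP => eps /posC[r r0 ->].
  have [N hN] := he (r ^+ 2) (exprn_gt0 _ r0).
  exists (e N); exists N => // n /= Nn.
  by rewrite -ball_normE /= hq_lt//; apply: hN.
have /cvg_ex[x hx] : cvg (e @ \oo) by exact: cauchy_cvg.
exists x => eps eps0.
have s0 : 0 < Num.sqrt eps by rewrite sqrtr_gt0.
have /cvgrPdist_lt := hx => /(_ (Num.sqrt eps)%:C).
rewrite ltcR => /(_ s0)[N _ hN].
exists N => n Nn; have := hN n Nn; rewrite /= hq_lt// sqr_sqrtr//; exact: ltW.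
Qed.

Lemma bounded_opP (T : H -> H) (C : R) : linear T ->
  (forall x, hq (T x) <= C * hq x) -> T \in @bounded_op R H.
Proof.
move=> lT hT; apply/asboolP; split=> //.
pose lTm := GRing.isLinear.Build _ _ _ _ T lT.
pose T' : {linear H -> H} := HB.pack T lTm.
apply: (@bounded_linear_continuous _ _ _ T').
apply/linear_boundedP.
have D0 : 0 <= Num.max C 0 by rewrite le_max lexx orbT.
exists (Num.sqrt (Num.max C 0))%:C; split.
  by rewrite ger0_real// ler0c sqrtr_ge0.
move=> r hr x /=; apply: (@le_trans _ _ ((Num.sqrt (Num.max C 0))%:C * `|x|)).
  rewrite !hilb_normE' -rmorphM lecR -sqrtrM// ler_sqrt.
    by apply: (le_trans (hT x)); rewrite ler_wpM2r ?hq_ge0// le_max lexx.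
  by rewrite mulr_ge0 ?hq_ge0.
by rewrite ler_wpM2r// ltW.
Qed.

Lemma bop_bounded A : exists2 C : R, 0 <= C & forall x, hq (A x) <= C * hq x.
Proof.
have /asboolP[lT cT] := bop_funP A.
pose lTm := GRing.isLinear.Build _ _ _ _ (bop_fun A) lT.
pose T' : {linear H -> H} := HB.pack (bop_fun A) lTm.
have /linear_boundedP[r [rr hr]] : bounded_near T' (nbhs 0).
  by apply/linear_bounded_continuous.
pose s := Num.max (Re r) 0 + 1.
have s0 : 0 <= s by rewrite addr_ge0// le_max lexx orbT.
exists (s ^+ 2) => [|x]; first exact: exprn_ge0.
have /hr/(_ x) : r < s%:C.
  rewrite -(RRe_real rr) ltcR /s.
  by rewrite (@le_lt_trans _ _ (Num.max (Re r) 0)) ?le_max ?lexx// ltrDl.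
rewrite /= !hilb_normE' -rmorphM lecR => h.
rewrite -(sqr_sqrtr (hq_ge0 x)) -(sqr_sqrtr (hq_ge0 (A x))) -exprMn.
by rewrite lerXn2r// nnegrE ?mulr_ge0 ?sqrtr_ge0.
Qed.

Lemma opnorm_leP A (r : R) : 0 <= r ->
  opnorm_le A r <-> forall x, hq (A x) <= r ^+ 2 * hq x.
Proof.
move=> r0; have h x : (`|A x| <= r%:C * `|x|) = (hq (A x) <= r ^+ 2 * hq x).
  rewrite !hilb_normE' -rmorphM lecR -[LHS]ler_sqr ?nnegrE ?mulr_ge0 ?sqrtr_ge0//.
  by rewrite exprMn !sqr_sqrtr ?hq_ge0.
by split=> k x; have := k x; rewrite h.
Qed.

(** A real-linear functional suffices, since an antilinear one is determined
    by its real part. *)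
Lemma riesz_real (phi : H -> R) (C : R) :
  (forall x y, phi (x + y) = phi x + phi y) ->
  (forall (t : R) x, phi (t%:C *: x) = t * phi x) ->
  (forall x, phi x ^+ 2 <= C * hq x) ->
  exists x, forall y, Re (hilb_ip H x y) = phi y.
Proof.
move=> h1 h2 h3; have [e [ec eh]] := riesz_pre hilb_sip h1 h2 h3.
have [|x hx] := @hilb_complete e.
  move=> eps eps0; have e4 : 0 < eps / 4 by lra.
  have [N hN] := dlt_small e4; exists N => m n /hN hm /hN hn.
  have := ec m n; rewrite -/(hq _); lra.
exists x => y; apply/eqP; rewrite -subr_eq0 -sqrf_eq0; apply/eqP/le_anti.
rewrite sqr_ge0 andbT; apply/ler_addgt0Pl => eps eps0; rewrite addr0.
have Q := hq_ge0 y; have d0 : 0 < eps / (4 * (hq y + 1)) by rewrite divr_gt0//; lra.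
have [N hN] := hx _ d0; have [M hM] := dlt_small d0.
have k1 := hN (maxn N M) (leq_maxl _ _); have k2 := hM (maxn N M) (leq_maxr _ _).
move: (maxn N M) k1 k2 => n k1 k2; have k3 := eh y n.
have k4 := sip_CS hilb_sip (x - e n) y.
rewrite (sipB hilb_sip) ReB -!/(hq _) in k3 k4.
set b := phi y in k3 *; set c := Re _ in k3 k4; set a := Re _ in k4 *.
have hh : (a - b) ^+ 2 <= 2 * (a - c) ^+ 2 + 2 * (b - c) ^+ 2.
  rewrite -subr_ge0 (_ : _ - _ = (a - c + (b - c)) ^+ 2) ?sqr_ge0//; ring.
have m1 : dlt R n * (hq y + 1) <= eps / 4.
  rewrite -ler_pdivlMr; last lra.
  by rewrite -mulrA -invfM; exact: ltW.
have m2 : hq (x - e n) * hq y <= eps / 4.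
  apply: (@le_trans _ _ (hq (x - e n) * (hq y + 1))); first by rewrite ler_wpM2l ?hq_ge0//; lra.
  rewrite -ler_pdivlMr; last lra.
  by rewrite -mulrA -invfM; exact: ltW.
lra.
Qed.

End HilbertSpaces.

(** Equips a complete inner product space with the norm, topology and
    uniformity that the type of Hilbert spaces asks for. *)
Section HilbertOf.
Variables (R : realType) (V : lmodType R[i]) (ip : V -> V -> R[i]).

Definition ip_definite : Prop := forall x, Re (ip x x) = 0 -> x = 0.

Definition ip_complete : Prop := forall e : nat -> V,
  (forall eps : R, 0 < eps -> exists N, forall m n, (N <= m)%N -> (N <= n)%N ->
     Re (ip (e m - e n) (e m - e n)) < eps) ->
  exists x, forall eps : R, 0 < eps -> exists N, forall n, (N <= n)%N ->
     Re (ip (x - e n) (x - e n)) < eps.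

Hypotheses (ip_semi : semi_ip ip) (ip_def : ip_definite) (ip_comp : ip_complete).

(** The alias carries the three hypotheses, so that structures built from them
    can be inferred from the type. *)
Definition hspace (_ : semi_ip ip) (_ : ip_definite) (_ : ip_complete) : Type := V.

Let W := hspace ip_semi ip_def ip_comp.

HB.instance Definition _ := GRing.Lmodule.copy W V.

Definition hs_ip (x y : W) : R[i] := ip x y.

Let q (x : W) := Re (ip x x).

Definition hs_norm (x : W) : R[i] := (Num.sqrt (q x))%:C.

Lemma hs_normD (x y : W) : hs_norm (x + y) <= hs_norm x + hs_norm y.
Proof.
rewrite /hs_norm -rmorphD lecR.
have q0 z : 0 <= q z by exact: sipq_ge0.
rewrite -ler_sqr ?nnegrE ?addr_ge0 ?sqrtr_ge0// sqr_sqrtr// sqrrD !sqr_sqrtr//.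
rewrite {1}/q (sipqD ip_semi) -!/(q _) -addrA -addrA lerD2l lerD2r.
rewrite -[leRHS]mulr_natl ler_pM2l// -sqrtrM//.
apply: (le_trans (ler_norm _)); rewrite -sqrtr_sqr ler_sqrt ?mulr_ge0//.
exact: sip_CS.
Qed.

Lemma hs_normZ (a : R[i]) (x : W) : hs_norm (a *: x) = `|a| * hs_norm x.
Proof.
rewrite /hs_norm {1}/q (sipqZ ip_semi) sqrtrM ?addr_ge0 ?sqr_ge0//.
by rewrite normc_def -rmorphM.
Qed.

Lemma hs_norm0_eq0 (x : W) : hs_norm x = 0 -> x = 0.
Proof.
move=> /eqP; rewrite /hs_norm -[0]/(0%:C) => /eqP[/eqP].
rewrite sqrtr_eq0 => h; apply: ip_def; apply/le_anti; rewrite h.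
exact: sipq_ge0.
Qed.

HB.instance Definition _ :=
  Lmodule_isNormed.Build R[i] W hs_normD hs_normZ hs_norm0_eq0.

Lemma hs_lt (x : W) (e : R) : 0 < e -> (`|x| < e%:C) = (q x < e ^+ 2).
Proof.
move=> e0; rewrite [`|x|]/(hs_norm x) ltcR -[e in LHS]gtr0_norm//.
by rewrite -sqrtr_sqr ltr_sqrt ?exprn_gt0.
Qed.

Lemma hs_complete (F : set_system W) : ProperFilter F -> cauchy F -> cvg F.
Proof.
move=> FF /cauchyP hF.
have q0 z : 0 <= q z by exact: sipq_ge0.
have /choice[e he] n : exists x : W, F (ball x (dlt R n)%:C).
  by apply: hF; rewrite ltcR dlt_gt0.
have bq (x y : W) (r : R) : 0 < r -> ball x r%:C y -> q (x - y) < r ^+ 2.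
  by move=> r0; rewrite -ball_normE /= hs_lt.
have qtri (x y z : W) : q (x - z) <= 2 * q (x - y) + 2 * q (y - z).
  have := sipq_par ip_semi (x - y) (y - z).
  by rewrite (_ : x - y + (y - z) = x - z)// addrA subrK.
have eq m n : q (e m - e n) <= 2 * dlt R m ^+ 2 + 2 * dlt R n ^+ 2.
  have [z [/(bq _ _ _ (dlt_gt0 _ _)) h1 /(bq _ _ _ (dlt_gt0 _ _)) h2]] :=
    filter_ex (filterI (he m) (he n)).
  apply: (le_trans (qtri _ z _)).
  have -> : q (z - e n) = q (e n - z) by exact: sipqBC.
  lra.
have dsm n : dlt R n ^+ 2 <= dlt R n.
  have := dlt_gt0 R n => d0; rewrite expr2 ler_piMr ?(ltW d0)//.
  by rewrite invf_le1 ?ltr0n// ler1n.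
have [|x hx] := @ip_comp e.
  move=> eps eps0; have e4 : 0 < eps / 4 by lra.
  have [N hN] := dlt_small e4; exists N => m n /hN hm /hN hn.
  have := eq m n; rewrite -/(q _); have := dsm m; have := dsm n; lra.
apply/cvg_ex; exists x.
apply/cvgrPdist_lt => eps eps0.
have [r r0 ->] : exists2 r : R, 0 < r & eps = r%:C.
  exists (Re eps); last by apply: ge0cE; apply: ltW.
  by move: eps0; rewrite ltcE /= => /andP[].
have r4 : 0 < r ^+ 2 / 4 by rewrite divr_gt0// exprn_gt0.
have [N hN] := hx _ r4; have [M hM] := dlt_small r4.
have := hN (maxn N M) (leq_maxl _ _); have := hM (maxn N M) (leq_maxr _ _).
move: (maxn N M) => n k1 k2.
apply: filterS (he n) => y /(bq _ _ _ (dlt_gt0 _ _)) h.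
rewrite /= hs_lt//; have := qtri x (e n) y; have := dsm n; rewrite -/(q _) in k2; lra.
Qed.

HB.instance Definition _ := Uniform_isComplete.Build W hs_complete.

Lemma hs_ip_bilinear : bilinear_for (GRing.mul : R[i] -> R[i] -> R[i])
  ((@Num.conj R[i]) \; GRing.mul) hs_ip.
Proof.
by split=> [z a x y|z a x y]; rewrite /hs_ip /= ?(sipE ip_semi).
Qed.

HB.instance Definition _ := bilinear_isBilinear.Build R[i] W W R[i] _ _ hs_ip
  hs_ip_bilinear.

Lemma hs_ip_herm (x y : W) : hs_ip x y = (-1) ^+ false * Num.conj (hs_ip y x).
Proof. by rewrite expr0 mul1r /hs_ip (sipC ip_semi). Qed.

HB.instance Definition _ :=
  isHermitianSesquilinear.Build R[i] W false (@Num.conj R[i]) hs_ip hs_ip_herm.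

Lemma hs_ip_gt0 (x : W) : x != 0 -> 0 < hs_ip x x.
Proof.
move=> x0; have [_ _ /(_ x)] := ip_semi; rewrite le_eqVlt => /predU1P[h|//].
by move/eqP: x0; case; apply: ip_def; rewrite -h.
Qed.

HB.instance Definition _ := isDotProduct.Build R[i] W hs_ip hs_ip_gt0.

Lemma hs_normE (x : W) : `|x| ^+ 2 = hs_ip x x.
Proof.
rewrite [`|x|]/(hs_norm x) /hs_norm -rmorphXn /= sqr_sqrtr ?sipq_ge0//.
by rewrite -(sipqE ip_semi).
Qed.

Definition hilbert_of : hilbert R := @Hilbert R W hs_ip hs_normE.

End HilbertOf.

(** A function homogeneous under multiplication by i has its imaginary part
    encoded in its real part. *)
Lemma re_form_ext (R : realType) (E : lmodType R[i]) (b c : E -> R[i]) :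
  (forall y, b ('i *: y) = - 'i * b y) -> (forall y, c ('i *: y) = - 'i * c y) ->
  (forall y, Re (b y) = Re (c y)) -> b =1 c.
Proof.
move=> hb hc h y; apply: cext => //; have := h ('i *: y).
by rewrite hb hc !mulNr !reim !mul0r !mul1r !sub0r !opprK.
Qed.

Lemma conj_mulE (R : realType) (a : R[i]) (u v : R) :
  (Re a * u + Im a * v) +i* (Re a * v - Im a * u) = conjc a * (u +i* v).
Proof.
by case: a => x y; apply: cext => /=; rewrite mulNr ?opprK.
Qed.

Section BoundedForms.
Variables (R : realType) (H : hilbert R).
Implicit Types (x y z : H) (A B : bop H).

Local Notation ip := (hilb_ip H).
Local Notation hB := (hilb_sip H).

Lemma ip_ext x y : (forall z, Re (ip x z) = Re (ip y z)) -> x = y.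
Proof.
move=> h; apply/eqP; rewrite -subr_eq0; apply/eqP/hq_eq0.
by rewrite /hq {1}(sipB hB) ReB h subrr.
Qed.

Lemma bop_add A B x : (A + B) x = A x + B x. Proof. by []. Qed.
Lemma bop_scale (a : R[i]) A x : (a *: A) x = a *: A x. Proof. by []. Qed.
Lemma bop_opp A x : (- A) x = - A x. Proof. by []. Qed.
Lemma bop_0 x : (0 : bop H) x = 0. Proof. by []. Qed.
Lemma bopD A x y : A (x + y) = A x + A y.
Proof. by have := bop_linear A 1 x y; rewrite !scale1r. Qed.
Lemma bop0 A : A 0 = 0.
Proof. by apply: (@addrI _ (A 0)); rewrite -bopD !addr0. Qed.
Lemma bopZ A a x : A (a *: x) = a *: A x.
Proof. by have := bop_linear A a x 0; rewrite !addr0 bop0 addr0. Qed.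
Lemma bop_sum A I (r : seq I) (P : pred I) (F : I -> H) :
  A (\sum_(i <- r | P i) F i) = \sum_(i <- r | P i) A (F i).
Proof. by elim/big_rec2: _ => [|i x y _ <-]; rewrite ?bop0 ?bopD. Qed.
Lemma bop_sumE I (r : seq I) (P : pred I) (F : I -> bop H) x :
  (\sum_(i <- r | P i) F i) x = \sum_(i <- r | P i) F i x.
Proof. by elim/big_rec2: _ => [|i y z _ <-]. Qed.

Lemma conjc_i : conjc ('i : R[i]) = - 'i.
Proof. by apply: cext; rewrite /= ?oppr0. Qed.

(** The theorem of Riesz represents the form in its second variable; the bound
    on the operator is the assumed inequality at [y = A x]. *)
Lemma bop_of_form (b : H -> H -> R[i]) (C : R) :
  (forall a x y z, b (a *: x + y) z = a * b x z + b y z) ->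
  (forall x y z, b x (y + z) = b x y + b x z) ->
  (forall a x y, b x (a *: y) = conjc a * b x y) ->
  (forall x y, Re (b x y) ^+ 2 <= C * hq x * hq y) ->
  exists A : bop H, forall x y, ip (A x) y = b x y.
Proof.
move=> bl bD bZ bb.
have /choice[T hT] x : exists z, forall y, Re (ip z y) = Re (b x y).
  apply: (@riesz_real _ _ (fun y => Re (b x y)) (C * hq x)) => [y z|t y|y].
  - by rewrite bD ReD.
  - by rewrite bZ !reim; ring.
  - exact: bb.
have TE x y : ip (T x) y = b x y.
  move: y; apply: re_form_ext => [y|y|y]; last exact: hT.
    by rewrite (sipZr hB) conjc_i.
  by rewrite bZ conjc_i.
have lT : linear T.
  move=> a x y; apply: ip_ext => z.
  by rewrite TE bl -!TE (sipD hB) (sipZ hB).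
have T_op : T \in @bounded_op R H.
  apply: (@bounded_opP _ _ _ C) => // x.
  have := bb x (T x); rewrite -TE -/(hq _).
  have := hq_ge0 (T x); rewrite le_eqVlt => /predU1P[<- h|h0].
    have [C0|C0] := leP 0 C; first by rewrite mulr_ge0// hq_ge0.
    have := bb x x; have := hq_ge0 x; rewrite le_eqVlt => /predU1P[<-|h1].
      by rewrite !mulr0.
    have := sqr_ge0 (Re (b x x)) => k1 k2.
    have : 0 <= C * hq x * hq x by exact: le_trans k2.
    by rewrite -mulrA nmulr_rge0// leNgt mulr_gt0.
  by rewrite expr2 ler_pM2r.
by exists (Bop T_op) => x y; exact: TE.
Qed.

Lemma adj_exists A : exists B : bop H, adjoint_of A B.
Proof.
have [C C0 hC] := bop_bounded A.
have [|||x y|B hBB] := @bop_of_form (fun x y => ip x (A y)) C.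
- by move=> a x y z; rewrite (sipD hB) (sipZ hB).
- by move=> x y z; rewrite bopD (sipDr hB).
- by move=> a x y; rewrite bopZ (sipZr hB).
- apply: (le_trans (sip_CS hB _ _)); rewrite -!/(hq _) mulrC mulrAC.
  by rewrite ler_wpM2r ?hq_ge0.
- by exists B => x y; rewrite (sipC hB) -hBB -(sipC hB).
Qed.

Definition adj A : bop H := projT1 (cid (adj_exists A)).

Lemma adjP A x y : ip (A x) y = ip x (adj A y).
Proof. by rewrite /adj; case: cid. Qed.

Lemma adjP' A x y : ip (adj A x) y = ip x (A y).
Proof. by rewrite (sipC hB) -adjP -(sipC hB). Qed.

Lemma bop_ext A B : (forall x y, ip (A x) y = ip (B x) y) -> A = B.
Proof.
by move=> h; apply/val_inj/funext => x; apply: ip_ext => y; rewrite h.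
Qed.

Lemma adj_uniq A B : adjoint_of A B -> B = adj A.
Proof.
move=> h; apply: bop_ext => x y.
by rewrite adjP' (sipC hB) -h -(sipC hB).
Qed.

Lemma adjK A : adj (adj A) = A.
Proof. by apply: bop_ext => x y; rewrite adjP' adjP. Qed.
Lemma adjD A B : adj (A + B) = adj A + adj B.
Proof.
by apply: bop_ext => x y; rewrite adjP' !bop_add (sipD hB) (sipDr hB) !adjP'.
Qed.
Lemma adjZ a A : adj (a *: A) = conjc a *: adj A.
Proof.
by apply: bop_ext => x y; rewrite adjP' !bop_scale (sipZ hB) (sipZr hB) !adjP'.
Qed.
Lemma adjM A B : adj (bop_comp A B) = bop_comp (adj B) (adj A).
Proof. by apply: bop_ext => x y; rewrite adjP' /= !adjP'. Qed.
Lemma adj1 : adj (bop1 H) = bop1 H.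
Proof. by apply: bop_ext => x y; rewrite adjP'. Qed.

Lemma opnorm_le_exists A : exists2 r : R, 0 < r & opnorm_le A r.
Proof.
have [C C0 h] := bop_bounded A; exists (C + 1); first by lra.
apply/opnorm_leP => [|x]; first by lra.
apply: (le_trans (h x)); rewrite ler_wpM2r ?hq_ge0//; nra.
Qed.

Lemma opnorm_le_adj A r : 0 <= r -> opnorm_le A r -> opnorm_le (adj A) r.
Proof.
move=> r0 /(opnorm_leP _ r0) h; apply/opnorm_leP => // x.
have := sip_CS hB x (A (adj A x)); rewrite -adjP' -!/(hq _) => k.
have := h (adj A x); have := hq_ge0 (adj A x).
rewrite le_eqVlt => /predU1P[<- _|k0 k1].
  by rewrite mulr_ge0 ?hq_ge0 ?exprn_ge0.
rewrite -(ler_pM2r k0) -expr2; apply: (le_trans k).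
by rewrite mulrAC [leLHS]mulrC ler_wpM2r ?hq_ge0.
Qed.

End BoundedForms.

(** The completion of a space with a semi-inner product is its antidual. This
    avoids quotients and Cauchy sequences: the dual of a normed space is
    always complete, and by [riesz_pre] the vectors are dense in it. *)
Section Completion.
Variables (R : realType) (E : lmodType R[i]) (B : E -> E -> R[i]).
Hypothesis hB : semi_ip B.

Let q x := Re (B x x).

Definition bdd_antilin : {pred E -> R[i]} := fun f =>
  `[< [/\ forall x y, f (x + y) = f x + f y,
          forall a x, f (a *: x) = conjc a * f x &
          exists2 C : R, 0 <= C & forall x, Re (f x) ^+ 2 <= C * q x] >].

Record compl_elt := ComplElt { compl_val : E -> R[i]; _ : compl_val \in bdd_antilin }.

HB.instance Definition _ := [isSub for compl_val].
HB.instance Definition _ := [Choice of compl_elt by <:].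

Lemma bdd_antilin_submod : submod_closed bdd_antilin.
Proof.
split=> [|a f g].
  apply/asboolP; split=> [x y|b x|]; rewrite ?addr0 ?mulr0//.
  by exists 0 => // x; rewrite mul0r expr0n.
move=> /asboolP[fD fZ [C C0 fb]] /asboolP[gD gZ [D D0 gb]]; apply/asboolP; split.
- move=> x y; rewrite -[LHS]/(a * f (x + y) + g (x + y)) fD gD mulrDr addrACA //.
- move=> b x; rewrite -[LHS]/(a * f (b *: x) + g (b *: x)) fZ gZ.
  rewrite -[RHS]/(conjc b * (a * f x + g x)); ring.
- have fi x : Im (f x) ^+ 2 <= C * q x.
    have := fb ('i *: x); rewrite fZ /q (sipqZ hB) conjc_i !reim.
    by rewrite expr0n expr1n add0r mul1r oppr0 mul0r sub0r mulN1r opprK.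
  exists (3 * ((Re a ^+ 2 + Im a ^+ 2) * C + D)) => [|x].
    by rewrite mulr_ge0// addr_ge0// mulr_ge0// addr_ge0// sqr_ge0.
  have Re2 (b c d : R[i]) : Re (b * c + d) = Re b * Re c - Im b * Im c + Re d.
    by rewrite ReD ReM.
  have -> : Re ((a *: f + g) x) = Re a * Re (f x) - Im a * Im (f x) + Re (g x).
    exact: (Re2 a (f x) (g x)).
  have := fb x; have := fi x; have := gb x.
  set u := Re (f x); set v := Im (f x); set w := Re (g x) => h1 h2 h3.
  apply: (@le_trans _ _ (3 * (Re a ^+ 2 * u ^+ 2 + Im a ^+ 2 * v ^+ 2 + w ^+ 2))).
    have := sqr_ge0 (Re a * u + Im a * v); have := sqr_ge0 (Re a * u - w).
    have := sqr_ge0 (Im a * v + w).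
    rewrite !sqrrD !exprMn !sqrrN; lra.
  have := ler_wpM2l (sqr_ge0 (Re a)) h3; have := ler_wpM2l (sqr_ge0 (Im a)) h2; lra.
Qed.

HB.instance Definition _ :=
  GRing.isSubmodClosed.Build R[i] (E -> R[i]) bdd_antilin bdd_antilin_submod.
HB.instance Definition _ := [SubChoice_isSubLmodule of compl_elt by <:].

Coercion compl_val : compl_elt >-> Funclass.

Implicit Types f g : compl_elt.

Lemma complP f : [/\ forall x y, f (x + y) = f x + f y,
          forall a x, f (a *: x) = conjc a * f x &
          exists2 C : R, 0 <= C & forall x, Re (f x) ^+ 2 <= C * q x].
Proof. by case: f => f fP; apply/asboolP. Qed.

Lemma compl_ext f g : f =1 g -> f = g.
Proof. by move=> h; apply/val_inj/funext. Qed.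

Lemma compl_addE f g x : (f + g) x = f x + g x. Proof. by []. Qed.
Lemma compl_oppE f x : (- f) x = - f x. Proof. by []. Qed.
Lemma compl_scaleE a f x : (a *: f) x = a * f x. Proof. by []. Qed.

(** The sequence [e] represents [f] in the limit, with the explicit rates of
    [riesz_pre]. *)
Definition repr_of f (e : nat -> E) : Prop :=
  (forall m n, q (e m - e n) <= 2 * (dlt R m + dlt R n)) /\
  (forall y n, (Re (f y) - Re (B (e n) y)) ^+ 2 <= dlt R n * (q y + 1)).

Lemma repr_exists f : exists e, repr_of f e.
Proof.
have [fD fZ [C C0 fb]] := complP f.
apply: (@riesz_pre _ _ _ hB (fun x => Re (f x)) C) => [x y|t x|x]; last exact: fb.
  by rewrite fD ReD.
by rewrite fZ !reim; ring.
Qed.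


Lemma repr_bdd f e : repr_of f e -> exists2 C : R, 0 < C & forall n, q (e n) <= C.
Proof.
move=> [h _]; exists (2 * q (e 0%N) + 8) => [|n].
  have := sipq_ge0 hB (e 0%N); rewrite -/(q _); lra.
have := sipq_par hB (e 0%N) (e n - e 0%N); rewrite addrC subrK -!/(q _).
have := h n 0%N; have d1 m : dlt R m <= 1 by rewrite /dlt invf_le1 ?ltr0n// ler1n.
have := d1 n; have := d1 0%N; lra.
Qed.

Definition rep f : nat -> E := projT1 (cid (repr_exists f)).
Lemma repP f : repr_of f (rep f). Proof. by rewrite /rep; case: cid. Qed.

Definition re_lim (u : nat -> R) := lim (u n @[n --> \oo]).

Lemma re_cauchy (u : nat -> R) :
  (forall eps, 0 < eps -> exists N, forall m n, (N <= m)%N -> (N <= n)%N ->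
     (u m - u n) ^+ 2 < eps) -> cvg (u n @[n --> \oo]).
Proof.
move=> h; apply: cauchy_cvg; apply/cauchy_exP => eps eps0.
have [N hN] := h _ (exprn_gt0 2 eps0).
exists (u N); exists N => // n /= Nn; rewrite -ball_normE /=.
have := hN N n (leqnn _) Nn; rewrite -[X in X < _]real_normK ?num_real//.
by rewrite ltr_sqr ?nnegrE// ltW.
Qed.

Lemma compl_eval_cvg f d g : repr_of g d -> cvg (Re (f (d n)) @[n --> \oo]).
Proof.
move=> gd; have [fD fZ [C C0 fb]] := complP f.
apply: re_cauchy => eps eps0.
have [|N hN] := @dlt_small R (eps / (4 * C + 4)); first by rewrite divr_gt0//; lra.
exists N => m n /hN hm /hN hn.
have -> : Re (f (d m)) - Re (f (d n)) = Re (f (d m - d n)).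
  by rewrite fD ReD -scaleN1r fZ rmorphN1 mulN1r ReN.
apply: (le_lt_trans (fb _)); apply: (@le_lt_trans _ _ (C * (2 * (dlt R m + dlt R n)))).
  by rewrite ler_wpM2l//; exact: gd.1.
have e1 : dlt R m * (4 * C + 4) < eps by rewrite -ltr_pdivlMr//; lra.
have e2 : dlt R n * (4 * C + 4) < eps by rewrite -ltr_pdivlMr//; lra.
have := dlt_gt0 R m; have := dlt_gt0 R n; nra.
Qed.

(** Approximating only the second argument makes the form visibly linear in
    the first. *)
Definition compl_re f g : R := re_lim (fun n => Re (f (rep g n))).

Lemma compl_re_cvg f g : (Re (f (rep g n)) @[n --> \oo]) --> compl_re f g.
Proof. exact: compl_eval_cvg (repP g). Qed.

Lemma compl_reD f f' g : compl_re (f + f') g = compl_re f g + compl_re f' g.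
Proof.
apply: cvg_lim => //.
under eq_fun do rewrite compl_addE ReD.
by apply: cvgD; exact: compl_re_cvg.
Qed.

Lemma compl_reZ (t : R) f g : compl_re (t%:C *: f) g = t * compl_re f g.
Proof.
apply: cvg_lim => //.
under eq_fun do rewrite compl_scaleE !reim mul0r subr0.
by apply: cvgM; [exact: cvg_cst|exact: compl_re_cvg].
Qed.

Lemma sqr_cvg0 (w : nat -> R) :
  (forall eps, 0 < eps -> exists N, forall n, (N <= n)%N -> w n ^+ 2 < eps) ->
  w n @[n --> \oo] --> 0.
Proof.
move=> h; apply/cvgrPdist_lt => eps eps0; have [N hN] := h _ (exprn_gt0 2 eps0).
exists N => // n /= /hN; rewrite sub0r normrN -[X in X < _]real_normK ?num_real//.
by rewrite ltr_sqr ?nnegrE// ltW.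
Qed.

(** Replacing a functional by its approximating vectors does not change limits
    along bounded sequences; applied to both arguments this gives the symmetry
    of the form. *)
Lemma cross_cvg f e d (C : R) : 0 < C ->
  (forall y n, (Re (f y) - Re (B (e n) y)) ^+ 2 <= dlt R n * (q y + 1)) ->
  (forall n, q (d n) <= C) ->
  forall a : R, Re (f (d n)) @[n --> \oo] --> a ->
  Re (B (e n) (d n)) @[n --> \oo] --> a.
Proof.
move=> C0 hf hC a ha.
suff h : Re (f (d n)) - Re (B (e n) (d n)) @[n --> \oo] --> 0.
  have k : Re (f (d n)) - (Re (f (d n)) - Re (B (e n) (d n))) @[n --> \oo] --> a - 0.
    exact: cvgB ha h.
  by move: k; rewrite subr0; under eq_fun do rewrite subKr.
apply: sqr_cvg0 => eps eps0.
have [|N hN] := @dlt_small R (eps / (C + 1)); first by rewrite divr_gt0//; lra.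
exists N => n /hN hn; apply: (le_lt_trans (hf _ _)).
have d0 := dlt_gt0 R n; apply: (@le_lt_trans _ _ (dlt R n * (C + 1))).
  by rewrite ler_pM2l// lerD2r hC.
by rewrite -ltr_pdivlMr//; lra.
Qed.

Lemma compl_reC f g : compl_re f g = compl_re g f.
Proof.
have [C C0 hC] := repr_bdd (repP g); have [D D0 hD] := repr_bdd (repP f).
have h3 := cross_cvg C0 (repP f).2 hC (@compl_re_cvg f g).
have h4 := cross_cvg D0 (repP g).2 hD (@compl_re_cvg g f).
move: h4; under eq_fun do rewrite (Re_sipC hB); move=> h4.
exact: cvg_unique h3 h4.
Qed.

Lemma compl_q_cvg f : q (rep f n) @[n --> \oo] --> compl_re f f.
Proof.
have [C C0 hC] := repr_bdd (repP f).
apply: (@cross_cvg f (rep f) (rep f) C C0 (repP f).2 hC); exact: compl_re_cvg.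
Qed.

Lemma compl_re_ge0 f : 0 <= compl_re f f.
Proof.
have h := @compl_q_cvg f; rewrite -(cvg_lim (@Rhausdorff R) h).
apply: limr_ge; first by apply/cvg_ex; exists (compl_re f f).
by near=> n; exact: sipq_ge0.
Unshelve. all: by end_near. Qed.

(** The norm [a] of [f] is a limit both of [Re (f e)] and of [q e], so that
    the bound gives [a^2 <= C a]. *)
Lemma compl_re_le f (C : R) : 0 <= C ->
  (forall y, Re (f y) ^+ 2 <= C * q y) -> compl_re f f <= C.
Proof.
move=> C0 h; have a0 := compl_re_ge0 f.
have c1 : Re (f (rep f n)) ^+ 2 @[n --> \oo] --> compl_re f f ^+ 2.
  by rewrite expr2; under eq_fun do rewrite expr2; apply: cvgM; exact: compl_re_cvg.
have c2 : C * q (rep f n) @[n --> \oo] --> C * compl_re f f.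
  by apply: cvgM; [exact: cvg_cst|exact: compl_q_cvg].
have : compl_re f f ^+ 2 <= C * compl_re f f.
  rewrite -(cvg_lim (@Rhausdorff R) c1) -(cvg_lim (@Rhausdorff R) c2).
  apply: ler_lim; [by apply/cvg_ex; eexists; exact: c1|by apply/cvg_ex; eexists; exact: c2|].
  by near=> n; exact: h.
move: a0; rewrite le_eqVlt => /predU1P[<-//|a0].
by rewrite expr2 ler_pM2r.
Unshelve. all: by end_near. Qed.

Lemma compl_reN f g : compl_re (- f) g = - compl_re f g.
Proof. by rewrite -scaleN1r -(rmorphN1 (real_complex R)) compl_reZ mulN1r. Qed.

Lemma repr_i f y n :
  (Re (('i *: f) y) - Re (B ('i *: rep f n) y)) ^+ 2 <= dlt R n * (q y + 1).
Proof.
have := (repP f).2 ('i *: y) n; have [_ fZ _] := complP f.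
rewrite fZ conjc_i compl_scaleE (sipZr hB) conjc_i (sipZ hB).
rewrite /q (sipqZ hB) /= expr0n expr1n add0r mul1r !mulNr !ReN -opprD.
by rewrite sqrrN.
Qed.

Lemma compl_re_i f g : compl_re ('i *: f) g = - compl_re f ('i *: g).
Proof.
rewrite [in RHS]compl_reC.
have [C C0 hC] := repr_bdd (repP g); have [D D0 hD] := repr_bdd (repP f).
have h3 := cross_cvg C0 (repr_i f) hC (@compl_re_cvg ('i *: f) g).
have h4 := cross_cvg D0 (repr_i g) hD (@compl_re_cvg ('i *: g) f).
have h5 : - Re (B ('i *: rep g n) (rep f n)) @[n --> \oo] --> - compl_re ('i *: g) f.
  exact: cvgN h4.
suff k : (fun n => - Re (B ('i *: rep g n) (rep f n))) =
         (fun n => Re (B ('i *: rep f n) (rep g n))).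
  by rewrite k in h5; exact: cvg_unique h3 h5.
apply/funext => n; rewrite !(sipZ hB) [B (rep g n) _](sipC hB) !reim.
by rewrite !mul0r !mul1r !sub0r opprK.
Qed.

(** The imaginary part is the one forced by linearity in [f]. *)
Definition compl_ip f g : R[i] := compl_re f g +i* compl_re (- 'i *: f) g.

Lemma compl_reZc a f g : compl_re (a *: f) g =
  Re a * compl_re f g - Im a * compl_re (- 'i *: f) g.
Proof.
have -> : a *: f = (Re a)%:C *: f + (- Im a)%:C *: (- 'i *: f).
  by rewrite scalerA -scalerDl; congr (_ *: _); apply: cext; rewrite !reim !zsimp.
by rewrite compl_reD !compl_reZ mulNr.
Qed.

Lemma compl_ip_semi : semi_ip compl_ip.
Proof.
split=> [a f f' g|f g|f].
- apply: cext; rewrite /compl_ip /= !reim /= ?scalerDr !compl_reD.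
    by rewrite compl_reZc.
  rewrite scalerA [compl_re ((- 'i * a) *: f) g]compl_reZc.
  have -> : Re (- 'i * a) = Im a by rewrite !reim !zsimp.
  have -> : Im (- 'i * a) = - Re a by rewrite !reim !zsimp.
  by rewrite mulNr opprK; congr (_ + _); rewrite [RHS]addrC.
- rewrite /compl_ip /=; congr (_ +i* _); first exact: compl_reC.
  have k (h h' : compl_elt) : compl_re (- 'i *: h) h' = - compl_re ('i *: h) h'.
    by rewrite scaleNr compl_reN.
  by rewrite !k compl_re_i !opprK [LHS]compl_reC.
- apply/ge0cP; split; first exact: compl_re_ge0.
  have k (h h' : compl_elt) : compl_re (- 'i *: h) h' = - compl_re ('i *: h) h'.
    by rewrite scaleNr compl_reN.
  rewrite /compl_ip /= k; have := compl_re_i f f; rewrite [X in _ = - X]compl_reC; lra.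
Qed.

Lemma emb_subproof (e : E) : (fun y => B e y) \in bdd_antilin.
Proof.
apply/asboolP; split=> [x y|a x|]; rewrite ?(sipDr hB) ?(sipZr hB)//.
exists (q e); first exact: sipq_ge0.
by move=> x; exact: sip_CS.
Qed.

Definition emb (e : E) : compl_elt := ComplElt (emb_subproof e).

Lemma compl_re_emb f e : compl_re f (emb e) = Re (f e).
Proof.
rewrite compl_reC; apply: cvg_lim => //.
have h : Re (f e) - Re (B (rep f n) e) @[n --> \oo] --> 0.
  apply: sqr_cvg0 => eps eps0.
  have Q := sipq_ge0 hB e; rewrite -/(q e) in Q.
  have [|N hN] := @dlt_small R (eps / (q e + 1)); first by rewrite divr_gt0//; lra.
  exists N => n /hN hn; apply: (le_lt_trans ((repP f).2 _ _)).
  by rewrite -ltr_pdivlMr//; lra.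
have k : Re (f e) - (Re (f e) - Re (B (rep f n) e)) @[n --> \oo] --> Re (f e) - 0.
  by apply: cvgB; [exact: cvg_cst|exact: h].
by move: k; rewrite subr0; under eq_fun do rewrite subKr (Re_sipC hB).
Qed.

Lemma compl_ip_emb f e : compl_ip f (emb e) = f e.
Proof.
rewrite /compl_ip !compl_re_emb compl_scaleE mulNr reim.
by apply: cext => //=; rewrite !reim !zsimp.
Qed.

Lemma compl_CS f e : Re (f e) ^+ 2 <= compl_re f f * q e.
Proof.
rewrite -compl_re_emb.
have -> : q e = compl_re (emb e) (emb e) by rewrite compl_re_emb.
exact: (sip_CS compl_ip_semi f (emb e)).
Qed.

Lemma compl_ext_re f g : (forall y, Re (f y) = Re (g y)) -> f = g.
Proof.
move=> h; have [_ fZ _] := complP f; have [_ gZ _] := complP g.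
by apply/compl_ext/re_form_ext => // y; rewrite ?fZ ?gZ conjc_i.
Qed.

Lemma compl_definite : ip_definite compl_ip.
Proof.
move=> f /= h; apply: compl_ext_re => y; apply/eqP.
rewrite -sqrf_eq0; apply/eqP/le_anti; rewrite sqr_ge0 andbT.
by apply: (le_trans (compl_CS f y)); rewrite h mul0r.
Qed.

(** A Cauchy sequence of functionals converges pointwise, and the limit
    inherits the bounds. *)
Lemma compl_complete : ip_complete compl_ip.
Proof.
move=> phi hphi.
have conv y : cvg (Re (phi n y) @[n --> \oo]).
  apply: re_cauchy => eps eps0; have Q := sipq_ge0 hB y; rewrite -/(q y) in Q.
  have [|N hN] := hphi (eps / (q y + 1)); first by rewrite divr_gt0//; lra.
  exists N => m n Nm Nn; have := hN m n Nm Nn.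
  rewrite ltr_pdivlMr; last by lra.
  move=> h; rewrite -ReB -compl_oppE -compl_addE.
  apply: (le_lt_trans (compl_CS _ y)).
  apply: le_lt_trans h; rewrite ler_wpM2l ?compl_re_ge0//; lra.
pose re (y : E) : R := re_lim (fun n => Re (phi n y)).
have reP y : Re (phi n y) @[n --> \oo] --> re y by exact: conv.
have reD x y : re (x + y) = re x + re y.
  apply: cvg_lim => //.
  have -> : (fun n => Re (phi n (x + y))) = (fun n => Re (phi n x) + Re (phi n y)).
    by apply/funext => n; have [fD _ _] := complP (phi n); rewrite fD ReD.
  exact: cvgD (reP x) (reP y).
have reZ (t : R) y : re (t%:C *: y) = t * re y.
  apply: cvg_lim => //.
  have -> : (fun n => Re (phi n (t%:C *: y))) = (fun n => t * Re (phi n y)).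
    by apply/funext => n; have [_ fZ _] := complP (phi n); rewrite fZ !reim !zsimp.
  by apply: cvgM; [exact: cvg_cst|exact: reP].
have close (eps : R) : 0 < eps -> exists N, forall n, (N <= n)%N -> forall y,
    (re y - Re (phi n y)) ^+ 2 <= eps * q y.
  move=> eps0; have [N hN] := hphi _ eps0; exists N => n Nn y.
  have c1 : (Re (phi m y) - Re (phi n y)) ^+ 2 @[m --> \oo] --> (re y - Re (phi n y)) ^+ 2.
    rewrite expr2; under eq_fun do rewrite expr2.
    by apply: cvgM; apply: cvgB; [exact: reP|exact: cvg_cst|exact: reP|exact: cvg_cst].
  rewrite -(cvg_lim (@Rhausdorff R) c1); apply: limr_le.
    by apply/cvg_ex; eexists; exact: c1.
  exists N => // m /= Nm; rewrite -ReB -compl_oppE -compl_addE.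
  apply: (le_trans (compl_CS _ y)); rewrite ler_wpM2r ?sipq_ge0//.
  by apply: ltW; exact: hN.
have [N hN] := close 1 ltr01.
have re_bdd : exists2 C, 0 <= C & forall y, re y ^+ 2 <= C * q y.
  exists (2 * (1 + compl_re (phi N) (phi N))) => [|y].
    by rewrite mulr_ge0// addr_ge0// compl_re_ge0.
  have := hN N (leqnn _) y; have := compl_CS (phi N) y.
  have := sqr_ge0 (re y - 2 * Re (phi N y)).
  rewrite !sqrrB exprMn; move: (Re _) => r; set a := r ^+ 2; nra.
pose f y : R[i] := re y +i* re ('i *: y).
have fP : f \in bdd_antilin.
  apply/asboolP; split=> [x y|a y|].
  - by apply: cext; rewrite ?ReD ?ImD /f /= ?scalerDr !reD.
  - have rea : re (a *: y) = Re a * re y + Im a * re ('i *: y).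
      rewrite -!reZ -reD scalerA -scalerDl; congr re; congr (_ *: _).
      by apply: cext; rewrite !reim !zsimp.
    have reia : re ('i *: (a *: y)) = Re a * re ('i *: y) - Im a * re y.
      have -> : Re a * re ('i *: y) - Im a * re y =
          re ((Re a)%:C *: ('i *: y)) + re ((- Im a)%:C *: y) by rewrite !reZ mulNr.
      rewrite -reD !scalerA -scalerDl; congr re; congr (_ *: _).
      by apply: cext; rewrite !reim !zsimp.
    rewrite /f rea reia; move: (re y) (re ('i *: y)) => u v.
    exact: conj_mulE.
  - by have [C C0 hC] := re_bdd; exists C.
exists (ComplElt fP) => eps eps0.
have e2 : 0 < eps / 2 by lra.
have [M hM] := close _ e2; exists M => n Mn.
apply: (@le_lt_trans _ _ (eps / 2)); last by lra.
apply: compl_re_le => [|y]; first exact: ltW.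
by rewrite compl_addE compl_oppE ReB; exact: hM.
Qed.

Definition completion : hilbert R :=
  hilbert_of compl_ip_semi compl_definite compl_complete.

End Completion.

(** * The Hahn-Banach theorem *)

Section HahnBanach.
Variables (R : realType) (V : lmodType R[i]).

Definition rsubspace (U : set V) : Prop :=
  (forall u v, U u -> U v -> U (u + v)) /\ (forall (t : R) u, U u -> U (t%:C *: u)).

(** A pair [(v, r)] of the cone stands for the requirement [g v <= r] on the
    functional [g] to be found. The last condition says that these
    requirements do not contradict each other. *)
Definition bcone (Q : V -> R -> Prop) : Prop :=
  [/\ forall u v r s, Q u r -> Q v s -> Q (u + v) (r + s),
      forall (t : R) u r, 0 <= t -> Q u r -> Q (t%:C *: u) (t * r) &
      forall r, Q 0 r -> 0 <= r].

Lemma maximal_bcone (Q : V -> R -> Prop) : bcone Q -> Q 0 0 ->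
  exists A, [/\ bcone A, forall v r, Q v r -> A v r &
    forall A', bcone A' -> (forall v r, A v r -> A' v r) ->
      forall v r, A' v r -> A v r].
Proof.
move=> [QD QZ Q0] Q00.
(* The empty set is admitted because it is the union of the empty chain. *)
pose P := [set X : set (V * R) | X = set0 \/
  bcone (fun v r => X (v, r)) /\ (forall v r, Q v r -> X (v, r))].
have [|A [PA Amax]] := @Zorn_bigcup (V * R)%type P.
  move=> F FP Ftot.
  have [F0|/existsNP[X0 /not_implyP[FX0 X0n]]] := pselect (forall X, F X -> X = set0).
    by left; rewrite -subset0 => x [X FX]; rewrite (F0 X FX).
  have FX0' : forall v r, Q v r -> X0 (v, r) by have [//|[]] := FP _ FX0.
  right; split=> [|v r Qvr]; last by exists X0 => //; apply: FX0'.
  have XC X x : F X -> X x -> bcone (fun v r => X (v, r)).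
    by move=> FX Xx; have [X0'|[]//] := FP _ FX; rewrite X0' in Xx.
  split.
  - move=> u v r s [X FX Xu] [Y FY Yv]; have [XY|YX] := Ftot _ _ FX FY.
      by exists Y => //; have [h _ _] := XC _ _ FY Yv; apply: h => //; exact: XY.
    by exists X => //; have [h _ _] := XC _ _ FX Xu; apply: h => //; exact: YX.
  - move=> t u r t0 [X FX Xu]; exists X => //.
    by have [_ h _] := XC _ _ FX Xu; exact: h.
  - by move=> r [X FX Xu]; have [_ _ h] := XC _ _ FX Xu; exact: h.
have PQ : P [set x | Q x.1 x.2] by right.
have [A0|[Ac QA]] := PA.
  exfalso; apply: (Amax _ _ PQ); split; first by rewrite A0; exact: sub0set.
  by rewrite A0 => /(_ (0, 0) Q00).
exists (fun v r => A (v, r)); split=> // A' A'c AA' v r A'v.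
apply: contrapT => nA; apply: (Amax [set x | A' x.1 x.2]).
  by split=> [[u s] /AA'//|h]; apply: nA; exact: (h (v, r)).
by right; split=> // u s /QA/AA'.
Qed.

(** In a maximal consistent family of requirements every [u] of [U] satisfies
    both [g u <= c] and [g (- u) <= - c] for [c] the infimum of the bounds on
    [u]: adding either requirement keeps the family consistent. These values
    [c] define [g]. *)
Lemma hahn_banach (U : set V) (Q : V -> R -> Prop) :
  rsubspace U -> U 0 -> bcone Q -> (forall u, U u -> exists r, Q u r) ->
  exists g : V -> R, [/\ forall u v, U u -> U v -> g (u + v) = g u + g v,
    forall (t : R) u, U u -> g (t%:C *: u) = t * g u &
    forall u r, U u -> Q u r -> g u <= r].
Proof.
move=> [UD UZ] U0 Qc Qtot.
have Q00 : Q 0 0.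
  have [r Qr] := Qtot _ U0; have [_ QZ _] := Qc.
  by have := QZ 0 _ _ (lexx _) Qr; rewrite mul0r scaler0.
have [A [Ac QA Amax]] := maximal_bcone Qc Q00.
have [AD AZ A0] := Ac.
have UN u : U u -> U (- u).
  by move=> Uu; rewrite -scaleN1r -(rmorphN1 (real_complex R)); exact: UZ.
have A00 := QA _ _ Q00.
(* By maximality a requirement holds as soon as adding it stays consistent. *)
have ext (w : V) (c : R) :
    (forall t s : R, 0 <= t -> A (- (t%:C *: w)) (s - t * c) -> 0 <= s) -> A w c.
  move=> h; apply: (Amax (fun v r => exists2 t : R, 0 <= t & A (v - t%:C *: w) (r - t * c))).
  - split.
    + move=> u v r s [t t0 h1] [t' t'0 h2]; exists (t + t'); first exact: addr_ge0.
      rewrite rmorphD scalerDl mulrDl !opprD addrACA [X in A _ X]addrACA; exact: AD.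
    + move=> t u r t0 [t' t'0 h1]; exists (t * t'); first exact: mulr_ge0.
      by rewrite rmorphM -scalerA -scalerBr -mulrA -mulrBr; exact: AZ.
    + by move=> r [t t0]; rewrite sub0r; exact: h.
  - by move=> v r Avr; exists 0 => //; rewrite scale0r mul0r !subr0.
  - by exists 1; rewrite ?ler01// scale1r mul1r !subrr.
have key u : U u -> exists c, A u c /\ A (- u) (- c).
  move=> Uu; pose X := [set r | A u r].
  have [r0 Ar0] := Qtot _ Uu; have [s0 As0] := Qtot _ (UN _ Uu).
  have lbX : lbound X (- s0).
    move=> r Ar; rewrite lerNl -subr_ge0 opprK; apply: A0.
    by rewrite -(subrr u) addrC addrC; rewrite addrC; apply: AD => //; exact: QA.
  have Xinf : has_inf X by split; [exists r0; exact: QA|exists (- s0)].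
  exists (inf X); split; apply: ext => t s.
    rewrite le_eqVlt => /predU1P[<-|t0].
      by rewrite mul0r subr0 scale0r oppr0; exact: A0.
    move=> h; rewrite leNgt; apply/negP => s0'.
    have [|r Ar rlt] := @inf_adherent _ X (- s / t) _ Xinf.
      by rewrite divr_gt0// oppr_gt0.
    have := AD _ _ _ _ h (AZ t _ _ (ltW t0) Ar); rewrite addNr => /A0.
    have : (r - inf X) * t < - s by rewrite -ltr_pdivlMr//; lra.
    rewrite mulrBl; lra.
  rewrite le_eqVlt => /predU1P[<-|t0].
    by rewrite mul0r subr0 scale0r oppr0; exact: A0.
  rewrite scalerN opprK mulrN opprK => h.
  have := AZ t^-1 _ _ _ h; rewrite scalerA -rmorphM mulVf ?gt_eqF// scale1r.
  rewrite invr_ge0 (ltW t0) => /(_ isT) Au.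
  have : inf X <= t^-1 * (s + t * inf X) by apply: ge_inf => //; case: Xinf.
  rewrite mulrDr mulrA mulVf ?gt_eqF// mul1r; rewrite -subr_ge0 addrK.
  by rewrite pmulr_rge0 ?invr_gt0.
have /choice[g hg] u : exists c, U u -> A u c /\ A (- u) (- c).
  by have [/key[c hc]|nU] := pselect (U u); [exists c|exists 0].
have le u r s : A u r -> A (- u) (- s) -> s <= r.
  by move=> h1 h2; rewrite -subr_ge0; apply: A0; rewrite -(subrr u); exact: AD.
exists g; split=> [u v Uu Uv|t u Uu|u r Uu Qur].
- have [h1 h2] := hg _ Uu; have [h3 h4] := hg _ Uv; have [h5 h6] := hg _ (UD _ _ Uu Uv).
  apply/le_anti; apply/andP; split; [apply: le (AD _ _ _ _ h1 h3) h6|apply: le h5 _].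
  by rewrite !opprD; exact: AD.
- have [h1 h2] := hg _ Uu; have [h5 h6] := hg _ (UZ t _ Uu).
  have [t0|t0] := leP 0 t.
    apply/le_anti; apply/andP; split; [apply: le (AZ _ _ _ t0 h1) h6|apply: le h5 _].
    by rewrite -scalerN -mulrN; exact: AZ.
  have nt0 : 0 <= - t by rewrite oppr_ge0 ltW.
  have NN (w : V) : - ((- t)%:C *: w) = t%:C *: w by rewrite rmorphN scaleNr opprK.
  apply/le_anti; apply/andP; split; [apply: le _ h6|apply: le h5 _].
    by have := AZ _ _ _ nt0 h2; rewrite scalerN NN mulrNN.
  by have := AZ _ _ _ nt0 h1; rewrite mulNr rmorphN scaleNr.
- by have [_ h2] := hg _ Uu; apply: le h2; exact: QA.
Qed.

End HahnBanach.

(** * Operator systems and completely positive maps *)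

Lemma sum_pair (V : nmodType) (A1 A2 : finType) (F : A1 * A2 -> V) :
  \sum_z F z = \sum_x \sum_y F (x, y).
Proof. by rewrite pair_bigA; apply: eq_bigr => -[]. Qed.

Section OperatorSystemBasics.
Variable R : realType.
Implicit Types (S T U : opsys R) (H : hilbert R).

(** Matrices indexed by arbitrary finite types: block matrices are then
    indexed by products, sums or [bool] without reindexing. *)
Definition fpos H (X : finType) (P : X -> X -> bop H) : Prop :=
  forall xi : X -> H, 0 <= \sum_x \sum_y hilb_ip H (P x y (xi y)) (xi x).

Definition fmx (V : Type) (X : finType) (P : X -> X -> V) : 'M[V]_#|X| :=
  \matrix_(i, j) P (enum_val i) (enum_val j).

Lemma fpos_mx H (X : finType) (P : X -> X -> bop H) : bop_pos (fmx P) <-> fpos P.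
Proof.
have E (xi : X -> H) : \sum_x \sum_y hilb_ip H (P x y (xi y)) (xi x) =
    \sum_i \sum_j hilb_ip H (fmx P i j (xi (enum_val j))) (xi (enum_val i)).
  rewrite (reindex (@enum_val X predT)) /=; last first.
    by apply: onW_bij; exact: enum_val_bij.
  apply: eq_bigr => i _; rewrite (reindex (@enum_val X predT)) /=; last first.
    by apply: onW_bij; exact: enum_val_bij.
  by apply: eq_bigr => j _; rewrite mxE.
split=> h xi; first by rewrite E; exact: h.
have := h (fun x => xi (enum_rank x)); rewrite E.
congr (0 <= _); apply: eq_bigr => i _; apply: eq_bigr => j _.
by rewrite !enum_valK.
Qed.

Definition ospos S (X : finType) (P : X -> X -> S) : Prop :=
  fpos (fun x y => os_val (P x y)).

Lemma ospos_mx S (X : finType) (P : X -> X -> S) : os_pos (fmx P) <-> ospos P.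
Proof.
rewrite /ospos -fpos_mx /os_pos.
by rewrite (_ : map_mx _ _ = fmx (fun x y => os_val (P x y)))//; apply/matrixP => i j; rewrite !mxE.
Qed.

Lemma ospos_ord S n (A : 'M[S]_n) : os_pos A <-> ospos (fun i j => A i j).
Proof.
by split=> h xi; have := h xi; congr (0 <= _); apply: eq_bigr => i _;
  apply: eq_bigr => j _; rewrite mxE.
Qed.

Lemma cp_ospos S T (f : {linear S -> T}) (X : finType) (P : X -> X -> S) :
  cp f -> ospos P -> ospos (fun x y => f (P x y)).
Proof.
move=> fcp /ospos_mx/fcp h; apply/ospos_mx.
by rewrite (_ : fmx _ = map_mx f (fmx P))//; apply/matrixP => i j; rewrite !mxE.
Qed.

Lemma uco_ospos S T (f : {linear S -> T}) (X : finType) (P : X -> X -> S) :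
  uco_embedding f -> ospos (fun x y => f (P x y)) -> ospos P.
Proof.
move=> [_ fu] /ospos_mx h; apply/ospos_mx/fu.
by rewrite (_ : map_mx f _ = fmx (fun x y => f (P x y)))//; apply/matrixP => i j; rewrite !mxE.
Qed.

Lemma uco_cp S T (f : {linear S -> T}) : uco_embedding f -> cp f.
Proof. by move=> [_ fu] n A /fu. Qed.

Lemma cp_comp S T U (f : {linear S -> T}) (g : {linear T -> U}) (h : {linear S -> U}) :
  cp f -> cp g -> (forall x, h x = g (f x)) -> cp h.
Proof.
move=> fc gc E n A /fc/gc; congr os_pos.
by apply/matrixP => i j; rewrite !mxE E.
Qed.

Lemma os_valD S (x y : S) : os_val (x + y) = os_val x + os_val y.
Proof. by []. Qed.
Lemma os_valN S (x : S) : os_val (- x) = - os_val x.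
Proof. by []. Qed.
Lemma os_valZ S a (x : S) : os_val (a *: x) = a *: os_val x.
Proof. by []. Qed.

Definition spos S (s : S) : Prop := forall xi, 0 <= hilb_ip _ (os_val s xi) xi.

Lemma spos_ospos S (s : S) : spos s <-> ospos (fun _ _ : 'I_1 => s).
Proof.
split=> h xi; first by rewrite !big_ord1 /=; exact: h.
by have := h (fun _ => xi); rewrite !big_ord1.
Qed.

Lemma cp_spos S T (f : {linear S -> T}) s : cp f -> spos s -> spos (f s).
Proof. by move=> fc /spos_ospos h; apply/spos_ospos; exact: (cp_ospos fc h). Qed.


Definition mx2 (V : Type) (a b c d : V) (x y : bool) : V :=
  if x then (if y then a else b) else (if y then c else d).

Definition pos2 H (a b c d : bop H) : Prop := forall xi eta : H,
  0 <= hilb_ip H (a xi) xi + hilb_ip H (b eta) xi + hilb_ip H (c xi) eta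
       + hilb_ip H (d eta) eta.

Lemma pos2_fpos H (a b c d : bop H) : pos2 a b c d <-> fpos (mx2 a b c d).
Proof.
split=> h.
  by move=> xi; rewrite !big_bool /= addrA; have := h (xi true) (xi false).
by move=> xi eta; have := h (fun x => if x then xi else eta); rewrite !big_bool /= addrA.
Qed.

Lemma cp_pos2 S T (f : {linear S -> T}) a b c d : cp f ->
  pos2 (os_val a) (os_val b) (os_val c) (os_val d) ->
  pos2 (os_val (f a)) (os_val (f b)) (os_val (f c)) (os_val (f d)).
Proof.
move=> fc /pos2_fpos h; apply/pos2_fpos.
have : ospos (mx2 a b c d).
  by move=> xi; have := h xi; congr (0 <= _); rewrite !big_bool.
by move=> /(cp_ospos fc) k xi; have := k xi; congr (0 <= _); rewrite !big_bool.
Qed.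

Lemma ip_rZ1 H (r : R) xi : hilb_ip H ((r%:C *: bop1 H) xi) xi = (r * hq xi)%:C.
Proof.
by rewrite bop_scale /= (sipZ (hilb_sip H)) (sipqE (hilb_sip H)) -rmorphM.
Qed.

(** The 2 x 2 matrix with diagonal [r] and off-diagonal entries [A] and [adj
    A] is positive when the norm of [A] is at most [r]. Since it involves the
    matrix order only, completely positive maps control norms ([cp_norm],
    through the converse [pos2_bound]) and adjoints ([cp_star], through
    [pos2_adj]). *)
Lemma pos2_norm H (A : bop H) (r : R) : 0 <= r -> opnorm_le A r ->
  pos2 (r%:C *: bop1 H) A (adj A) (r%:C *: bop1 H).
Proof.
move=> r0 /(opnorm_leP _ r0) hA xi eta.
have hB := hilb_sip H.
rewrite !ip_rZ1 adjP' [hilb_ip H xi _](sipC hB).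
apply/ge0cP; rewrite !reim; split; last by ring.
have c1 := sip_CS hB (A eta) xi; rewrite -!/(hq _) in c1.
have := hA eta; have := hq_ge0 xi; have := hq_ge0 eta.
move: (hq xi) (hq eta) (hq (A eta)) (Re _) c1 => a b c d c1 b0 a0 k.
have : d ^+ 2 <= r ^+ 2 * b * a by apply: (le_trans c1); rewrite ler_wpM2r.
move=> h.
have h2 : (2 * d) ^+ 2 <= (r * (a + b)) ^+ 2.
  rewrite !exprMn; apply: (@le_trans _ _ (4 * (r ^+ 2 * b * a))); first by lra.
  rewrite -subr_ge0 (_ : _ - _ = r ^+ 2 * (a - b) ^+ 2); last by ring.
  by rewrite mulr_ge0// sqr_ge0.
have : `|2 * d| <= r * (a + b).
  rewrite -[leRHS]ger0_norm; last by rewrite mulr_ge0// addr_ge0.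
  by rewrite -ler_sqr ?nnegrE// !real_normK ?num_real.
rewrite ler_norml => /andP[h3 _]; lra.
Qed.

Lemma pos2_adj H (a b c d : bop H) : pos2 a b c d -> c = adj b.
Proof.
move=> h; have hB := hilb_sip H.
have ha xi : Im (hilb_ip H (a xi) xi) = 0.
  by have := h xi 0; rewrite !bop0 (sip0 hB) !(sip0r hB) !addr0 => /ge0cP[].
have hd eta : Im (hilb_ip H (d eta) eta) = 0.
  by have := h 0 eta; rewrite !bop0 !(sip0r hB) !(sip0 hB) !add0r => /ge0cP[].
have h1 xi eta : Im (hilb_ip H (b eta) xi) + Im (hilb_ip H (c xi) eta) = 0.
  by have := h xi eta => /ge0cP[_]; rewrite !reim ha hd add0r addr0.
apply: bop_ext => xi eta; rewrite adjP' [RHS](sipC hB).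
apply: cext; rewrite ?ReC ?ImC; last first.
  by have := h1 xi eta; lra.
have := h1 xi ('i *: eta); rewrite !bopZ (sipZ hB) (sipZr hB) conjc_i !reim.
rewrite !mul0r !mul1r !zsimp; lra.
Qed.

Lemma pos2_bound H (a b c d : bop H) (r : R) : 0 < r -> pos2 a b c d ->
  (forall xi, Re (hilb_ip H (a xi) xi) <= r * hq xi) ->
  (forall xi, Re (hilb_ip H (d xi) xi) <= r * hq xi) -> opnorm_le b r.
Proof.
move=> r0 h ha hd; have hB := hilb_sip H.
apply/opnorm_leP => [|eta]; first exact: ltW.
have /ge0cP[+ _] := h ((- r^-1)%:C *: b eta) eta.
rewrite (pos2_adj h) adjP' !reim.
have := ha ((- r^-1)%:C *: b eta); have := hd eta.
rewrite !(sipZ hB, sipZr hB) /hq (sipqZr hB) !conjc_real !reim -!/(hq _).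
rewrite (sipqE hB) -/(hq _) !zsimp sqrrN.
move: (hq (b eta)) (hq eta) (Re (hilb_ip H (d eta) eta)) (Re (hilb_ip H (a _) _)) => u v w z h1 h2.
have E : r * (r^-1 ^+ 2 * u) = r^-1 * u by field; rewrite gt_eqF.
rewrite E in h2; rewrite /= => h4.
have : r^-1 * u <= r * v by lra.
by rewrite ler_pdivrMl// mulrA -expr2.
Qed.

Lemma os_star_subproof S (s : S) : adj (os_val s) \in @os_pred R S.
Proof. by case: s => s hs; apply: (@os_adj R S s) => // x y; exact: adjP. Qed.
Definition os_star S (s : S) : S := OsElt (os_star_subproof s).

Lemma os_starD S (s t : S) : os_star (s + t) = os_star s + os_star t.
Proof. by apply/val_inj; rewrite /= adjD. Qed.
Lemma os_starZ S a (s : S) : os_star (a *: s) = conjc a *: os_star s.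
Proof. by apply/val_inj; rewrite /= adjZ. Qed.
Lemma os_starN S (s : S) : os_star (- s) = - os_star s.
Proof. by rewrite -[- s]scaleN1r os_starZ rmorphN1 scaleN1r. Qed.
Lemma os_starK S (s : S) : os_star (os_star s) = s.
Proof. by apply/val_inj; rewrite /= adjK. Qed.

Lemma opnorm_le_Re H (A : bop H) r xi : 0 <= r -> opnorm_le A r ->
  Re (hilb_ip H (A xi) xi) <= r * hq xi.
Proof.
move=> r0 /(pos2_norm r0)/(_ (- xi) xi)/ge0cP[+ _].
have hB := hilb_sip H.
rewrite !ip_rZ1 adjP' !(sipE hB) !reim [Re (hilb_ip H xi _)](Re_sipC hB).
rewrite /hq (sipqN hB); lra.
Qed.

Lemma cp_norm S T (f : {linear S -> T}) (C r : R) s : cp f -> 0 <= C -> 0 <= r ->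
  opnorm_le (os_val (f (os_one S))) C -> opnorm_le (os_val s) r ->
  opnorm_le (os_val (f s)) (C * r).
Proof.
move=> fc C0 r0 hC hr.
(* The slack e provides the strictly positive bound that pos2_bound needs when
   C * r = 0. *)
suff h (e : R) : 0 < e -> opnorm_le (os_val (f s)) (C * r + e).
  apply/opnorm_leP => [|x]; first exact: mulr_ge0.
  have Q := hq_ge0 x.
  apply/ler_addgt0Pl => eps eps0.
  pose D := (2 * (C * r) + 1) * hq x + 1.
  have Cr := mulr_ge0 C0 r0.
  have D0 : 0 < D by rewrite /D ltr_wpDl// mulr_ge0//; lra.
  pose e := Num.min 1 (eps / D).
  have e0 : 0 < e by rewrite lt_min ltr01 divr_gt0.
  have /opnorm_leP := h e e0 => /(_ _)/(_ x) hh; apply: (le_trans (hh _)); first by lra.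
  rewrite sqrrD mulrDl mulrDl [leRHS]addrC -addrA lerD2l.
  have e1 : e <= 1 by rewrite ge_min lexx.
  have e2 : e * D <= eps by rewrite -ler_pdivlMr// ge_min lexx orbT.
  apply: le_trans e2; rewrite /D mulrDr mulr1.
  have : e ^+ 2 * hq x <= e * hq x by rewrite ler_wpM2r// expr2 ler_piMl// ltW.
  rewrite -mulrnAr -mulr_natl; move: (hq x) (C * r) Q Cr => Q c Q0 c0 k.
  rewrite (_ : e * ((2 * c + 1) * Q) = 2 * (c * e) * Q + e * Q); last by ring.
  rewrite (_ : c * (2 * e) = 2 * (c * e)); last by ring.
  lra.
move=> e0.
pose r' := r + e / (C + 1).
have C1 : 0 < C + 1 by lra.
have e1 : 0 < e / (C + 1) by rewrite divr_gt0.
have r'0 : 0 < r' by rewrite /r'; lra.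
have hr' : opnorm_le (os_val s) r'.
  apply/opnorm_leP => [|x]; first exact: ltW.
  have /(opnorm_leP _ r0)/(_ x) hx := hr; apply: (le_trans hx).
  by rewrite ler_wpM2r ?hq_ge0// ler_sqr ?nnegrE//; rewrite /r'; lra.
have := @pos2_norm _ _ _ (ltW r'0) hr'.
move=> /(@cp_pos2 S T f (r'%:C *: os_one S) s (os_star s) (r'%:C *: os_one S) fc) k.
have bd xi : Re (hilb_ip _ (os_val (f (r'%:C *: os_one S)) xi) xi) <= (C * r + e) * hq xi.
  rewrite linearZ os_valZ bop_scale (sipZ (hilb_sip _)) !reim mul0r subr0.
  apply: (@le_trans _ _ (r' * (C * hq xi))).
    by rewrite ler_wpM2l ?(ltW r'0)//; exact: opnorm_le_Re.
  rewrite mulrA ler_wpM2r ?hq_ge0// /r' mulrDl [r * C]mulrC lerD2l.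
  rewrite mulrAC ler_pdivrMr// mulrDr mulr1; lra.
by apply: (pos2_bound _ k bd bd); have := mulr_ge0 C0 r0; lra.
Qed.

Lemma cp_bounded S T (f : {linear S -> T}) : cp f -> exists2 C : R, 0 < C &
  forall s r, 0 <= r -> opnorm_le (os_val s) r -> opnorm_le (os_val (f s)) (C * r).
Proof.
move=> fc; have [C C0 hC] := opnorm_le_exists (os_val (f (os_one S))).
by exists C => // s r r0 hr; apply: cp_norm => //; exact: ltW.
Qed.

Lemma opnorm_le1 H : opnorm_le (bop1 H) 1.
Proof. by move=> x; rewrite mul1r. Qed.

Lemma ucp_contractive S T (f : {linear S -> T}) s r : ucp f -> 0 <= r ->
  opnorm_le (os_val s) r -> opnorm_le (os_val (f s)) r.
Proof.
move=> [f1 fc] r0 h; rewrite -[r]mul1r; apply: cp_norm => //.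
by rewrite f1; exact: opnorm_le1.
Qed.

Lemma cp_star S T (f : {linear S -> T}) s : cp f -> f (os_star s) = os_star (f s).
Proof.
move=> fc; apply/val_inj => /=.
have [r r0 hr] := opnorm_le_exists (os_val s).
have := @pos2_norm _ _ _ (ltW r0) hr.
move=> /(@cp_pos2 S T f (r%:C *: os_one S) s (os_star s) (r%:C *: os_one S) fc).
exact: pos2_adj.
Qed.

End OperatorSystemBasics.

(** * Ultralimits and the double commutant expectation property *)

Lemma mk_linear (K : nzRingType) (V W : lmodType K) (f : V -> W) : linear f ->
  exists g : {linear V -> W}, g =1 f.
Proof.
move=> lf; pose m := GRing.isLinear.Build _ _ _ _ f lf.
by pose g : {linear V -> W} := HB.pack f m; exists g.
Qed.

Section Ultralimits.
Variables (R : realType) (X : Type) (F : set_system X).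
Context {FU : UltraFilter F}.

Lemma ultra_cvg (f : X -> R) (r : R) : F [set i | `|f i| <= r] -> cvg (f @ F).
Proof.
move=> Fr; have := @segment_compact R (- r) r; rewrite compact_ultra.
move=> /(_ (f @ F)) [].
- apply: Build_UltraFilter => G PG fG.
  apply/seteqP; split=> [A GA|//].
  have [//|fA] := in_ultra_setVsetC (f @^-1` A) FU.
  have GcA : G (~` A) by apply: fG.
  by have h0 : G (A `&` ~` A) by [exact: filterI]; rewrite setICr in h0; case: (filter_ex h0).
- change (F (f @^-1` `[- r, r])); apply: filterS Fr => i Hi.
  have h : `|f i| <= r by exact: Hi.
  by change (f i \in `[- r, r]%R); rewrite in_itv /= -ler_norml.
- by move=> l [_ h]; apply/cvg_ex; exists l.
Qed.

(** Componentwise convergence of complex scalars, so that the limit theory of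
    the real line applies. *)
Definition zcvg (z : X -> R[i]) (l : R[i]) : Prop :=
  Re (z i) @[i --> F] --> Re l /\ Im (z i) @[i --> F] --> Im l.

Lemma zcvg_unique z l m : zcvg z l -> zcvg z m -> l = m.
Proof.
by move=> [h1 h2] [h3 h4]; apply: cext; [exact: cvg_unique h1 h3|exact: cvg_unique h2 h4].
Qed.

Lemma zcvg_lin a z w l m : zcvg z l -> zcvg w m ->
  zcvg (fun i => a * z i + w i) (a * l + m).
Proof.
move=> [h1 h2] [h3 h4]; split; rewrite !reim; under eq_fun do rewrite !reim.
  by apply: cvgD => //; apply: cvgB; apply: cvgM => //; exact: cvg_cst.
by apply: cvgD => //; apply: cvgD; apply: cvgM => //; exact: cvg_cst.
Qed.

Lemma zcvg_cst l : zcvg (fun=> l) l.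
Proof. by split; exact: cvg_cst. Qed.

Lemma zcvgD z w l m : zcvg z l -> zcvg w m -> zcvg (fun i => z i + w i) (l + m).
Proof.
move=> h1 h2; have := zcvg_lin 1 h1 h2; rewrite mul1r.
by rewrite (_ : (fun i => _) = (fun i => z i + w i))//; apply/funext => i; rewrite mul1r.
Qed.

Lemma zcvg_sum I (r : seq I) (z : I -> X -> R[i]) (l : I -> R[i]) :
  (forall j, zcvg (z j) (l j)) ->
  zcvg (fun i => \sum_(j <- r) z j i) (\sum_(j <- r) l j).
Proof.
move=> h; elim: r => [|j r IH].
  by rewrite big_nil; under eq_fun do rewrite big_nil; exact: zcvg_cst.
by rewrite big_cons; under eq_fun do rewrite big_cons; exact: zcvgD.
Qed.


Lemma zcvg_ge0 z l : zcvg z l -> (forall i, 0 <= z i) -> 0 <= l.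
Proof.
move=> [h1 h2] h; apply/ge0cP; split.
  rewrite -(cvg_lim (@Rhausdorff R) h1); apply: limr_ge.
    by apply/cvg_ex; exists (Re l).
  by apply: nearW => i; have /ge0cP[] := h i.
have E : (fun i => Im (z i)) = fun=> 0 by apply/funext => i; have /ge0cP[] := h i.
by rewrite E in h2; exact: cvg_unique h2 (cvg_cst _).
Qed.

Variables (S : opsys R) (H : hilbert R) (phi : X -> S -> bop H).
Hypothesis phi_lin : forall i, linear (phi i).
Hypothesis phi_bdd : forall s, exists2 r : R, 0 <= r & forall i, opnorm_le (phi i s) r.

Local Notation ip := (hilb_ip H).

Lemma phi_ip_cvg s x y : exists l, zcvg (fun i => ip (phi i s x) y) l.
Proof.
have [r r0 hr] := phi_bdd s.
have key z i : Re (ip (phi i s x) z) ^+ 2 <= (r ^+ 2 * hq x * hq z + 1) ^+ 2.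
  apply: (@le_trans _ _ (r ^+ 2 * hq x * hq z)).
    apply: (le_trans (sip_CS (hilb_sip H) _ _)); rewrite ler_wpM2r ?hq_ge0//.
    by have /(opnorm_leP _ r0) := hr i; exact.
  have : 0 <= r ^+ 2 * hq x * hq z by rewrite !mulr_ge0 ?hq_ge0.
  by move: (_ * hq z) => t t0; rewrite sqrrD; have := sqr_ge0 t; lra.
have cv z : cvg (Re (ip (phi i s x) z) @[i --> F]).
  apply: (@ultra_cvg _ (r ^+ 2 * hq x * hq z + 1)); apply: filterE => i /=.
  have t0 : 0 <= r ^+ 2 * hq x * hq z + 1 by rewrite addr_ge0// !mulr_ge0 ?hq_ge0.
  by rewrite -ler_sqr ?nnegrE// real_normK ?num_real.
exists (lim (Re (ip (phi i s x) y) @[i --> F]) +i*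
        lim (Re (ip (phi i s x) ('i *: y)) @[i --> F])).
split; first exact: cv.
rewrite [Im (_ +i* _)]/=.
have -> : (fun i => Im (ip (phi i s x) y)) = (fun i => Re (ip (phi i s x) ('i *: y))).
  by apply/funext => i; rewrite (sipZr (hilb_sip H)) conjc_i !reim !zsimp.
exact: cv.
Qed.

(** For fixed s, x, y the scalars are bounded, so they converge along the
    ultrafilter; the limits form a bounded sesquilinear form in x and y. *)
Lemma ultralimit : exists psi : {linear S -> fullsys H},
  forall s x y, zcvg (fun i => ip (phi i s x) y) (ip (os_val (psi s) x) y).
Proof.
have hB := hilb_sip H.
have phiD i s t : phi i (s + t) = phi i s + phi i t.
  by have := phi_lin i 1 s t; rewrite !scale1r.
have ex s : exists A : bop H, forall x y, zcvg (fun i => ip (phi i s x) y) (ip (A x) y).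
  have /choice[b0 hb0] (p : H * H) := phi_ip_cvg s p.1 p.2.
  pose b x y := b0 (x, y); have hb x y : zcvg (fun i => ip (phi i s x) y) (b x y).
    exact: hb0 (x, y).
  have [r r0 hr] := phi_bdd s.
  have [|||x y|A hA] := @bop_of_form _ _ b (r ^+ 2).
  - move=> a x y z; apply: zcvg_unique (hb _ _) _.
    have := zcvg_lin a (hb x z) (hb y z); congr zcvg; apply/funext => i.
    by rewrite bopD bopZ (sipD hB) (sipZ hB).
  - move=> x y z; apply: zcvg_unique (hb _ _) _.
    have := zcvgD (hb x y) (hb x z); congr zcvg; apply/funext => i.
    by rewrite (sipDr hB).
  - move=> a x y; apply: zcvg_unique (hb _ _) _.
    have := zcvg_lin (conjc a) (hb x y) (zcvg_cst 0); rewrite addr0.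
    congr zcvg; apply/funext => i.
    by rewrite (sipZr hB) addr0.
  - have [h _] := hb x y.
    have c1 : Re (ip (phi i s x) y) ^+ 2 @[i --> F] --> Re (b x y) ^+ 2.
      by rewrite expr2; under eq_fun do rewrite expr2; apply: cvgM.
    rewrite -(cvg_lim (@Rhausdorff R) c1); apply: limr_le.
      by apply/cvg_ex; eexists; exact: c1.
    apply: nearW => i; apply: (le_trans (sip_CS hB _ _)).
    by rewrite ler_wpM2r ?hq_ge0//; have /(opnorm_leP _ r0) := hr i; exact.
  - by exists A => x y; rewrite hA; exact: hb.
have /choice[psi hpsi] := ex.
have lpsi : linear (fun s => OsElt (isT : psi s \in @os_pred R (fullsys H)) : fullsys H).
  move=> a s t; apply/val_inj/bop_ext => x y /=.
  rewrite -[LHS]/(ip (psi (a *: s + t) x) y) -[RHS]/(ip (a *: psi s x + psi t x) y).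
  apply: zcvg_unique (hpsi _ x y) _.
  rewrite (sipD hB) (sipZ hB).
  have := zcvg_lin a (hpsi s x y) (hpsi t x y); congr zcvg; apply/funext => i.
  by rewrite phi_lin bop_add bop_scale (sipD hB) (sipZ hB).
have [Psi PsiE] := mk_linear lpsi.
by exists Psi => s x y; rewrite PsiE; exact: hpsi.
Qed.

Lemma ultralimit_cp (psi : {linear S -> fullsys H}) :
  (forall s x y, zcvg (fun i => ip (phi i s x) y) (ip (os_val (psi s) x) y)) ->
  (forall i n (A : 'M[S]_n), os_pos A -> bop_pos (map_mx (phi i) A)) -> cp psi.
Proof.
move=> hpsi hphi n A Apos xi.
apply: (@zcvg_ge0 (fun k => \sum_i \sum_j ip (map_mx (phi k) A i j (xi j)) (xi i))).
  apply: zcvg_sum => i; apply: zcvg_sum => j; rewrite !mxE.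
  by under eq_fun do rewrite mxE; exact: hpsi.
by move=> k; exact: hphi.
Qed.

Lemma ultralimit_norm (psi : {linear S -> fullsys H}) s (r : R) :
  (forall s x y, zcvg (fun i => ip (phi i s x) y) (ip (os_val (psi s) x) y)) ->
  0 <= r -> F [set i | opnorm_le (phi i s) r] -> opnorm_le (os_val (psi s)) r.
Proof.
move=> hpsi r0 Fr; apply/opnorm_leP => // x.
have [h _] := hpsi s x (os_val (psi s) x).
have c1 : Re (ip (phi i s x) (os_val (psi s) x)) ^+ 2 @[i --> F] --> hq (os_val (psi s) x) ^+ 2.
  by rewrite expr2; under eq_fun do rewrite expr2; apply: cvgM.
have : hq (os_val (psi s) x) ^+ 2 <= r ^+ 2 * hq x * hq (os_val (psi s) x).
  rewrite -(cvg_lim (@Rhausdorff R) c1); apply: limr_le.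
    by apply/cvg_ex; eexists; exact: c1.
  apply: filterS Fr => i /(opnorm_leP _ r0) hi.
  apply: (le_trans (sip_CS (hilb_sip H) _ _)).
  by rewrite ler_wpM2r ?hq_ge0//; exact: hi.
have := hq_ge0 (os_val (psi s) x); rewrite le_eqVlt => /predU1P[<- _|h0].
  by rewrite mulr_ge0 ?hq_ge0 ?exprn_ge0.
by rewrite expr2 ler_pM2r.
Qed.

End Ultralimits.

Section DCEP.
Variable R : realType.

Lemma op_closure_approx (S : opsys R) (S_ : nat -> opsys R)
    (l : forall n, {linear S_ n -> S}) :
  @os_set R S = op_closure (\bigcup_n range (fun x => os_val (l n x))) ->
  forall s (e : R), 0 < e -> exists n x, opnorm_le (os_val (s - l n x)) e.
Proof.
move=> hS s e e0; have : @os_set R S (os_val s) by case: s.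
by rewrite hS => /(_ e e0)[_ [n _ [x _ <-]] h]; exists n, x.
Qed.

Lemma opnorm_leB (H : hilbert R) (A B : bop H) (r s : R) :
  opnorm_le A r -> opnorm_le B s -> opnorm_le (A - B) (r + s).
Proof.
move=> hA hB x; rewrite rmorphD mulrDl.
by apply: le_trans (ler_normB _ _) _; apply: lerD; [exact: hA|exact: hB].
Qed.


Lemma opnorm_le_eq0 (H : hilbert R) (A : bop H) (C : R) :
  (forall e : R, 0 < e -> opnorm_le A (C * e)) -> 0 < C -> A = 0.
Proof.
move=> h C0; apply: bop_ext => x y; rewrite bop_0 (sip0 (hilb_sip H)).
suff -> : A x = 0 by rewrite (sip0 (hilb_sip H)).
apply: hq_eq0; apply/le_anti; rewrite hq_ge0 andbT.
apply/ler_addgt0Pl => eps eps0; rewrite addr0.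
have Q := hq_ge0 x.
pose e := Num.min 1 (eps / (hq x + 1)) / C.
have d0 : 0 < eps / (hq x + 1) by rewrite divr_gt0//; lra.
have m0 : 0 < Num.min 1 (eps / (hq x + 1)) by rewrite lt_min ltr01.
have e0 : 0 < e by rewrite /e divr_gt0.
have := h _ e0; rewrite /e mulrC divfK ?gt_eqF// => /(opnorm_leP _ (ltW m0))/(_ x) k.
apply: (le_trans k).
have m1 : Num.min 1 (eps / (hq x + 1)) <= 1 by rewrite ge_min lexx.
have m2 : Num.min 1 (eps / (hq x + 1)) <= eps / (hq x + 1) by rewrite ge_min lexx orbT.
move: (Num.min _ _) m0 m1 m2 => m m0 m1 m2.
apply: (@le_trans _ _ (m * (hq x + 1))).
  rewrite expr2 -mulrA ler_pM2l//; nra.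
by rewrite -ler_pdivlMr//; lra.
Qed.

(** The ultralimit of expectations for the stages. Its values commute with the
    commutant of [i S] because those of each expectation do, the double
    commutants of the stages being contained in that of [i S]. *)
Lemma DCEP_limit (S_ : nat -> opsys R) (u : forall n, {linear S_ n -> S_ n.+1})
    (S : opsys R) (l : forall n, {linear S_ n -> S}) :
  is_inductive_limit u l -> (forall n, has_DCEP (S_ n)) -> has_DCEP S.
Proof.
move=> [lemb lcompat lclos _] hD H i iemb.
have [i1 ipos] := iemb.
have lu m n : (m <= n)%N -> forall x, exists y, l m x = l n y.
  elim: n => [|n IH]; first by rewrite leqn0 => /eqP -> x; exists x.
  rewrite leq_eqVlt => /predU1P[-> x|]; first by exists x.
  by rewrite ltnS => /IH h x; have [y ->] := h x; exists (u n y); rewrite lcompat.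
pose il n : {linear S_ n -> fullsys H} := i \o l n.
have ilemb n : uco_embedding (il n).
  have [l1 lp] := lemb n; split=> [|k A]; first by rewrite /= l1.
  rewrite lp ipos; rewrite (_ : map_mx i _ = map_mx (il n) A)//.
  by apply/matrixP => a b; rewrite !mxE.
have /choice[f hf] n := hD n H (il n) (ilemb n).
have fucp n : ucp (f n).
  have [fc _ ff] := hf n; split=> //.
  by have [h1 _] := ilemb n; rewrite -[in LHS]h1 ff h1.
have [U [UU nU]] := ultraFilterLemma eventually_filter.
pose phi n (A : fullsys H) := os_val (f n A).
have lphi n : linear (phi n) by move=> a x y; rewrite /phi linearP.
have bphi (A : fullsys H) : exists2 r : R, 0 <= r & forall n, opnorm_le (phi n A) r.
  have [r r0 hr] := opnorm_le_exists (os_val A); exists r; first exact: ltW.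
  by move=> n; apply: ucp_contractive => //; exact: ltW.
have [psi hpsi] := ultralimit (FU := UU) lphi bphi.
have hpsin A (r : R) : 0 <= r -> opnorm_le (os_val A) r -> opnorm_le (os_val (psi A)) r.
  move=> r0 hr; apply: (ultralimit_norm (FU := UU) (phi := phi)) => //.
  by apply: filterE => n; apply: ucp_contractive.
exists psi; split.
- apply: (ultralimit_cp (FU := UU) (phi := phi)) => // n k A /(fucp n).2.
  rewrite /os_pos; congr bop_pos; apply/matrixP => a b; rewrite !mxE //.
- move=> A B hB; apply: bop_ext => x y /=; rewrite [RHS]adjP.
  apply: (zcvg_unique (F := U)) (hpsi A _ _) _.
  have := hpsi A x (adj B y); congr zcvg; apply/funext => n; rewrite -adjP.
  have [_ fcomm _] := hf n.
  have k : bop_comp (os_val (f n A)) B = bop_comp B (os_val (f n A)).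
    by apply: (fcomm A) => C [x' _ <-]; apply: hB; exists (l n x').
  by rewrite -[LHS]/(hilb_ip H (bop_comp B (os_val (f n A)) x) y) -k.
- have base n x : psi (i (l n x)) = i (l n x).
    apply/val_inj/bop_ext => a b.
    apply: (zcvg_unique (F := U)) (hpsi _ _ _) _.
    set c := hilb_ip _ _ _.
    have cst : zcvg U (fun=> c) c by exact: zcvg_cst.
    have ev : U [set k | phi k (i (l n x)) = os_val (i (l n x))].
      apply: nU; exists n => // k /= nk; rewrite /phi.
      have -> // : f k (i (l n x)) = i (l n x).
      have [y ->] := lu _ _ nk x; have [_ _ ff] := hf k; exact: ff.
    by split; [move: cst.1|move: cst.2]; apply: cvg_trans; apply: near_eq_cvg;
      apply: filterS ev => k /= ->.
  move=> s; apply/eqP; rewrite -subr_eq0; apply/eqP/val_inj.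
  apply: (@opnorm_le_eq0 _ _ 2) => // e e0.
  have [n [x hx]] := op_closure_approx lclos s e0.
  have -> : psi (i s) - i s = psi (i (s - l n x)) - i (s - l n x).
    have e1 : i (s - l n x) = i s - i (l n x) by exact: raddfB.
    have e2 : psi (i s - i (l n x)) = psi (i s) - psi (i (l n x)) by exact: raddfB.
    rewrite e1 e2 base.
    have gen (V : zmodType) (a b c : V) : a - b = (a - c) - (b - c).
      by rewrite opprB addrA addrNK.
    exact: gen.
  have e0' := ltW e0.
  have k1 : opnorm_le (os_val (i (s - l n x))) e.
    by apply: ucp_contractive => //; split=> //; exact: uco_cp.
  have -> : 2 * e = e + e by rewrite mulr_natl mulr2n.
  exact: (opnorm_leB (hpsin _ _ e0' k1) k1).
Qed.

End DCEP.

(** * The extension theorem of Arveson *)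

Section OsIp.
Variables (R : realType) (W : opsys R).
Local Notation ip := (hilb_ip (os_hilb W)).
Local Notation hB := (hilb_sip (os_hilb W)).

Lemma ip_osD (s t : W) x y : ip (os_val (s + t) x) y = ip (os_val s x) y + ip (os_val t x) y.
Proof. by rewrite os_valD bop_add (sipD hB). Qed.
Lemma ip_osZ a (s : W) x y : ip (os_val (a *: s) x) y = a * ip (os_val s x) y.
Proof. by rewrite os_valZ bop_scale (sipZ hB). Qed.
Lemma ip_os0 x y : ip (os_val (0 : W) x) y = 0.
Proof. exact: (sip0 hB). Qed.
Lemma ip_os_sum (I : Type) (r : seq I) (P : pred I) (F : I -> W) x y :
  ip (os_val (\sum_(i <- r | P i) F i) x) y = \sum_(i <- r | P i) ip (os_val (F i) x) y.
Proof. by elim/big_rec2: _ => [|i u v _ <-]; [exact: ip_os0|exact: ip_osD]. Qed.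

End OsIp.

Section GramSchmidt.
Variables (R : realType) (H : hilbert R).
Local Notation ip := (hilb_ip H).
Local Notation hB := (hilb_sip H).

Definition fproj (es : seq H) (x : H) : H := \sum_(e <- es) ip x e *: e.

Lemma fproj_sym es x y : ip (fproj es x) y = ip x (fproj es y).
Proof.
rewrite /fproj (sip_sum hB) (sip_sumr hB); apply: eq_bigr => e _.
by rewrite (sipZ hB) (sipZr hB) -(sipC hB) mulrC.
Qed.

(** Gram-Schmidt: each new vector contributes its normalized residual, unless
    it is reproduced already. *)
Lemma gram_schmidt (l : seq H) : exists es : seq H,
  (forall e, e \in es -> fproj es e = e) /\ (forall x, x \in l -> fproj es x = x).
Proof.
elim: l => [|x l [es [hes hl]]]; first by exists [::].
pose r := x - fproj es x.
have ra a : a \in es -> ip r a = 0.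
  by move=> /hes ha; rewrite /r (sipB hB) fproj_sym ha subrr.
have [r0|r0] := eqVneq r 0.
  exists es; split=> // y; rewrite inE => /predU1P[->|/hl//].
  by apply/eqP; rewrite eq_sym -subr_eq0 -/r r0.
have q0 : 0 < hq r.
  by rewrite lt_neqAle hq_ge0 andbT eq_sym; apply: contra r0 => /eqP/hq_eq0 ->.
pose c := (Num.sqrt (hq r))^-1.
pose e := c%:C *: r.
have ea a : a \in es -> ip e a = 0.
  by move=> /ra h; rewrite /e (sipZ hB) h mulr0.
have ae a : a \in es -> ip a e = 0.
  by move=> /ea h; rewrite (sipC hB) h conjc0.
have fe y : ip (fproj es y) e = 0.
  rewrite /fproj (sip_sum hB) big_seq big1// => a aes.
  by rewrite (sipZ hB) ae// mulr0.
have cc : c * c * hq r = 1.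
  have s0 : Num.sqrt (hq r) != 0 by rewrite sqrtr_eq0 -ltNge.
  rewrite /c -{3}(sqr_sqrtr (ltW q0)); by field.
have ee : ip e e = 1.
  by rewrite /e (sipZ hB) (sipZr hB) conjc_real (sipqE hB) -/(hq r) -!rmorphM mulrA cc.
have fpE y : fproj (e :: es) y = ip y e *: e + fproj es y by rewrite /fproj big_cons.
exists (e :: es); split=> y; rewrite inE => /predU1P[->|].
- rewrite fpE ee scale1r; suff -> : fproj es e = 0 by rewrite addr0.
  by rewrite /fproj big_seq big1// => a /ea ->; rewrite scale0r.
- by move=> yes; rewrite fpE ae// scale0r add0r hes.
- have xE : x = r + fproj es x by rewrite /r subrK.
  rewrite fpE {1}xE (sipD hB) fe addr0 {1}/e (sipZr hB) conjc_real (sipqE hB).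
  rewrite -/(hq r) /e scalerA -!rmorphM mulrAC cc scale1r; exact: esym.
- move=> yl; rewrite fpE -{1}(hl y yl) fe scale0r add0r; exact: hl.
Qed.

End GramSchmidt.

Section HermitianForms.
Variable R : realType.

(** Polarization: the value at [x + y] forces the imaginary parts of [F x y]
    and [F y x] to cancel, and replacing [x] by [i x] compares the real parts.
    *)
Lemma real_form_herm (E : lmodType R[i]) (F : E -> E -> R[i]) :
  (forall x y z, F (x + y) z = F x z + F y z) ->
  (forall x y z, F x (y + z) = F x y + F x z) ->
  (forall a x y, F (a *: x) y = a * F x y) ->
  (forall a x y, F x (a *: y) = conjc a * F x y) ->
  (forall x, Im (F x x) = 0) -> forall x y, F y x = conjc (F x y).
Proof.
move=> FD FDr FZ FZr F0.
have h x y : Im (F x y) + Im (F y x) = 0.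
  by have := F0 (x + y); rewrite !FD !FDr !ImD !F0 add0r addr0.
move=> x y; apply: cext; rewrite ?ReC ?ImC; last by have := h x y; lra.
have := h ('i *: x) y; rewrite FZ FZr conjc_i !reim !mul0r !mul1r !zsimp; lra.
Qed.

Lemma fpos_herm (H : hilbert R) (X : finType) (P : X -> X -> bop H) x y :
  fpos P -> P y x = adj (P x y).
Proof.
move=> hP; have hB := hilb_sip H.
pose F (xi eta : X -> H) := \sum_x \sum_y hilb_ip H (P x y (xi y)) (eta x).
have Fherm : forall xi eta, F eta xi = conjc (F xi eta).
  apply: real_form_herm.
  - move=> a b c; rewrite /F -big_split; apply: eq_bigr => u _.
    by rewrite -big_split; apply: eq_bigr => v _; rewrite -[(a + b) v]/(a v + b v) bopD (sipD hB).
  - move=> a b c; rewrite /F -big_split; apply: eq_bigr => u _.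
    by rewrite -big_split; apply: eq_bigr => v _; rewrite -[(b + c) u]/(b u + c u) (sipDr hB).
  - move=> a b c; rewrite /F mulr_sumr; apply: eq_bigr => u _.
    by rewrite mulr_sumr; apply: eq_bigr => v _; rewrite -[(a *: b) v]/(a *: b v) bopZ (sipZ hB).
  - move=> a b c; rewrite /F mulr_sumr; apply: eq_bigr => u _.
    by rewrite mulr_sumr; apply: eq_bigr => v _; rewrite -[(a *: c) u]/(a *: c u) (sipZr hB).
  - by move=> a; have /ge0cP[] := hP a.
pose d (z : X) (a : H) (u : X) : H := if u == z then a else 0.
have Fd z w a b : F (d w a) (d z b) = hilb_ip H (P z w a) b.
  rewrite /F (bigD1 z)//= [X in _ + X]big1 ?addr0; last first.
    by move=> u /negPf uz; apply: big1 => v _; rewrite /d uz (sip0r hB).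
  rewrite (bigD1 w)//= big1 ?addr0 /d ?eqxx// => v /negPf vw.
  by rewrite vw bop0 (sip0 hB).
apply: bop_ext => a b; rewrite adjP' -Fd [RHS](sipC hB) -Fd; exact: Fherm.
Qed.

Lemma ospos_herm (S : opsys R) (X : finType) (P : X -> X -> S) x y :
  ospos P -> P y x = os_star (P x y).
Proof. by move=> h; apply/val_inj; exact: (fpos_herm x y h). Qed.

(** The hermitian part of [P] has twice the real part of the form of [P] as
    its form, and it is a matrix over [S] because [S] is self-adjoint. *)
Lemma cp_re_pos (S T T' : opsys R) (j : {linear S -> T}) (f : {linear S -> T'})
    (X : finType) (P : X -> X -> S) : uco_embedding j -> cp f ->
  (forall zeta, 0 <= Re (\sum_x \sum_y hilb_ip _ (os_val (j (P x y)) (zeta y)) (zeta x))) ->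
  (forall zeta, 0 <= Re (\sum_x \sum_y hilb_ip _ (os_val (f (P x y)) (zeta y)) (zeta x))).
Proof.
move=> jemb fc.
pose Q x y := P x y + os_star (P y x).
have QE (W : opsys R) (k : {linear S -> W}) zeta : cp k ->
    \sum_x \sum_y hilb_ip _ (os_val (k (Q x y)) (zeta y)) (zeta x) =
    (2 * Re (\sum_x \sum_y hilb_ip _ (os_val (k (P x y)) (zeta y)) (zeta x)))%:C.
  move=> kc; rewrite -[RHS]/(_%:C).
  set z := (X in Re X).
  have -> : (2 * Re z)%:C = z + conjc z.
    by apply: cext; rewrite !reim; [rewrite mulr_natl mulr2n|rewrite subrr].
  rewrite /z [conjc _]rmorph_sum; under [X in _ + X]eq_bigr do rewrite rmorph_sum.
  rewrite [X in _ + X]exchange_big -big_split; apply: eq_bigr => x _.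
  rewrite -big_split; apply: eq_bigr => y _ /=.
  have -> : k (Q x y) = k (P x y) + os_star (k (P y x)) by rewrite /Q linearD cp_star.
  transitivity (hilb_ip _ (os_val (k (P x y)) (zeta y)
                           + adj (os_val (k (P y x))) (zeta y)) (zeta x)) => //.
  by rewrite (sipD (hilb_sip _)) adjP' -(sipC (hilb_sip _)).
move=> h; have : ospos (fun x y => j (Q x y)).
  move=> zeta; rewrite QE; last exact: uco_cp.
  by rewrite ler0c mulr_ge0//; exact: h.
move=> /(uco_ospos jemb)/(cp_ospos fc) k zeta.
by have := k zeta; rewrite QE// ler0c pmulr_rge0.
Qed.

Definition dsum (V : zmodType) (X1 X2 : Type) (P1 : X1 -> X1 -> V) (P2 : X2 -> X2 -> V)
    (x y : X1 + X2) : V :=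
  match x, y with inl x, inl y => P1 x y | inr x, inr y => P2 x y | _, _ => 0 end.

Lemma ospos_dsum (W : opsys R) (X1 X2 : finType) (P1 : X1 -> X1 -> W) (P2 : X2 -> X2 -> W) :
  ospos P1 -> ospos P2 -> ospos (dsum P1 P2).
Proof.
move=> h1 h2 xi; have := addr_ge0 (h1 (xi \o inl)) (h2 (xi \o inr)).
congr (0 <= _); rewrite big_sumType /=; congr (_ + _); apply: eq_bigr => x _.
  by rewrite big_sumType [X in _ = _ + X]big1 ?addr0// => y _; exact: ip_os0.
by rewrite big_sumType [X in _ = X + _]big1 ?add0r// => y _; exact: ip_os0.
Qed.

Lemma ospos_scale (W : opsys R) (X : finType) (P : X -> X -> W) (r : R) : 0 <= r ->
  ospos P -> ospos (fun x y => r%:C *: P x y).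
Proof.
move=> r0 hP xi; have := mulr_ge0 (_ : 0 <= r%:C) (hP xi); rewrite ler0c => /(_ r0).
congr (0 <= _); rewrite mulr_sumr; apply: eq_bigr => x _.
by rewrite mulr_sumr; apply: eq_bigr => y _; rewrite ip_osZ.
Qed.

End HermitianForms.

(** A completely positive map [f : S -> B(H)] amounts to the functional
    sending s (x) x (x) y^* to <f(s) x, y>, which is nonnegative on the cone
    generated by the positive matrices. Hahn-Banach extends this functional
    from [S] to [T], and the bounded form so obtained is the extension of [f].
    *)
Section Arveson.
Variables (R : realType) (H : hilbert R) (S T : opsys R).
Variables (j : {linear S -> T}) (f : {linear S -> fullsys H}).
Hypotheses (jemb : uco_embedding j) (fcp : cp f).

Local Notation ip := (hilb_ip H).
Local Notation hB := (hilb_sip H).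
Local Notation K := (os_hilb T).
Local Notation hK := (hilb_sip (os_hilb T)).

(** The tensor products t (x) x (x) y^* are represented by their evaluations
    at all forms of this kind. Symmetry under the adjoint makes real parts
    sufficient. *)
Definition hermform (b : T -> H -> H -> R[i]) : Prop :=
  [/\ forall a t t' x y, b (a *: t + t') x y = a * b t x y + b t' x y,
      forall a t x x' y, b t (a *: x + x') y = a * b t x y + b t x' y &
      forall t x y, b (os_star t) y x = conjc (b t x y)].

Record hform := HForm { hf_val :> T -> H -> H -> R[i]; hfP : hermform hf_val }.

Implicit Types b : hform.

Lemma hfDt b t t' x y : b (t + t') x y = b t x y + b t' x y.
Proof. by have [h _ _] := hfP b; rewrite -[t]scale1r h mul1r scale1r. Qed.
Lemma hf0t b x y : b 0 x y = 0.
Proof. by apply: (@addrI _ (b 0 x y)); rewrite -hfDt !addr0. Qed.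
Lemma hfZt b a t x y : b (a *: t) x y = a * b t x y.
Proof. by have [h _ _] := hfP b; rewrite -[a *: t]addr0 h hf0t addr0. Qed.
Lemma hfDl b t x x' y : b t (x + x') y = b t x y + b t x' y.
Proof. by have [_ h _] := hfP b; rewrite -[x]scale1r h mul1r scale1r. Qed.
Lemma hf0l b t y : b t 0 y = 0.
Proof. by apply: (@addrI _ (b t 0 y)); rewrite -hfDl !addr0. Qed.
Lemma hfZl b a t x y : b t (a *: x) y = a * b t x y.
Proof. by have [_ h _] := hfP b; rewrite -[a *: x]addr0 h hf0l addr0. Qed.
Lemma hfC b t x y : b (os_star t) y x = conjc (b t x y).
Proof. by have [_ _ h] := hfP b. Qed.
Lemma hfDr b t x y y' : b t x (y + y') = b t x y + b t x y'.
Proof. by rewrite -[t]os_starK !(hfC b (os_star t)) hfDl rmorphD. Qed.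
Lemma hfZr b a t x y : b t x (a *: y) = conjc a * b t x y.
Proof. by rewrite -[t]os_starK !(hfC b (os_star t)) hfZl rmorphM. Qed.

Local Notation V := (hform -> R[i]).

Definition ev (t : T) (x y : H) : V := fun b => (Re (b t x y))%:C.

Lemma evDt t t' x y : ev (t + t') x y = ev t x y + ev t' x y.
Proof. by apply/funext => b; rewrite -[RHS]/(_ + _) /ev hfDt ReD rmorphD. Qed.
Lemma evDl t x x' y : ev t (x + x') y = ev t x y + ev t x' y.
Proof. by apply/funext => b; rewrite -[RHS]/(_ + _) /ev hfDl ReD rmorphD. Qed.
Lemma evDr t x y y' : ev t x (y + y') = ev t x y + ev t x y'.
Proof. by apply/funext => b; rewrite -[RHS]/(_ + _) /ev hfDr ReD rmorphD. Qed.
Lemma evZt (r : R) t x y : ev (r%:C *: t) x y = r%:C *: ev t x y.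
Proof. by apply/funext => b; rewrite -[RHS]/(_ * _) /ev hfZt !reim mul0r subr0 rmorphM. Qed.
Lemma evZl (r : R) t x y : ev t (r%:C *: x) y = r%:C *: ev t x y.
Proof. by apply/funext => b; rewrite -[RHS]/(_ * _) /ev hfZl !reim mul0r subr0 rmorphM. Qed.
Lemma evZr (r : R) t x y : ev t x (r%:C *: y) = r%:C *: ev t x y.
Proof. by apply/funext => b; rewrite -[RHS]/(_ * _) /ev hfZr conjc_real !reim mul0r subr0 rmorphM. Qed.
Lemma ev_it t x y : ev ('i *: t) x y = ev t ('i *: x) y.
Proof. by apply/funext => b; rewrite /ev hfZt hfZl. Qed.
Lemma ev_il t x y : ev t ('i *: x) y = - ev t x ('i *: y).
Proof.
apply/funext => b; rewrite -[RHS]/(- _) /ev hfZl hfZr conjc_i -rmorphN.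
by rewrite mulNr ReN opprK.
Qed.
Lemma ev_star t x y : ev (os_star t) y x = ev t x y.
Proof. by apply/funext => b; rewrite /ev hfC ReC. Qed.

Definition ev_span : set V :=
  [set v | exists l : seq (T * H * H), v = \sum_(p <- l) ev p.1.1 p.1.2 p.2].

Lemma ev_span_rsub : rsubspace ev_span.
Proof.
split=> [_ _ [l ->] [l' ->]|r _ [l ->]]; first by exists (l ++ l'); rewrite big_cat.
exists [seq (r%:C *: p.1.1, p.1.2, p.2) | p <- l]; rewrite big_map scaler_sumr.
by apply: eq_bigr => p _ /=; rewrite evZt.
Qed.

Definition ev_cone (X : finType) (A : X -> X -> T) (h : X -> H) : V :=
  \sum_x \sum_y ev (A x y) (h y) (h x).

(** The bounds imposed on the extension [g0]: if [v] plus an element of the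
    positive cone comes from [S], with value [r] there, then [g0 v] must be at
    most [r]. *)
Definition dom (v : V) (r : R) : Prop :=
  exists (s : seq (S * H * H)) (X : finType) (A : X -> X -> T) (h : X -> H),
    [/\ ospos A, v + ev_cone A h = \sum_(p <- s) ev (j p.1.1) p.1.2 p.2 &
        r = \sum_(p <- s) Re (ip (os_val (f p.1.1) p.1.2) p.2)].

Lemma hform_sub_ip N (e d : 'I_N -> H) (z : 'I_N -> K) :
  hermform (fun t x y => \sum_p \sum_q ip x (d p) * ip (d q) y * hilb_ip K (os_val t (z p)) (z q)).
Proof.
split=> [a t t' x y|a t x x' y|t x y].
- rewrite mulr_sumr -big_split; apply: eq_bigr => p _; rewrite mulr_sumr -big_split.
  apply: eq_bigr => q _; rewrite ip_osD ip_osZ /=.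
  by rewrite mulrDr mulrCA.
- rewrite mulr_sumr -big_split; apply: eq_bigr => p _; rewrite mulr_sumr -big_split.
  apply: eq_bigr => q _ /=.
  by rewrite (sipD hB) (sipZ hB) !mulrDl !mulrA.
- rewrite rmorph_sum /= exchange_big; apply: eq_bigr => p _.
  rewrite rmorph_sum; apply: eq_bigr => q _ /=.
  rewrite !rmorphM /= -!(sipC hB) -(sipC hK) adjP' mulrC [RHS]mulrC; congr (_ * _).
  exact: mulrC.
Qed.

(** Bounds on 0 are consistent: if an element of the positive cone comes from
    [S], then expressing its vectors in an orthonormal family turns it into a
    matrix over [S] whose image in [T] is positive. It is positive in [S]
    since [j] is an order embedding, and complete positivity of [f] makes its
    value nonnegative. *)
Lemma dom_proper r : dom 0 r -> 0 <= r.
Proof.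
move=> [s [X [A [h [Apos]]]]]; rewrite add0r => E ->.
have [es [_ hes]] := gram_schmidt ([seq p.1.2 | p <- s] ++ [seq p.2 | p <- s]).
pose N := size es; pose e (p : 'I_N) := nth 0 es p.
have fpE x : fproj es x = \sum_p ip x (e p) *: e p.
  by rewrite /fproj (big_nth 0) big_mkord.
(* The element coming from S, expanded in the orthonormal family: a matrix
   over S. *)
pose P q p := \sum_(t <- s) (ip t.1.2 (e p) * ip (e q) t.2) *: t.1.1.
have key zeta : 0 <= Re (\sum_q \sum_p hilb_ip K (os_val (j (P q p)) (zeta p)) (zeta q)).
  pose b := HForm (hform_sub_ip e e zeta).
  have /(congr1 (fun v => Re (v b))) := E.
  pose xi x := \sum_p ip (h x) (e p) *: zeta p.
  have -> : Re (ev_cone A h b) = Re (\sum_x \sum_y hilb_ip K (os_val (A x y) (xi y)) (xi x)).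
    rewrite /ev_cone fct_sumE !Re_sum; apply: eq_bigr => x _.
    rewrite fct_sumE !Re_sum; apply: eq_bigr => y _.
    rewrite /ev Re_real /=; congr Re.
    rewrite /xi bop_sum (sip_sum hK); apply: eq_bigr => p _.
    rewrite (sip_sumr hK); apply: eq_bigr => q _.
    by rewrite bopZ (sipZ hK) (sipZr hK) -(sipC hB) mulrA.
  have -> : Re ((\sum_(p <- s) ev (j p.1.1) p.1.2 p.2) b) =
      Re (\sum_q \sum_p hilb_ip K (os_val (j (P q p)) (zeta p)) (zeta q)).
    transitivity (Re (\sum_(t <- s) b (j t.1.1) t.1.2 t.2)).
      by rewrite fct_sumE !Re_sum; apply: eq_bigr.
    congr Re; rewrite [RHS]exchange_big [LHS]exchange_big; apply: eq_bigr => p _.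
    rewrite exchange_big; apply: eq_bigr => q _.
    rewrite /P linear_sum /=.
    rewrite ip_os_sum; apply: eq_bigr => t _.
    by rewrite linearZ_LR ip_osZ.
  by move=> <-; have /ge0cP[] := Apos xi.
have := cp_re_pos jemb fcp key e; congr (0 <= _).
rewrite -Re_sum; congr Re.
transitivity (\sum_q \sum_p \sum_(t <- s)
    ip t.1.2 (e p) * ip (e q) t.2 * ip (os_val (f t.1.1) (e p)) (e q)).
  apply: eq_bigr => q _; apply: eq_bigr => p _.
  rewrite /P linear_sum ip_os_sum; apply: eq_bigr => t _.
  by rewrite linearZ_LR ip_osZ.
rewrite exchange_big; under eq_bigr do rewrite exchange_big.
rewrite exchange_big big_seq [RHS]big_seq; apply: eq_bigr => t ts.
have h1 : fproj es t.1.2 = t.1.2 by apply: hes; rewrite mem_cat (map_f (fun p : S * H * H => p.1.2) ts).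
have h2 : fproj es t.2 = t.2 by apply: hes; rewrite mem_cat (map_f (fun p : S * H * H => p.2) ts) orbT.
rewrite -{2}h1 -{2}h2 !fpE bop_sum (sip_sum hB); apply: eq_bigr => p _.
rewrite (sip_sumr hB); apply: eq_bigr => q _.
by rewrite bopZ (sipZ hB) (sipZr hB) -(sipC hB) mulrA.
Qed.


Lemma ev_coneD (X Y : finType) (A : X -> X -> T) (B : Y -> Y -> T) (h : X -> H) (k : Y -> H) :
  exists (C : X + Y -> X + Y -> T) (m : X + Y -> H),
    (ospos A -> ospos B -> ospos C) /\ ev_cone C m = ev_cone A h + ev_cone B k.
Proof.
exists (dsum A B).
exists (fun p => match p with inl x => h x | inr y => k y end).
split; first exact: ospos_dsum.
have ev0 x y : ev 0 x y = 0 by apply/funext => b; rewrite /ev hf0t.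
rewrite /ev_cone big_sumType /=; congr (_ + _); apply: eq_bigr => x _.
  by rewrite big_sumType /= [X in _ + X]big1 ?addr0.
by rewrite big_sumType /= [X in X + _]big1 ?add0r.
Qed.

Lemma dom_bcone : bcone dom.
Proof.
split; last exact: dom_proper.
- move=> u v r r' [s [X [A [h [hA E ->]]]]] [s' [Y [B [k [hB' E' ->]]]]].
  have [C [m [hC Ec]]] := ev_coneD A B h k.
  exists (s ++ s'), (X + Y)%type, C, m; split; [exact: hC| |by rewrite big_cat].
  by rewrite Ec big_cat /= -E -E' addrACA.
- move=> t u r t0 [s [X [A [h [hA E ->]]]]].
  exists [seq (t%:C *: p.1.1, p.1.2, p.2) | p <- s], X, (fun x y => t%:C *: A x y), h.
  split.
  + exact: ospos_scale.
  + rewrite big_map /=; under eq_bigr do rewrite linearZ /= evZt.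
    rewrite -scaler_sumr -E scalerDr; congr (_ + _).
    rewrite /ev_cone scaler_sumr; apply: eq_bigr => x _.
    by rewrite scaler_sumr; apply: eq_bigr => y _; rewrite evZt.
  + rewrite big_map mulr_sumr; apply: eq_bigr => p _ /=.
    by rewrite linearZ_LR (@ip_osZ R (fullsys H)) !reim mul0r subr0.
Qed.

(** Every symbol is bounded, by the 2 x 2 criterion for the operator [- t /
    2]. *)
Lemma dom_ev t : exists2 D : R, 0 <= D & forall x y, dom (ev t x y)
  (D * (Re (ip (os_val (f (os_one S)) x) x) + Re (ip (os_val (f (os_one S)) y) y))).
Proof.
pose t' : T := (- 2^-1)%:C *: t.
have [r r0 hr] := opnorm_le_exists (os_val t').
have p2 := pos2_norm (ltW r0) hr.
exists r => [|x y]; first exact: ltW.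
exists [:: (r%:C *: os_one S, y, y); (r%:C *: os_one S, x, x)], bool.
exists (mx2 (r%:C *: os_one T) t' (os_star t') (r%:C *: os_one T)).
exists (fun c : bool => if c then y else x); split.
- move=> xi; have := p2 (xi true) (xi false); congr (0 <= _).
  by rewrite !big_bool /= addrA.
- rewrite !big_cons big_nil addr0 /= /ev_cone !big_bool /=.
  have [j1 _] := jemb; rewrite !linearZ /= j1 ev_star /t' !evZt.
  have gen (Z : zmodType) (w a d b : Z) : d + d = - w -> w + (a + d + (d + b)) = a + b.
    by move=> h; rewrite -(addrA a d (d + b)) (addrA d d b) h addrCA (addrA w) subrr add0r.
  apply: gen; rewrite -scalerDl -rmorphD.
  have -> : - 2^-1 + - 2^-1 = -1 :> R by field.
  by rewrite rmorphN1 scaleN1r.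
- rewrite !big_cons big_nil addr0 /= mulrDr addrC; congr (_ + _);
  by rewrite linearZ_LR (@ip_osZ R (fullsys H)) !reim mul0r subr0.
Qed.

Lemma dom_total u : ev_span u -> exists r, dom u r.
Proof.
move=> [l ->]; have [domD _ _] := dom_bcone; elim: l => [|p l [r hr]].
  rewrite big_nil; exists 0, [::], 'I_0, (fun _ _ => 0), (fun _ => 0).
  split; [by move=> xi; rewrite big_ord0| |by rewrite big_nil].
  by rewrite /ev_cone big_ord0 big_nil addr0.
rewrite big_cons; have [D _ /(_ p.1.2 p.2) hD] := dom_ev p.1.1.
by eexists; exact: domD hD hr.
Qed.

Lemma ev_span_ev t x y : ev_span (ev t x y).
Proof. by exists [:: (t, x, y)]; rewrite big_seq1. Qed.

Lemma arveson_ext : exists2 g : {linear T -> fullsys H}, cp g & forall x, g (j x) = f x.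
Proof.
have span0 : ev_span 0 by exists [::]; rewrite big_nil.
have [g0 [g0D g0Z g0le]] := hahn_banach ev_span_rsub span0 dom_bcone dom_total.
have sp := ev_span_ev.
have [spD spZ] := ev_span_rsub.
pose G t x y := g0 (ev t x y).
have GDt t t' x y : G (t + t') x y = G t x y + G t' x y by rewrite /G evDt g0D.
have GDl t x x' y : G t (x + x') y = G t x y + G t x' y by rewrite /G evDl g0D.
have GDr t x y y' : G t x (y + y') = G t x y + G t x y' by rewrite /G evDr g0D.
have GZt (r : R) t x y : G (r%:C *: t) x y = r * G t x y by rewrite /G evZt g0Z.
have GZl (r : R) t x y : G t (r%:C *: x) y = r * G t x y by rewrite /G evZl g0Z.
have GZr (r : R) t x y : G t x (r%:C *: y) = r * G t x y by rewrite /G evZr g0Z.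
have gN v : ev_span v -> g0 (- v) = - g0 v.
  by move=> hv; rewrite -scaleN1r -(rmorphN1 (real_complex R)) g0Z// mulN1r.
have Git t x y : G ('i *: t) x y = G t ('i *: x) y by rewrite /G ev_it.
have Gil t x y : G t ('i *: x) y = - G t x ('i *: y) by rewrite /G ev_il gN.
pose b t x y : R[i] := G t x y +i* G t x ('i *: y).
have [D D0 hD] : exists2 D : R, 0 <= D & forall x, Re (ip (os_val (f (os_one S)) x) x) <= D * hq x.
  have [D D0 hD] := opnorm_le_exists (os_val (f (os_one S))).
  by exists D => [|x]; [exact: ltW|apply: opnorm_le_Re => //; exact: ltW].
have Gsum t : exists2 C : R, 0 <= C & forall x y, G t x y <= C * (hq x + hq y).
  have [E E0 hE] := dom_ev t; exists (E * D) => [|x y]; first exact: mulr_ge0.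
  apply: (le_trans (g0le _ _ (sp t x y) (hE x y))).
  by rewrite -mulrA ler_wpM2l// mulrDr lerD.
have Gbound t : exists C : R, forall x y, G t x y ^+ 2 <= C * hq x * hq y.
  have [C C0 hC] := Gsum t; exists (4 * C ^+ 2) => x y.
  have : (- (G t x y / 2)) ^+ 2 <= (C * hq y) * (C * hq x).
    apply: sip_discr; rewrite ?mulr_ge0 ?hq_ge0// => s.
    have := hC (s%:C *: x) y; rewrite GZl /hq (sipqZr hB) -!/(hq _); lra.
  rewrite sqrrN exprMn exprVn; lra.
have ii (W : lmodType R[i]) (w : W) : 'i *: ('i *: w) = - w.
  by rewrite scalerA -expr2 sqr_i scaleN1r.
have GNr t x y : G t x (- y) = - G t x y.
  by rewrite -scaleN1r -(rmorphN1 (real_complex R)) GZr mulN1r.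
have Ga t a x y : G t (a *: x) y = Re a * G t x y - Im a * G t x ('i *: y).
  by rewrite scale_re_im GDl !GZl Gil mulrN.
have Gra t a x y : G t x (a *: y) = Re a * G t x y + Im a * G t x ('i *: y).
  by rewrite scale_re_im GDr !GZr.
have Gta t a x y : G (a *: t) x y = Re a * G t x y - Im a * G t x ('i *: y).
  by rewrite scale_re_im GDt !GZt Git Gil mulrN.
have /choice[g hg] t : exists A : bop H, forall x y, ip (A x) y = b t x y.
  have [C hC] := Gbound t; apply: (@bop_of_form _ _ (b t) C).
  - move=> a x y z; apply: cext; rewrite ?ReD ?ImD ?ReM ?ImM /b /= GDl Ga //.
    by rewrite ii GNr mulrN opprK.
  - by move=> x y z; apply: cext; rewrite ?ReD ?ImD /b /= ?scalerDr GDr.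
  - move=> a x y; rewrite /b [X in _ +i* G t x X](_ : _ = a *: ('i *: y)); last first.
      by rewrite !scalerA mulrC.
    by rewrite (Gra t a x y) (Gra t a x ('i *: y)) ii GNr mulrN conj_mulE.
  - by move=> x y; exact: hC.
have gRe t x y : Re (ip (g t x) y) = G t x y by rewrite hg.
have lg : linear (fun t => OsElt (isT : g t \in @os_pred R (fullsys H)) : fullsys H).
  move=> a t t'; apply/val_inj/bop_ext => x y.
  rewrite -[LHS]/(ip (g (a *: t + t') x) y) -[RHS]/(ip (a *: g t x + g t' x) y).
  rewrite (sipD hB) (sipZ hB) !hg /b.
  by apply: cext; rewrite ?ReD ?ImD ?ReM ?ImM /= GDt Gta // ii GNr mulrN opprK.
have [g' g'E] := mk_linear lg; exists g'; last first.
  move=> s; rewrite g'E; apply/val_inj/bop_ext => x y /=.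
  apply: (@re_form_ext R H (fun y => ip (g (j s) x) y) (fun y => ip (os_val (f s) x) y)).
  - by move=> z; rewrite (sipZr hB) conjc_i.
  - by move=> z; rewrite (sipZr hB) conjc_i.
  move=> {}y; rewrite gRe.
  have one (s' : S) : G (j s') x y <= Re (ip (os_val (f s') x) y).
    apply: g0le => //; exists [:: (s', x, y)], 'I_0, (fun _ _ => 0), (fun _ => 0).
    split; [by move=> xi; rewrite big_ord0| |by rewrite big_seq1].
    by rewrite /ev_cone big_ord0 big_seq1 addr0.
  apply/le_anti; rewrite one /=; have := one (- s).
  have -> : G (j (- s)) x y = - G (j s) x y.
    by rewrite linearN -scaleN1r -(rmorphN1 (real_complex R)) GZt mulN1r.
  have -> : Re (ip (os_val (f (- s)) x) y) = - Re (ip (os_val (f s) x) y).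
    rewrite -scaleN1r -(rmorphN1 (real_complex R)) linearZ_LR.
    by rewrite (@ip_osZ R (fullsys H)) !reim mulN1r mul0r subr0.
  by rewrite lerN2.
move=> n A /ospos_ord Apos xi.
have -> : \sum_i \sum_k ip (map_mx (@os_val R (fullsys H)) (map_mx g' A) i k (xi k)) (xi i) =
    \sum_i \sum_k b (A i k) (xi k) (xi i).
  by apply: eq_bigr => i _; apply: eq_bigr => k _; rewrite !mxE g'E /= hg.
apply/ge0cP; rewrite Re_sum Im_sum; split; last first.
  set z := \sum_i _.
  suff : z = - z by lra.
  rewrite {2}/z -sumrN; under [RHS]eq_bigr do rewrite Im_sum -sumrN.
  rewrite [RHS]exchange_big; apply: eq_bigr => i _; rewrite Im_sum.
  apply: eq_bigr => k _ /=.
  by rewrite /G -[ev (A i k) _ _]ev_star ev_il gN// -(ospos_herm _ _ Apos).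
have g0sum (I : Type) (r : seq I) (F : I -> V) : (forall i, ev_span (F i)) ->
    ev_span (\sum_(i <- r) F i) /\ g0 (\sum_(i <- r) F i) = \sum_(i <- r) g0 (F i).
  move=> hF; elim: r => [|i r [h1 h2]].
    rewrite !big_nil; split=> //; have := g0Z 0 _ span0; rewrite mul0r scaler0 //.
  by rewrite !big_cons g0D// h2; split=> //; exact: spD.
have cspan i : ev_span (\sum_k ev (A i k) (xi k) (xi i)).
  by have [] := g0sum _ (index_enum 'I_n) (fun k => ev (A i k) (xi k) (xi i)) (fun k => sp _ _ _).
have [h1 h2] := g0sum _ (index_enum 'I_n) _ cspan.
have : g0 (- ev_cone (fun i k => A i k) xi) <= 0.
  apply: g0le; first by rewrite -scaleN1r -(rmorphN1 (real_complex R)); exact: spZ.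
  exists [::], 'I_n, (fun i k => A i k), xi.
  by rewrite !big_nil addNr.
rewrite gN// oppr_le0; congr (0 <= _); rewrite /ev_cone h2; apply: eq_bigr => i _.
rewrite Re_sum.
by have [_ ->] := g0sum _ (index_enum 'I_n) (fun k => ev (A i k) (xi k) (xi i)) (fun k => sp _ _ _).
Qed.

End Arveson.

Theorem arveson (R : realType) (H : hilbert R) : os_injective (fullsys H).
Proof. by move=> S T j f jemb fcp; exact: arveson_ext. Qed.

(** * Existence of injective envelopes *)

(** The construction of Hamana. Among the completely positive self-maps of
    B(H) that fix [S] choose one, [phi], for which the norms of the images are
    minimal; it is idempotent, its range is an injective operator system
    containing [S], and minimality leaves no smaller one. *)
Section InjectiveEnvelope.
Variables (R : realType) (S : opsys R).

Local Notation H := (os_hilb S).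
Local Notation A := (fullsys (os_hilb S)).

Definition full (H' : hilbert R) (B : bop H') : fullsys H' := @OsElt R (fullsys H') B isT.

Lemma fullK (H' : hilbert R) (x : fullsys H') : full (os_val x) = x.
Proof. exact/val_inj. Qed.

Lemma incl_linear (T : opsys R) : linear (fun s : T => full (os_val s)).
Proof. by move=> a s t; apply/val_inj. Qed.

Definition incl (T : opsys R) : {linear T -> fullsys (os_hilb T)} :=
  projT1 (cid (mk_linear (@incl_linear T))).

Lemma inclE (T : opsys R) (s : T) : os_val (incl T s) = os_val s.
Proof. by rewrite /incl; case: cid => g /= ->. Qed.

Lemma incl_uco (T : opsys R) : uco_embedding (incl T).
Proof.
split; first by apply/val_inj; rewrite /= inclE.
move=> n B; rewrite /os_pos (_ : map_mx _ (map_mx _ _) = map_mx (@os_val R T) B) //.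
by apply/matrixP => i j; rewrite !mxE inclE.
Qed.

Definition fixing (phi : {linear A -> A}) : Prop :=
  cp phi /\ forall s, phi (incl S s) = incl S s.

Definition Fix := {phi : {linear A -> A} | fixing phi}.

Lemma Fix_cp (p : Fix) : cp (sval p). Proof. by case: p => p []. Qed.
Lemma Fix_fix (p : Fix) s : sval p (incl S s) = incl S s. Proof. by case: p => p []. Qed.
Lemma Fix_ucp (p : Fix) : ucp (sval p).
Proof.
split; last exact: Fix_cp.
by have [h _] := incl_uco S; rewrite -[in LHS]h Fix_fix h.
Qed.

Lemma linearId_fixing : exists p : Fix, forall x, sval p x = x.
Proof.
have l1 : linear (fun x : A => x) by [].
have [g gE] := mk_linear l1.
have gf : fixing g.
  split=> [n B hB|s]; last by rewrite gE.
  by rewrite (_ : map_mx g B = B)//; apply/matrixP => i j; rewrite !mxE gE.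
by exists (exist _ g gf).
Qed.

Lemma Fix_comp (p q : Fix) : exists r : Fix, forall x, sval r x = sval p (sval q x).
Proof.
have l1 : linear (fun x => sval p (sval q x)) by move=> a x y; rewrite !linearP.
have [g gE] := mk_linear l1.
have gf : fixing g.
  split=> [|s]; last by rewrite gE !Fix_fix.
  exact: cp_comp (Fix_cp q) (Fix_cp p) gE.
by exists (exist _ g gf).
Qed.

Lemma bop_pos_comb n (a b : R) (X Y : 'M[bop H]_n) : 0 <= a -> 0 <= b ->
  bop_pos X -> bop_pos Y -> bop_pos (\matrix_(i, j) (a%:C *: X i j + b%:C *: Y i j)).
Proof.
move=> a0 b0 hX hY xi.
have a0' : 0 <= a%:C by rewrite ler0c.
have b0' : 0 <= b%:C by rewrite ler0c.
have := addr_ge0 (mulr_ge0 a0' (hX xi)) (mulr_ge0 b0' (hY xi)).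
congr (0 <= _); rewrite !mulr_sumr -big_split; apply: eq_bigr => i _.
rewrite !mulr_sumr -big_split; apply: eq_bigr => j _.
have hB := hilb_sip H.
by rewrite mxE bop_add !bop_scale (sipD hB) !(sipZ hB).
Qed.

Lemma Fix_convex (p q : Fix) (a b : R) : 0 <= a -> 0 <= b -> a + b = 1 ->
  exists r : Fix, forall x, sval r x = a%:C *: sval p x + b%:C *: sval q x.
Proof.
move=> a0 b0 ab1.
have l1 : linear (fun x => a%:C *: sval p x + b%:C *: sval q x).
  move=> c x y; rewrite (linearP (sval p)) (linearP (sval q)) /=.
  by rewrite !scalerDr !scalerA [a%:C * c]mulrC [b%:C * c]mulrC addrACA.
have [g gE] := mk_linear l1.
have gf : fixing g.
  split=> [n B hB|s].
    have := bop_pos_comb a0 b0 (Fix_cp p hB) (Fix_cp q hB).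
    rewrite /os_pos; congr bop_pos; apply/matrixP => i j; rewrite !mxE gE //.
  by rewrite gE !Fix_fix -scalerDl -rmorphD ab1 scale1r.
by exists (exist _ g gf).
Qed.

(** Comparison of the seminorms x |-> |phi x|, the operator norm being given
    by its upper bounds. *)
Definition shrinks (phi psi : Fix) : Prop := forall x (r : R), 0 <= r ->
  opnorm_le (os_val (sval phi x)) r -> opnorm_le (os_val (sval psi x)) r.

Definition minimal (phi : Fix) : Prop := forall psi, shrinks phi psi -> shrinks psi phi.

(** Zorn: a chain has an ultralimit along its tails, and norms do not increase
    in ultralimits. *)
Lemma exists_minimal : exists phi, minimal phi.
Proof.
have [p0 _] := linearId_fixing.
have [| | |phi hphi] := @ZL_preorder Fix p0 (fun p q => `[< shrinks p q >]).
- by move=> p; apply/asboolP => x r.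
- by move=> r s t /asboolP h /asboolP k; apply/asboolP => x c c0 /h -/(_ c0)/k; exact.
- move=> C Ctot; have [C0|/existsNP[c0 /contrapT Cc0]] := pselect (forall c, ~ C c).
    by exists p0 => s /C0.
  pose tail c := [set d | C d /\ shrinks c d].
  pose F := filter_from C tail.
  have FP : ProperFilter F.
    apply: filter_from_proper; last by move=> c Cc; exists c; split=> // x r.
    apply: filter_from_filter; first by exists c0.
    move=> c d Cc Cd; have [/asboolP cd|/asboolP dc] := Ctot c d Cc Cd.
      exists d => // e [Ce de]; split; split=> // x r r0 h; exact: de (cd _ _ r0 h).
    exists c => // e [Ce ce]; split; split=> // x r r0 h; exact: ce (dc _ _ r0 h).
  have [U [UU FU]] := ultraFilterLemma FP.
  pose phi (p : Fix) x := os_val (sval p x).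
  have lphi p : linear (phi p) by move=> a x y; rewrite /phi linearP.
  have bphi (x : A) : exists2 r : R, 0 <= r & forall p, opnorm_le (phi p x) r.
    have [r r0 hr] := opnorm_le_exists (os_val x); exists r; first exact: ltW.
    by move=> p; apply: (ucp_contractive (Fix_ucp p)) => //; exact: ltW.
  have [psi hpsi] := ultralimit (FU := UU) lphi bphi.
  have psif : fixing psi.
    split.
      apply: (ultralimit_cp (FU := UU) (phi := phi)) => // p k B hB.
      have := Fix_cp p hB; rewrite /os_pos; congr bop_pos.
      by apply/matrixP => i j; rewrite !mxE.
    move=> s; apply/val_inj/bop_ext => x y.
    apply: (zcvg_unique (F := U)) (hpsi _ x y) _.
    rewrite (_ : (fun i => _) = (fun=> hilb_ip H (os_val (incl S s) x) y)).
      exact: zcvg_cst.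
    by apply/funext => p; rewrite /phi Fix_fix.
  exists (exist _ psi psif) => c Cc; apply/asboolP => x r r0 h.
  apply: (ultralimit_norm (FU := UU) (phi := phi)) => //.
  apply: FU; exists c => // d [_ cd]; exact: cd.
by exists phi => psi /asboolP/hphi/asboolP.
Qed.

Lemma Fix_norm (p : Fix) x (r : R) : 0 <= r -> opnorm_le (os_val x) r ->
  opnorm_le (os_val (sval p x)) r.
Proof. exact: ucp_contractive (Fix_ucp p). Qed.

(** The average [chi] of the powers 1, phi, ..., phi^n telescopes on [x - phi
    x]. *)
Lemma ergodic (phi : Fix) n : exists chi : Fix, forall x, exists z,
  n.+1%:R *: sval chi (x - sval phi x) = x - z /\
  forall r : R, 0 <= r -> opnorm_le (os_val x) r -> opnorm_le (os_val z) r.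
Proof.
have [p0 p0E] := linearId_fixing.
elim: n => [|n [chi hchi]].
  exists p0 => x; exists (sval phi x); rewrite scale1r p0E; split=> // r; exact: Fix_norm.
have [q qE] := Fix_comp phi chi.
pose a : R := n.+2%:R^-1; pose b : R := n.+1%:R / n.+2%:R.
have n20 : n.+2%:R != 0 :> R by rewrite pnatr_eq0.
have [|||chi' hchi'] := @Fix_convex p0 q a b.
- by rewrite invr_ge0.
- by rewrite divr_ge0.
- by rewrite /a /b -[X in X + _]mul1r -mulrDl nat1r mulfV.
exists chi' => x; have [z [hz hzr]] := hchi x; exists (sval phi z); split; last first.
  by move=> r r0 /(hzr r r0); exact: Fix_norm.
have nC m : (m%:R : R[i]) = (m%:R : R)%:C by rewrite rmorph_nat.
rewrite hchi' p0E qE scalerDr !scalerA !nC -!rmorphM.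
have -> : n.+2%:R * a = 1 by rewrite mulfV.
have -> : n.+2%:R * b = n.+1%:R by rewrite /b mulrC divfK.
rewrite rmorph1 rmorph_nat scale1r -linearZ_LR /= hz linearB /=.
by rewrite addrA subrK.
Qed.

(** The averages of [ergodic], taken at [phi x], send [phi (x - phi x)] to
    elements of arbitrarily small norm. Composing [phi] with an average
    shrinks [phi], so by minimality [phi (x - phi x)] is itself small. *)
Lemma minimal_idem (phi : Fix) x : minimal phi -> sval phi (sval phi x) = sval phi x.
Proof.
move=> phimin.
suff : sval phi (x - sval phi x) = 0.
  by rewrite linearB => /eqP; rewrite subr_eq0 eq_sym => /eqP.
have [r r0 hr] := opnorm_le_exists (os_val x).
apply/val_inj; apply: (@opnorm_le_eq0 _ _ _ (4 * r)); last by rewrite mulr_gt0.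
move=> e e0; have [N hN] := dlt_small e0; have {}hN := hN N (leqnn _).
have [chi hchi] := ergodic phi N.
have [q qE] := Fix_comp chi phi.
have e0' := ltW e0; have r0' := ltW r0.
have sh : shrinks phi q by move=> y c c0; rewrite qE; exact: Fix_norm.
apply: (phimin _ sh); first by rewrite !mulr_ge0.
have [z [hz hzr]] := hchi (sval phi x).
rewrite qE linearB /=.
have hx := Fix_norm phi r0' hr; have hz' := hzr _ r0' hx.
have hd := opnorm_leB hx hz'.
have -> : sval chi (sval phi x - sval phi (sval phi x)) =
    (dlt R N)%:C *: (sval phi x - z).
  by rewrite -hz scalerA -(rmorph_nat (real_complex R)) -rmorphM mulVf ?scale1r.
have d0 := dlt_gt0 R N.
apply/opnorm_leP => [|y]; first by rewrite !mulr_ge0.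
have /(opnorm_leP _ _) := hd => /(_ (addr_ge0 r0' r0'))/(_ y) hy.
rewrite os_valZ bop_scale.
rewrite /hq (sipqZr (hilb_sip H)) -/(hq _).
apply: (@le_trans _ _ (e ^+ 2 * ((r + r) ^+ 2 * hq y))).
  apply: ler_pM; rewrite ?sqr_ge0 ?hq_ge0//.
  by rewrite ler_sqr ?nnegrE//; exact: ltW.
rewrite mulrA ler_wpM2r ?hq_ge0// -exprMn ler_sqr ?nnegrE ?mulr_ge0 ?addr_ge0//.
nra.
Qed.

Variable phi : Fix.
Hypothesis phi_min : minimal phi.

Let idem x : sval phi (sval phi x) = sval phi x := minimal_idem x phi_min.

(** The range of the idempotent [phi], described as its set of fixed points.
    *)
Definition env_pred : {pred bop H} := fun B => `[< os_val (sval phi (full B)) = B >].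

Lemma env_submod : submod_closed env_pred.
Proof.
split=> [|a x y /asboolP hx /asboolP hy]; apply/asboolP.
  by rewrite (_ : full 0 = 0) ?linear0//; exact/val_inj.
by rewrite (_ : full _ = a *: full x + full y) ?linearP/= ?hx ?hy//; exact/val_inj.
Qed.

Lemma env_unit : bop1 H \in env_pred.
Proof.
have [h _] := incl_uco S; have [h1 _] := Fix_ucp phi.
by apply/asboolP; rewrite -[full _]/(os_one A) h1.
Qed.

Lemma env_adj B C : B \in env_pred -> adjoint_of B C -> C \in env_pred.
Proof.
move=> /asboolP hB /adj_uniq ->; apply/asboolP.
rewrite (_ : full _ = os_star (full B)); last exact/val_inj.
by rewrite (cp_star _ (Fix_cp phi)) /= hB.
Qed.

Definition env : opsys R := OpSys env_submod env_unit env_adj.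

Lemma env_inP (s : S) : os_val s \in env_pred.
Proof.
apply/asboolP; rewrite (_ : full _ = incl S s) ?Fix_fix ?inclE//.
by apply/val_inj; rewrite /= inclE.
Qed.

Lemma env_projP (x : A) : os_val (sval phi x) \in env_pred.
Proof. by apply/asboolP; rewrite fullK idem. Qed.

Lemma env_in_linear : linear (fun s : S => @OsElt R env _ (env_inP s)).
Proof. by move=> a s t; apply/val_inj. Qed.
Lemma env_proj_linear : linear (fun x : A => @OsElt R env _ (env_projP x)).
Proof. by move=> a s t; apply/val_inj; rewrite /= linearP. Qed.

(** The range of [phi] is injective because B(H) is, by composing with [phi].
    If [J] is an injective system between [S] and the range, the projection
    onto [J] gives a map [Th] that fixes [S] and shrinks [phi]; it is then
    minimal, hence idempotent, and everything killed by [Th] is killed by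
    [phi], so that [J] is the whole range. *)
Lemma envelope : exists k : {linear S -> env}, injective_envelope k.
Proof.
have [k kE] := mk_linear env_in_linear.
have [P PE] := mk_linear env_proj_linear.
have Pcp : cp P.
  move=> n B hB; have := Fix_cp phi hB; rewrite /os_pos; congr bop_pos.
  by apply/matrixP => i j; rewrite !mxE PE.
have kuco : uco_embedding k.
  split=> [|n B]; first by rewrite kE; exact/val_inj.
  rewrite /os_pos (_ : map_mx _ (map_mx _ _) = map_mx (@os_val R S) B) //.
  by apply/matrixP => i j; rewrite !mxE kE.
have PI (y : env) : P (incl env y) = y.
  rewrite PE; apply/val_inj => /=; case: y => y yP /=.
  have -> : incl env (OsElt yP) = full y by apply/val_inj; rewrite /= inclE.
  exact/asboolP.
have env_inj : os_injective env.
  move=> S0 T0 j f jemb fcp.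
  have fl : linear (fun x => incl env (f x)) by move=> a x y; rewrite !linearP.
  have [f' f'E] := mk_linear fl.
  have f'cp : cp f' by apply: cp_comp fcp (uco_cp (incl_uco env)) f'E.
  have [g gcp gE] := @arveson R H S0 T0 j f' jemb f'cp.
  have gl : linear (fun x => P (g x)) by move=> a x y; rewrite !linearP.
  have [g' g'E] := mk_linear gl; exists g'; first exact: cp_comp gcp Pcp g'E.
  by move=> x; rewrite g'E gE f'E PI.
exists k; split=> // J j jemb Jinj jk z.
have il : linear (fun x : J => x) by [].
have [iJ iJE] := mk_linear il.
have iJcp : cp iJ.
  by move=> n B hB; rewrite (_ : map_mx iJ B = B)//; apply/matrixP => a b; rewrite !mxE iJE.
have [g gcp gE] := Jinj _ _ _ _ jemb iJcp.
pose psi x := j (g (P x)).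
have thl : linear (fun x : A => incl env (j (g (P x)))) by move=> a x y; rewrite !linearP.
have [th thE] := mk_linear thl.
have Pl : linear (fun x => g (P x)) by move=> a x y; rewrite !linearP.
have [gP gPE] := mk_linear Pl.
have jgPl : linear (fun x => j (g (P x))) by move=> a x y; rewrite !linearP.
have [jgP jgPE] := mk_linear jgPl.
have PE' s : P (incl S s) = k s.
  by rewrite PE kE; apply/val_inj; rewrite /= Fix_fix inclE.
have jg s : j (g (k s)) = k s.
  by have [y yE] := jk s; rewrite -yE gE iJE.
have ksE s : incl env (k s) = incl S s.
  by apply/val_inj; rewrite /= !inclE kE.
have thf : fixing th.
  split=> [|s]; last by rewrite thE PE' jg ksE.
  have gPcp : cp gP by exact: cp_comp Pcp gcp gPE.
  have jgPcp : cp jgP.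
    by apply: (@cp_comp _ _ _ _ gP j) => // [|x]; [exact: uco_cp|rewrite jgPE gPE].
  apply: (@cp_comp _ _ _ _ jgP (incl env)) => // [|x]; first exact: (uco_cp (incl_uco env)).
  by rewrite thE jgPE.
pose Th : Fix := exist _ th thf.
have jgucp : exists2 jg' : {linear env -> env}, ucp jg' & forall x, jg' x = j (g x).
  have l1 : linear (fun x => j (g x)) by move=> a x y; rewrite !linearP.
  have [jg' jg'E] := mk_linear l1; exists jg' => //; split.
    by have [k1 _] := kuco; rewrite jg'E -k1 jg.
  exact: cp_comp gcp (uco_cp jemb) jg'E.
have [jg' jg'ucp jg'E] := jgucp.
have sh1 : shrinks phi Th.
  move=> x r r0 h; rewrite /= thE inclE -jg'E.
  have hP : opnorm_le (os_val (P x)) r by rewrite PE.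
  exact: (ucp_contractive jg'ucp r0 hP).
have sh2 := phi_min sh1.
have Thmin : minimal Th.
  move=> chi h; have h2 : shrinks phi chi by move=> x r r0 /(sh1 _ _ r0)/(h _ _ r0).
  by move=> x r r0 /(phi_min h2 r0)/(sh1 _ _ r0).
exists (g z); apply/eqP; rewrite eq_sym -subr_eq0; apply/eqP.
have thz w : th (incl env w) = incl env (j (g w)) by rewrite thE PI.
have w0 : th (incl env (z - j (g z))) = 0.
  rewrite !linearB /=.
  have := minimal_idem (incl env z) Thmin; rewrite /= => hid.
  by rewrite -[incl env (j (g z))]thz hid subrr.
have : opnorm_le (os_val (sval phi (incl env (z - j (g z))))) 0.
  apply: (sh2 _ _ (lexx _)); rewrite /= w0 => x; rewrite mul0r.
  by rewrite -[os_val 0 x]/0 normr0.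
have -> : sval phi (incl env (z - j (g z))) = incl env (z - j (g z)).
  by apply/val_inj; have := congr1 (@os_val R env) (PI (z - j (g z))); rewrite PE /= inclE.
rewrite inclE => h; apply/val_inj; apply: (@opnorm_le_eq0 _ _ _ 1) => // e e0 x.
by apply: (le_trans (h x)); rewrite mul0r mulr_ge0// ler0c mul1r ltW.
Qed.

End InjectiveEnvelope.

Lemma injective_envelope_exists (R : realType) (S : opsys R) :
  exists (I : opsys R) (k : {linear S -> I}), injective_envelope k.
Proof.
have [phi phi_min] := exists_minimal S.
by have [k hk] := envelope phi_min; exists (env phi), k.
Qed.

(** * Tensor products and the cone D_n *)

Section ConjLinear.
Variable R : realType.
Implicit Types x y : R[i].
Lemma conjM x y : conjc (x * y) = conjc x * conjc y. Proof. exact: rmorphM. Qed.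
Lemma conjD x y : conjc (x + y) = conjc x + conjc y. Proof. exact: rmorphD. Qed.
Lemma conjN x : conjc (- x) = - conjc x. Proof. exact: rmorphN. Qed.
Lemma conj_sum I (r : seq I) (F : I -> R[i]) :
  conjc (\sum_(i <- r) F i) = \sum_(i <- r) conjc (F i).
Proof. exact: rmorph_sum. Qed.
Lemma linC (U : lmodType R[i]) (g : {linear U -> R[i]}) c u : g (c *: u) = c * g u.
Proof. exact: linearZ_LR. Qed.
End ConjLinear.

Section TensorBasics.
Variables (R : realType) (U V : lmodType R[i]).

Lemma tensDl (x x' : U) (y : V) : tens (x + x') y = tens x y + tens x' y.
Proof. exact: linearDl. Qed.
Lemma tensDr (x : U) (y y' : V) : tens x (y + y') = tens x y + tens x y'.
Proof. exact: linearDr. Qed.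
Lemma tensZl a (x : U) (y : V) : tens (a *: x) y = a *: tens x y.
Proof. exact: linearZl_LR. Qed.
Lemma tensZr a (x : U) (y : V) : tens x (a *: y) = a *: tens x y.
Proof. exact: linearZr_LR. Qed.
Lemma tens0l (y : V) : tens (0 : U) y = 0.
Proof. exact: linear0l. Qed.
Lemma tens0r (x : U) : tens x (0 : V) = 0.
Proof. exact: linear0r. Qed.
Lemma tens_sumr I (r : seq I) (F : I -> V) (x : U) :
  tens x (\sum_(i <- r) F i) = \sum_(i <- r) tens x (F i).
Proof. by elim/big_rec2: _ => [|i a b _ <-]; rewrite ?tens0r ?tensDr. Qed.

Lemma tensor_sum (z : tensor U V) : exists l : seq (U * V), z = \sum_(p <- l) tens p.1 p.2.
Proof.
exists (repr z).
have idl : linear (fun x : tensor U V => x) by [].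
have [g gE] := mk_linear idl.
have := @tensor_lift_unique _ U V (tensor U V) (@tens _ U V) g (fun x y => gE _) z.
by rewrite gE.
Qed.

(** Induction on the length of a representation of [z]. If the second
    component of the first term is a combination of the others, the term is
    absorbed into them; otherwise the equations, read for fixed [x] as a
    dependence relation, force all values of the first component to vanish. *)
Lemma tensor_separation (X Y : Type) (a : X -> {linear U -> R[i]}) (b : Y -> {linear V -> R[i]})
    (z : tensor U V) (l : seq (U * V)) :
  (forall u, (forall x, a x u = 0) -> u = 0) ->
  (forall v, (forall y, b y v = 0) -> v = 0) ->
  z = \sum_(p <- l) tens p.1 p.2 ->
  (forall x y, \sum_(p <- l) a x p.1 * b y p.2 = 0) -> z = 0.
Proof.
move=> ha hb -> {z}; elim: {l}(size l) {-2}l (eqxx (size l)) => [|m IH] l.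
  by move=> /nilP -> _; rewrite big_nil.
case: l => // [[u0 v0] l] /=; rewrite eqSS => ls h.
have [[c Ec]|ndep] := pselect (exists c : nat -> R[i], v0 = \sum_(i < size l) c i *: (nth (0, 0) l i).2).
  pose l' := [seq ((nth (0, 0) l i).1 + c i *: u0, (nth (0, 0) l i).2) | i <- iota 0 (size l)].
  have sl' : size l' == m by rewrite /l' size_map size_iota.
  have El' (F : U * V -> tensor U V) : \sum_(p <- l') F p =
     \sum_(i < size l) F ((nth (0, 0) l i).1 + c i *: u0, (nth (0, 0) l i).2).
    by rewrite /l' big_map -{1}[size l]subn0 big_mkord.
  have El'' (F : U * V -> R[i]) : \sum_(p <- l') F p =
     \sum_(i < size l) F ((nth (0, 0) l i).1 + c i *: u0, (nth (0, 0) l i).2).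
    by rewrite /l' big_map -{1}[size l]subn0 big_mkord.
  have := IH l' sl'; rewrite El' => IH'.
  rewrite big_cons /= {1}Ec tens_sumr (big_nth (0, 0)) big_mkord -big_split /=.
  rewrite -[RHS]IH'.
    by apply: eq_bigr => i _; rewrite /= tensDl tensZl tensZr addrC.
  move=> x y; rewrite El'' -[RHS](h x y) big_cons /= {1}Ec.
  rewrite (big_nth (0, 0)) big_mkord linear_sum mulr_sumr -big_split /=.
  by apply: eq_bigr => i _; rewrite linearD !linC /= mulrDl addrC mulrCA mulrA.
have u00 : u0 = 0.
  apply: ha => x; apply: contrapT => /eqP ax0; apply: ndep.
  exists (fun i => - (a x u0)^-1 * a x (nth (0, 0) l i).1).
  apply/eqP; rewrite -subr_eq0; apply/eqP/hb => y.
  rewrite linearB linear_sum /=; have := h x y; rewrite big_cons /=.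
  rewrite (big_nth (0, 0)) big_mkord => /(congr1 (fun w => (a x u0)^-1 * w)).
  rewrite mulr0 mulrDr mulrA mulVf// mul1r => E; rewrite -[RHS]E; congr (_ + _).
  rewrite -sumrN mulr_sumr; apply: eq_bigr => i _.
  by rewrite linC !mulNr opprK mulrA.
rewrite big_cons /= u00 tens0l add0r; apply: IH => // x y.
by have := h x y; rewrite big_cons /= u00 linear0 mul0r add0r.
Qed.

End TensorBasics.

Section MaxCone.
Variable R : realType.

Section OnePair.
Variables (S T : opsys R) (n : nat).

(** Matrices of tensors as plain functions, for which sums, scalings and zero
    are pointwise by definition. *)
Definition tmx := 'I_n -> 'I_n -> tensor S T.
HB.instance Definition _ := GRing.Lmodule.on tmx.

Lemma tmxDE (u v : tmx) i j : (u + v) i j = u i j + v i j. Proof. by []. Qed.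
Lemma tmxZE c (u : tmx) i j : (c *: u) i j = c *: u i j. Proof. by []. Qed.
Lemma tmxNE (u : tmx) i j : (- u) i j = - u i j. Proof. by []. Qed.
Lemma tmx0E i j : (0 : tmx) i j = 0. Proof. by []. Qed.

Definition tunit : tmx := fun i j => ((i == j)%:R : R[i]) *: tens (os_one S) (os_one T).

(** The term a a^* (x) s (x) t. *)
Definition dyad (a : 'I_n -> R[i]) (s : S) (t : T) : tmx :=
  fun i j => (a i * conjc (a j)) *: tens s t.

(** The cone D_n, with arbitrary finite index types so that sums in D_n are
    direct sums of the data. *)
Definition mcone (u : tmx) : Prop :=
  exists (X Y : finType) (P : X -> X -> S) (Q : Y -> Y -> T) (a : 'I_n -> X * Y -> R[i]),
    [/\ ospos P, ospos Q & forall i j, u i j =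
      \sum_z \sum_z' (a i z * conjc (a j z')) *: tens (P z.1 z'.1) (Q z.2 z'.2)].

Lemma mcone_of_precone (u : 'M[tensor S T]_n) : max_precone u -> mcone (fun i j => u i j).
Proof.
move=> [k [m [P [Q [a [hP hQ ->]]]]]].
exists 'I_k, 'I_m, (fun x y => P x y), (fun x y => Q x y), (fun i z => a i (mxtens_index z)).
split; [exact/ospos_ord|exact/ospos_ord|move=> i j].
rewrite mxE (reindex (@mxtens_index k m)) /=; last first.
  by exists (@mxtens_unindex k m) => z _; [exact: mxtens_indexK|exact: mxtens_unindexK].
apply: eq_bigr => z _; rewrite (reindex (@mxtens_index k m)) /=; last first.
  by exists (@mxtens_unindex k m) => z' _; [exact: mxtens_indexK|exact: mxtens_unindexK].
by apply: eq_bigr => z' _; rewrite mxE !mxtens_indexK.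
Qed.

Lemma precone_of_mcone (u : 'M[tensor S T]_n) : mcone (fun i j => u i j) -> max_precone u.
Proof.
move=> [X [Y [P [Q [a [hP hQ hu]]]]]].
pose dec (p : 'I_(#|X| * #|Y|)) : X * Y :=
  (enum_val (mxtens_unindex p).1, enum_val (mxtens_unindex p).2).
pose enc (z : X * Y) : 'I_(#|X| * #|Y|) := mxtens_index (enum_rank z.1, enum_rank z.2).
have encK : cancel enc dec by move=> [x y]; rewrite /dec /enc mxtens_indexK /= !enum_rankK.
have decK : cancel dec enc.
  by move=> p; rewrite /dec /enc /= !enum_valK; exact: (mxtens_unindexK p).
exists #|X|, #|Y|, (fmx P), (fmx Q), (\matrix_(i, p) a i (dec p)); split.
- exact/ospos_mx.
- exact/ospos_mx.
- apply/matrixP => i j; rewrite hu mxE (reindex dec) /=; last by exists enc => p _.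
  apply: eq_bigr => p _; rewrite (reindex dec) /=; last by exists enc => q _.
  by apply: eq_bigr => q _; rewrite !mxE.
Qed.

Lemma mcone_dyad a s t : spos s -> spos t -> mcone (dyad a s t).
Proof.
move=> /spos_ospos hs /spos_ospos ht.
exists 'I_1, 'I_1, (fun _ _ => s), (fun _ _ => t), (fun i _ => a i).
split=> // i j; rewrite -(pair_bigA _ (fun _ _ => \sum_z' _)) /= !big_ord1.
by rewrite -(pair_bigA _ (fun _ _ => _)) /= !big_ord1.
Qed.

(** The part of a sum over pairs that survives when only matching summands of
    two disjoint unions interact. *)
Lemma big_sum_diag (W : zmodType) (X1 X2 Y1 Y2 : finType)
    (F : (X1 + X2) * (Y1 + Y2) -> W) :
  (forall x y, F (inl x, inr y) = 0) -> (forall x y, F (inr x, inl y) = 0) ->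
  \sum_z F z = \sum_(z : X1 * Y1) F (inl z.1, inl z.2) + \sum_(z : X2 * Y2) F (inr z.1, inr z.2).
Proof.
move=> h1 h2.
rewrite !sum_pair big_sumType /=; congr (_ + _); apply: eq_bigr => x _.
  by rewrite big_sumType /= [X in _ + X]big1 ?addr0.
by rewrite big_sumType /= [X in X + _]big1 ?add0r.
Qed.

Lemma mcone_add u v : mcone u -> mcone v -> mcone (u + v).
Proof.
move=> [X1 [Y1 [P1 [Q1 [a1 [hP1 hQ1 hu]]]]]] [X2 [Y2 [P2 [Q2 [a2 [hP2 hQ2 hv]]]]]].
pose a i (z : (X1 + X2) * (Y1 + Y2)) : R[i] := match z with
  | (inl x, inl y) => a1 i (x, y) | (inr x, inr y) => a2 i (x, y) | _ => 0 end.
exists (X1 + X2)%type, (Y1 + Y2)%type, (dsum P1 P2), (dsum Q1 Q2), a; split.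
- exact: ospos_dsum.
- exact: ospos_dsum.
move=> i j; rewrite tmxDE hu hv big_sum_diag; last 2 first.
- by move=> x y; apply: big1 => z _; rewrite mul0r scale0r.
- by move=> x y; apply: big1 => z _; rewrite mul0r scale0r.
congr (_ + _); apply: eq_bigr => -[x y] _ /=; rewrite big_sum_diag /=; last 2 first.
- by move=> *; rewrite ?tens0r ?tens0l scaler0.
- by move=> *; rewrite ?tens0r ?tens0l scaler0.
- rewrite [X in _ = _ + X]big1 ?addr0; last by move=> z _; rewrite tens0l scaler0.
  by apply: eq_bigr => -[x' y'] _.
- by move=> *; rewrite ?tens0r ?tens0l scaler0.
- by move=> *; rewrite ?tens0r ?tens0l scaler0.
- rewrite [X in _ = X + _]big1 ?add0r; last by move=> z _; rewrite tens0l scaler0.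
  by apply: eq_bigr => -[x' y'] _.
Qed.

Lemma mcone_scale (r : R) u : 0 <= r -> mcone u -> mcone (r%:C *: u).
Proof.
move=> r0 [X [Y [P [Q [a [hP hQ hu]]]]]].
exists X, Y, (fun x y => r%:C *: P x y), Q, a; split=> //; first exact: ospos_scale.
move=> i j; rewrite tmxZE hu scaler_sumr; apply: eq_bigr => z _.
by rewrite scaler_sumr; apply: eq_bigr => z' _; rewrite tensZl !scalerA mulrC.
Qed.

Lemma spos_one (W : opsys R) : spos (os_one W).
Proof. by move=> xi; rewrite (sipqE (hilb_sip _)) ler0c hq_ge0. Qed.

Lemma mcone0 : mcone 0.
Proof.
rewrite (_ : 0 = dyad (fun _ => 0) (os_one S) (os_one T)); last first.
  by apply/funext => i; apply/funext => j; rewrite /dyad mul0r scale0r.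
by apply: mcone_dyad; exact: spos_one.
Qed.

Lemma mcone_sum I (r : seq I) (F : I -> tmx) : (forall i, mcone (F i)) ->
  mcone (\sum_(i <- r) F i).
Proof. by move=> h; elim/big_rec: _ => [|i x _ hx]; [exact: mcone0|exact: mcone_add]. Qed.

Lemma tunitE : tunit = \sum_(k < n) dyad (fun i => (i == k)%:R) (os_one S) (os_one T).
Proof.
apply/funext => i; apply/funext => j; rewrite /tunit !fct_sumE (bigD1 i)//= big1.
  by rewrite addr0 /dyad eqxx mul1r conjc_nat eq_sym.
by move=> k /negPf ki; rewrite /dyad [i == k]eq_sym ki mul0r scale0r.
Qed.

Lemma mcone_unit : mcone tunit.
Proof. by rewrite tunitE; apply: mcone_sum => k; apply: mcone_dyad; exact: spos_one. Qed.

(** The real span of the positive dyads; it consists exactly of the hermitian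
    elements ([hermt_rspan], [hermt_rspanP]). *)
Inductive rspan : tmx -> Prop :=
| rspan0 : rspan 0
| rspan_cons (r : R) a s t w : spos s -> spos t -> rspan w -> rspan (r%:C *: dyad a s t + w).

Lemma rspan_add u v : rspan u -> rspan v -> rspan (u + v).
Proof.
elim=> [|r a s t w hs ht hw IH] hv; first by rewrite add0r.
by rewrite -addrA; apply: rspan_cons => //; exact: IH.
Qed.

Lemma rspan_scale (r : R) u : rspan u -> rspan (r%:C *: u).
Proof.
elim=> [|r' a s t w hs ht hw IH]; first by rewrite scaler0; exact: rspan0.
by rewrite scalerDr scalerA -rmorphM; apply: rspan_cons.
Qed.

Lemma rspan_opp u : rspan u -> rspan (- u).
Proof.
by move=> /(rspan_scale (-1)); rewrite rmorphN1 scaleN1r.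
Qed.

Lemma rspan_dyad a s t : spos s -> spos t -> rspan (dyad a s t).
Proof.
move=> hs ht; rewrite -[dyad a s t]addr0 -[dyad a s t]scale1r -(rmorph1 (real_complex R)).
by apply: rspan_cons => //; exact: rspan0.
Qed.

Lemma rspan_unit : rspan tunit.
Proof.
rewrite tunitE; elim/big_rec: _ => [|i x _ hx]; first exact: rspan0.
by apply: rspan_add => //; apply: rspan_dyad; exact: spos_one.
Qed.


Local Notation KS := (os_hilb S).
Local Notation KT := (os_hilb T).

Definition pfun_fun (x x' : KS) (y y' : KT) (s : S) (t : T) : R[i] :=
  hilb_ip KS (os_val s x) x' * hilb_ip KT (os_val t y) y'.

Lemma pfun_bilinear x x' y y' : bilinear_for *:%R *:%R (pfun_fun x x' y y').
Proof.
split=> [t a s s'|s a t t']; rewrite /pfun_fun ip_osD ip_osZ.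
  by rewrite mulrDl -mulrA.
by rewrite mulrDr mulrCA.
Qed.

HB.instance Definition _ x x' y y' := bilinear_isBilinear.Build R[i] S T R[i]
  *:%R *:%R (pfun_fun x x' y y') (pfun_bilinear x x' y y').

(** The matrix coefficient of s (x) t on the vectors x (x) y and x' (x) y'. *)
Definition pfun x x' y y' : tensor S T -> R[i] := tensor_lift (pfun_fun x x' y y').

HB.instance Definition _ x x' y y' := GRing.Linear.on (pfun x x' y y').

Lemma pfunE x x' y y' s t : pfun x x' y y' (tens s t) =
  hilb_ip KS (os_val s x) x' * hilb_ip KT (os_val t y) y'.
Proof. exact: tensor_liftE. Qed.

Lemma pfunD x x' y y' z w : pfun x x' y y' (z + w) = pfun x x' y y' z + pfun x x' y y' w.
Proof. exact: linearD. Qed.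
Lemma pfunZ x x' y y' c z : pfun x x' y y' (c *: z) = c * pfun x x' y y' z.
Proof. exact: linearZ_LR. Qed.

Lemma pfun_sum x x' y y' I (r : seq I) (F : I -> tensor S T) :
  pfun x x' y y' (\sum_(i <- r) F i) = \sum_(i <- r) pfun x x' y y' (F i).
Proof. exact: linear_sum. Qed.

Lemma pfun_separation z : (forall x x' y y', pfun x x' y y' z = 0) -> z = 0.
Proof.
have vl (W : opsys R) (x : os_hilb W * os_hilb W) :
    exists g : {linear W -> R[i]}, g =1 (fun s => hilb_ip _ (os_val s x.1) x.2).
  by apply: (@mk_linear R[i] W R[i]) => a s t; rewrite ip_osD ip_osZ.
have /choice[a ha] := vl S; have /choice[b hb] := vl T.
have sep (W : opsys R) (s : W) :
    (forall x, hilb_ip _ (os_val s x.1) x.2 = 0) -> s = 0.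
  move=> h; apply/val_inj/bop_ext => x y; rewrite [LHS](h (x, y)); exact/esym/ip_os0.
move=> h; have [l zE] := tensor_sum z; apply: (tensor_separation _ _ zE) => [s hs|t ht|x y].
- by apply: sep => x; rewrite -ha.
- by apply: sep => x; rewrite -hb.
rewrite -[RHS](h x.1 x.2 y.1 y.2) zE linear_sum; apply: eq_bigr => p _.
by rewrite ha hb; exact/esym/pfunE.
Qed.

(** Invariance under the involution of the matrices over the tensor product,
    expressed by matrix coefficients. *)
Definition hermt (w : tmx) : Prop := forall i j x x' y y',
  pfun x' x y' y (w j i) = conjc (pfun x x' y y' (w i j)).

(** A hermitian element that stays hermitian after multiplication by i has
    coefficients equal to their negatives. *)
Lemma hermt_i k : hermt k -> hermt ('i *: k) -> k = 0.
Proof.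
move=> h1 h2; apply/funext => i; apply/funext => j.
apply: pfun_separation => x x' y y'; have := h2 j i x' x y' y.
rewrite !tmxZE !pfunZ conjM conjc_i -(h1 j i x' x y' y) => /eqP.
rewrite -subr_eq0 mulNr opprK -mulrDl mulf_eq0 => /orP[/eqP/(congr1 (@complex.Im R))|/eqP//].
by rewrite ImD /= => /eqP; rewrite -mulr2n pnatr_eq0.
Qed.

Lemma hermtD u v : hermt u -> hermt v -> hermt (u + v).
Proof.
by move=> h1 h2 i j x x' y y'; rewrite !tmxDE !pfunD rmorphD /= h1 h2.
Qed.

Lemma hermtZ (r : R) u : hermt u -> hermt (r%:C *: u).
Proof.
by move=> h i j x x' y y'; rewrite !tmxZE !pfunZ conjM conjc_real h.
Qed.

Lemma hermt_mcone u : mcone u -> hermt u.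
Proof.
move=> [X [Y [P [Q [a [hP hQ hu]]]]]] i j x x' y y'.
rewrite !hu !pfun_sum conj_sum; under eq_bigr do rewrite pfun_sum.
under [RHS]eq_bigr do rewrite pfun_sum conj_sum.
rewrite exchange_big; apply: eq_bigr => z _; apply: eq_bigr => z' _.
rewrite !pfunZ !pfunE !conjM conjcK; congr (_ * _); first exact: mulrC.
rewrite (ospos_herm z.1 z'.1 hP) (ospos_herm z.2 z'.2 hQ) /= !adjP'.
by rewrite -!(sipC (hilb_sip _)).
Qed.

Lemma hermt_rspan u : rspan u -> hermt u.
Proof.
elim=> [|r a s t w hs ht _ IH].
  by move=> i j x x' y y'; rewrite !tmx0E !linear0.
by apply: hermtD => //; apply: hermtZ; apply: hermt_mcone; exact: mcone_dyad.
Qed.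

Definition cspan (w : tmx) : Prop := exists h k, [/\ rspan h, rspan k & w = h + 'i *: k].

Lemma cspan_rspan w : rspan w -> cspan w.
Proof. by move=> h; exists w, 0; rewrite scaler0 addr0; split=> //; exact: rspan0. Qed.

Lemma cspan_add u v : cspan u -> cspan v -> cspan (u + v).
Proof.
move=> [h [k [hh hk ->]]] [h' [k' [hh' hk' ->]]]; exists (h + h'), (k + k').
by split; [exact: rspan_add|exact: rspan_add|rewrite scalerDr addrACA].
Qed.

Lemma cspan_scale c u : cspan u -> cspan (c *: u).
Proof.
move=> [h [k [hh hk ->]]].
exists ((Re c)%:C *: h + (- Im c)%:C *: k), ((Im c)%:C *: h + (Re c)%:C *: k); split.
- by apply: rspan_add; exact: rspan_scale.
- by apply: rspan_add; exact: rspan_scale.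
have eN : (- Im c)%:C = - (Im c)%:C by exact: rmorphN.
rewrite {1}[c]complexE eN; move: (Re c)%:C (Im c)%:C => a b.
rewrite scalerDl !scalerDr !scalerA [RHS]addrACA [LHS]addrACA; congr (_ + _).
rewrite addrC; congr (_ *: _ + _ *: _); last exact: mulrC.
by rewrite mulrAC -expr2 sqr_i mulN1r.
Qed.

Lemma cspan_sum I (r : seq I) (F : I -> tmx) : (forall i, cspan (F i)) ->
  cspan (\sum_(i <- r) F i).
Proof.
move=> h; elim/big_rec: _ => [|i x _ hx]; last exact: cspan_add.
by apply: cspan_rspan; exact: rspan0.
Qed.

Lemma spos_sub_norm (W : opsys R) (s : W) (r : R) : 0 <= r -> opnorm_le (os_val s) r ->
  os_star s = s -> spos (r%:C *: os_one W - s).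
Proof.
move=> r0 hr hs xi; have hB := hilb_sip (os_hilb W).
rewrite ip_osD ip_osZ -scaleN1r ip_osZ (sipqE hB) -/(hq xi) mulN1r.
have Im0 : Im (hilb_ip _ (os_val s xi) xi) = 0.
  have E : hilb_ip _ (os_val s xi) xi = conjc (hilb_ip _ (os_val s xi) xi).
    by rewrite -{1}hs /= adjP' -(sipC hB).
  by have := congr1 (@complex.Im R) E; rewrite ImC; lra.
have := opnorm_le_Re xi r0 hr; move=> k.
by apply/ge0cP; rewrite !reim Im0 ?mul0r ?mulr0 ?subr0 ?addr0; split; lra.
Qed.

Lemma spos_star (W : opsys R) (s : W) : spos s -> os_star s = s.
Proof. by move=> /spos_ospos h; exact/esym/(ospos_herm ord0 ord0 h). Qed.

(** Hermitian elements become positive after adding a multiple of the unit,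
    and every element is h + i k with h and k hermitian. *)
Lemma spos_decomp (W : opsys R) (s : W) : exists p1 p2 c,
  [/\ spos p1, spos p2 & s = p1 + 'i *: p2 + c *: os_one W].
Proof.
pose h := (2^-1)%:C *: (s + os_star s).
pose k := (2^-1)%:C *: ('i *: (os_star s - s)).
have hs : os_star h = h.
  by rewrite /h os_starZ conjc_real os_starD os_starK addrC.
have ks : os_star k = k.
  rewrite /k !os_starZ conjc_real os_starD os_starN os_starK conjc_i scaleNr -scalerN.
  by rewrite opprB.
have hk : s = h + 'i *: k.
  rewrite /k scalerA ['i * _]mulrC -scalerA (scalerA 'i 'i) -expr2 sqr_i scaleN1r scalerN.
  have gen (x y : W) : x + y - (y - x) = x + x by rewrite opprB addrACA subrr addr0.
  rewrite /h -scalerBr gen.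
  rewrite scalerDr -scalerDl -rmorphD; have -> : 2^-1 + 2^-1 = 1 :> R by field.
  by rewrite rmorph1 scale1r.
have [r r0 hr] := opnorm_le_exists (os_val (- h)).
have [r' r'0 hr'] := opnorm_le_exists (os_val (- k)).
exists (r%:C *: os_one W - - h), (r'%:C *: os_one W - - k), (- (r%:C + 'i * r'%:C)).
split; [by apply: spos_sub_norm => //; [exact: ltW|rewrite os_starN hs]|
  by apply: spos_sub_norm => //; [exact: ltW|rewrite os_starN ks]|].
have gen (o x y : W) (a b : R[i]) :
    x + 'i *: y = (a *: o + x) + 'i *: (b *: o + y) + (- (a + 'i * b)) *: o.
  by rewrite scalerDr scaleNr scalerDl scalerA addrACA [X in _ = X - _]addrC addrK.
by rewrite {1}hk !opprK; exact: gen.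
Qed.

Lemma dyadDl a s s' t : dyad a (s + s') t = dyad a s t + dyad a s' t.
Proof. by apply/funext => i; apply/funext => j; rewrite tmxDE /dyad tensDl scalerDr. Qed.
Lemma dyadDr a s t t' : dyad a s (t + t') = dyad a s t + dyad a s t'.
Proof. by apply/funext => i; apply/funext => j; rewrite tmxDE /dyad tensDr scalerDr. Qed.
Lemma dyadZl a c s t : dyad a (c *: s) t = c *: dyad a s t.
Proof. by apply/funext => i; apply/funext => j; rewrite tmxZE /dyad tensZl !scalerA mulrC. Qed.
Lemma dyadZr a c s t : dyad a s (c *: t) = c *: dyad a s t.
Proof. by apply/funext => i; apply/funext => j; rewrite tmxZE /dyad tensZr !scalerA mulrC. Qed.

Lemma dyadNl a s t : dyad a (- s) t = - dyad a s t.
Proof. by rewrite -scaleN1r dyadZl scaleN1r. Qed.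
Lemma dyadNr a s t : dyad a s (- t) = - dyad a s t.
Proof. by rewrite -scaleN1r dyadZr scaleN1r. Qed.

Lemma cspan_dyad a s t : cspan (dyad a s t).
Proof.
have [p1 [p2 [c [h1 h2 ->]]]] := spos_decomp s.
have [q1 [q2 [d [k1 k2 ->]]]] := spos_decomp t.
have o1 := @spos_one S; have o2 := @spos_one T.
rewrite !dyadDl !dyadDr !dyadZl !dyadZr.
by repeat apply: cspan_add; do ?apply: cspan_scale; apply: cspan_rspan; exact: rspan_dyad.
Qed.

(** The general term a b^* (x) s (x) t is a combination of four dyads by
    polarization. *)
Lemma cspanT w : cspan w.
Proof.
pose d (k : 'I_n) : 'I_n -> R[i] := fun i => (i == k)%:R.
pose el2 (a b : 'I_n -> R[i]) s t : tmx := fun i j => (a i * conjc (b j)) *: tens s t.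
have h2 a b s t : cspan (el2 a b s t).
  have -> : el2 a b s t = 4^-1 *: (dyad (fun i => a i + b i) s t - dyad (fun i => a i - b i) s t
     + 'i *: dyad (fun i => a i + 'i * b i) s t - 'i *: dyad (fun i => a i - 'i * b i) s t).
    apply/funext => i; apply/funext => j.
    rewrite tmxZE !tmxDE !tmxNE !tmxZE /el2 /dyad !scalerA -scalerBl -scalerDl -scalerBl scalerA.
    congr (_ *: _); rewrite ?(conjD, conjN, conjM, conjc_i).
    move: (conjc (a j)) (conjc (b j)) (a i) (b i) => x' y' x y.
    have i2 : ('i : R[i]) * 'i = -1 by rewrite -expr2 sqr_i.
    have E : (x + y) * (x' + y') - (x - y) * (x' - y') + 'i * ((x + 'i * y) * (x' + - 'i * y'))
      - 'i * ((x - 'i * y) * (x' - - 'i * y')) = 2 * (x * y' + y * x') + ('i * 'i) * 2 * (y * x' - x * y').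
      by ring.
    rewrite E i2; have -> : 2 * (x * y' + y * x') + -1 * 2 * (y * x' - x * y') = 4 * (x * y').
      by ring.
    by rewrite mulKf// pnatr_eq0.
  have e := cspan_dyad.
  apply: cspan_scale; apply: cspan_add; last by rewrite -scaleNr; exact: cspan_scale.
  apply: cspan_add; last exact: cspan_scale.
  by apply: cspan_add => //; rewrite -scaleN1r; exact: cspan_scale.
have /choice[l hl] (p : 'I_n * 'I_n) := tensor_sum (w p.1 p.2).
have -> : w = \sum_i \sum_j \sum_(p <- l (i, j)) el2 (d i) (d j) p.1 p.2.
  apply/funext => i; apply/funext => j; rewrite !fct_sumE (bigD1 i)//= [X in _ + X]big1 ?addr0.
    rewrite !fct_sumE (bigD1 j)//= [X in _ + X]big1 ?addr0.
      rewrite !fct_sumE {1}(hl (i, j)); apply: eq_bigr => p _.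
      by rewrite /el2 /d !eqxx mul1r conjc1 scale1r.
    move=> k /negPf kj; rewrite !fct_sumE; apply: big1 => p _.
    by rewrite /el2 /d [j == k]eq_sym kj conjc0 mulr0 scale0r.
  move=> k /negPf ki; rewrite !fct_sumE; apply: big1 => m _; rewrite !fct_sumE.
  by apply: big1 => p _; rewrite /el2 /d [i == k]eq_sym ki mul0r scale0r.
by apply: cspan_sum => i; apply: cspan_sum => j; apply: cspan_sum => p.
Qed.

Lemma hermt_rspanP u : hermt u -> rspan u.
Proof.
move=> hu; have [h [k [hh hk uE]]] := cspanT u.
suff k0 : k = 0 by rewrite uE k0 scaler0 addr0.
apply: hermt_i; first exact: hermt_rspan.
have -> : 'i *: k = u - h by rewrite uE addrC addKr.
by apply: hermtD => //; apply: hermt_rspan; exact: rspan_opp.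
Qed.


End OnePair.
End MaxCone.

(** * Separation from the cone D_n *)

(** Vector space identities, stated for an abstract space: rewriting in the
    function space of tensor matrices would unfold its operations. *)
Section ConeIdentities.
Variables (R : realType) (V : lmodType R[i]).
Implicit Types (x y z w k : V) (a b c : R[i]).

Lemma telescope_scale a b c x y z w : 
  (a * b * c) *: x - z =
  (a * b) *: (c *: x - y) + (b *: (a *: y - w) + (b *: w - z)).
Proof. by rewrite !scalerBr !scalerA [b * a]mulrC !addrA !subrK. Qed.

Lemma cone_sum_identity a b c d (e x y z k W : V) :
  (a *: e - x + 'i *: y + c *: W) + (b *: e - z + 'i *: k + d *: W) =
  (a + b) *: e - (x + z) + 'i *: (y + k) + (c + d) *: W.
Proof.
rewrite !scalerDl opprD scalerDr [LHS]addrACA; congr (_ + _).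
by rewrite [LHS]addrACA; congr (_ + _); rewrite [LHS]addrACA.
Qed.

Lemma cone_scale_identity (t : R[i]) a c (e x y W : V) :
  t *: (a *: e - x + 'i *: y + c *: W) =
  (t * a) *: e - t *: x + 'i *: (t *: y) + (t * c) *: W.
Proof. by rewrite !scalerDr !scalerN !scalerA [t * 'i]mulrC. Qed.

End ConeIdentities.

Section OrderUnitSeparation.
Variables (R : realType) (V : lmodType R[i]) (D rs : V -> Prop) (e : V).
Hypotheses (Da : forall u v, D u -> D v -> D (u + v))
  (Ds : forall (r : R) u, 0 <= r -> D u -> D (r%:C *: u))
  (Drs : forall u, D u -> rs u) (De : D e)
  (rsa : forall u v, rs u -> rs v -> rs (u + v))
  (rss : forall (r : R) u, rs u -> rs (r%:C *: u))
  (rsi : forall k, rs k -> rs ('i *: k) -> k = 0)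
  (decV : forall w, exists h k, [/\ rs h, rs k & w = h + 'i *: k])
  (rsdom : forall w, rs w -> exists2 r : R, 0 <= r & D (r%:C *: e - w)).

Let rse : rs e. Proof. exact: Drs. Qed.
Let rs0 : rs 0. Proof. by have := rss 0 rse; rewrite scale0r. Qed.
Let D0 : D 0. Proof. by have := Ds (lexx 0) De; rewrite scale0r. Qed.
Let rsN u : rs u -> rs (- u).
Proof. by move=> /(rss (-1)); rewrite rmorphN1 scaleN1r. Qed.
Let Des (r : R) : 0 <= r -> D (r%:C *: e). Proof. by move=> r0; exact: Ds. Qed.

(** Separation of a point from a cone [D] with an order unit [e] inside the
    real form [rs] of [V]. The requirements imposed on the real part [g] of
    the functional are: [g >= 0] on [D], [g = 0] on [i rs], [g e >= 1], and [g
    <= 0] at [u + eps e]. They are consistent because [u + eps e] is not in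
    [D]. *)
Lemma order_unit_separation (u : V) (eps : R) : rs u -> 0 < eps ->
  ~ D (u + eps%:C *: e) ->
  exists L : V -> R[i], [/\ linear L, forall d, D d -> 0 <= L d & Re (L u) < 0].
Proof.
move=> hu eps0 nu; set W := u + _ in nu.
have hW : rs W by apply: rsa => //; apply: rss; exact: rse.
pose dm (v : V) (r : R) := exists l k, [/\ 0 <= l, rs k &
  D (r%:C *: e - v + 'i *: k + l%:C *: W)].
have dmc : bcone dm.
  split.
  - move=> v v' r r' [l [k [l0 hk h]]] [l' [k' [l'0 hk' h']]].
    exists (l + l'), (k + k'); split; [exact: addr_ge0|exact: rsa|].
    have := Da h h'; congr D.
    by rewrite !rmorphD; exact: cone_sum_identity.
  - move=> t v r t0 [l [k [l0 hk h]]]; exists (t * l), (t%:C *: k); split.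
    + exact: mulr_ge0.
    + exact: rss.
    have := Ds t0 h; congr D.
    by rewrite !rmorphM; exact: cone_scale_identity.
  - move=> r [l [k [l0 hk]]]; rewrite subr0 => h; rewrite leNgt; apply/negP => r0.
    have k0 : k = 0.
      apply: rsi => //.
      have -> : 'i *: k = r%:C *: e + 'i *: k + l%:C *: W - (r%:C *: e + l%:C *: W).
        by rewrite [X in X - _]addrAC [X in X - _]addrC addrK.
      apply: rsa; first exact: Drs.
      by apply: rsN; apply: rsa; apply: rss.
    rewrite k0 scaler0 addr0 in h; apply: nu.
    (* For l = 0 the unit itself would be negative, and then D would contain
       every element of rs. *)
    move: l0; rewrite le_eqVlt => /predU1P[l0|l0].
      rewrite -l0 scale0r addr0 in h.
      have [p p0 hp] := rsdom (rsN hu); rewrite opprK in hp.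
      have q0 : 0 <= p / - r by rewrite divr_ge0// oppr_ge0 ltW.
      have -> : W = p%:C *: e + u + (p / - r)%:C *: (r%:C *: e) + eps%:C *: e.
        rewrite scalerA -rmorphM (_ : p / - r * r = - p); last by field; lra.
        by rewrite rmorphN scaleNr [_ *: e + u]addrC addrK.
      apply: Da; last by apply: Des; exact: ltW.
      by apply: Da => //; exact: Ds.
    have -> : W = (l^-1)%:C *: (r%:C *: e + l%:C *: W) + (- r / l)%:C *: e.
      rewrite scalerDr !scalerA -!rmorphM mulVf ?gt_eqF// rmorph1 scale1r.
      rewrite addrAC -scalerDl -rmorphD (_ : l^-1 * r + - r / l = 0); last by field; lra.
      by rewrite rmorph0 scale0r add0r.
    apply: Da; first by apply: Ds => //; rewrite invr_ge0 ltW.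
    by apply: Des; rewrite divr_ge0 ?oppr_ge0// ltW.
have dmt v : setT v -> exists r, dm v r.
  move=> _; have [h [k [hh hk ->]]] := decV v.
  have [r r0 hr] := rsdom hh; exists r, 0, k; split=> //.
  by rewrite scale0r addr0 opprD addrA subrK.
have [g [gD gZ gle]] := @hahn_banach R V setT dm (conj (fun _ _ _ _ => I) (fun _ _ _ => I)) I dmc dmt.
have {}gD v w : g (v + w) = g v + g w by exact: gD.
have {}gZ t v : g (t%:C *: v) = t * g v by exact: gZ.
have {}gle v r : dm v r -> g v <= r by exact: gle.
have gN v : g (- v) = - g v.
  by rewrite -scaleN1r -(rmorphN1 (real_complex R)) gZ mulN1r.
have gc a w : g (a *: w) = Re a * g w + Im a * g ('i *: w) by rewrite (scale_re_im a) gD !gZ.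
have ii (w : V) : 'i *: ('i *: w) = - w by rewrite scalerA -expr2 sqr_i scaleN1r.
have gpos d : D d -> 0 <= g d.
  move=> hd; rewrite -oppr_le0 -gN; apply: gle; exists 0, 0; split; [exact: lexx|exact: rs0|].
  by rewrite !scale0r scaler0 !addr0 sub0r opprK.
have gi k : rs k -> g ('i *: k) = 0.
  have gile k' : rs k' -> g ('i *: k') <= 0.
    move=> hk; apply: gle; exists 0, k'; split=> //.
    by rewrite !scale0r addr0 sub0r addNr; exact: D0.
  move=> hk; apply/le_anti; rewrite gile//= -oppr_le0 -gN -scalerN.
  by apply: gile; exact: rsN.
have gW : g W <= 0.
  apply: gle; exists 1, 0; split; [exact: ler01|exact: rs0|].
  by rewrite scale0r scaler0 addr0 sub0r rmorph1 scale1r addNr; exact: D0.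
have ge : 1 <= g e.
  rewrite -lerN2 -gN; apply: gle; exists 0, 0; split; [exact: lexx|exact: rs0|].
  by rewrite scale0r scaler0 !addr0 opprK rmorphN1 scaleN1r addNr; exact: D0.
pose h v := g v +i* - g ('i *: v).
have hl a v w : h (a *: v + w) = a * h v + h w.
  apply: cext.
    by rewrite ReD ReM /= gD gc mulrN opprK.
  rewrite ImD ImM /=.
  rewrite scalerDr gD [g ('i *: (a *: v))](_ : _ = Re a * g ('i *: v) - Im a * g v); last first.
    by rewrite scalerA mulrC -scalerA gc ii gN mulrN.
  by rewrite opprD opprB mulrN [Im a * _ - _]addrC.
exists h; split; rewrite /h.
- by move=> a v w; exact: hl.
- move=> d hd; apply/ge0cP; split=> /=; first exact: gpos.
  by rewrite gi ?oppr0//; exact: Drs.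
- rewrite /=; move: gW; rewrite /W gD gZ => hg.
  have : eps * 1 <= eps * g e by rewrite ler_pM2l.
  lra.
Qed.


End OrderUnitSeparation.

Section MaxConeSeparation.
Variables (R : realType) (S T : opsys R) (n : nat).
Local Notation tmx := (@tmx R S T n).
Local Notation tunit := (@tunit R S T n).
Local Notation KT := (os_hilb T).

Lemma hq_sum_le (K : hilbert R) I (r : seq I) (v : I -> K) :
  hq (\sum_(j <- r) v j) <= 2 ^+ size r * \sum_(j <- r) hq (v j).
Proof.
elim: r => [|j r IH]; first by rewrite !big_nil /hq (sip0 (hilb_sip K)) mulr0.
rewrite !big_cons /= exprS; have := sipq_par (hilb_sip K) (v j) (\sum_(j <- r) v j).
rewrite -!/(hq _) => h; apply: (le_trans h).
have p1 : 1 <= 2 ^+ size r :> R by rewrite exprn_ege1// ler1n.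
have q0 := hq_ge0 (v j); have : hq (v j) <= 2 ^+ size r * hq (v j) by rewrite ler_peMl.
by rewrite -mulrA mulrDr; move: (2 ^+ size r * hq (v j)) IH => a IH; lra.
Qed.

(** The matrix [c 1 - a a^*] is positive for large [c] by the Cauchy-Schwarz
    inequality, here with a crude constant. *)
Lemma unit_dominates a : exists2 c : R, 0 <= c &
  mcone (c%:C *: tunit - @dyad R S T n a (os_one S) (os_one T)).
Proof.
pose A := \sum_j (complex.Re (a j) ^+ 2 + complex.Im (a j) ^+ 2).
have A0 : 0 <= A by apply: sumr_ge0 => j _; rewrite addr_ge0// sqr_ge0.
pose m := size (index_enum 'I_n).
pose c := 2 ^+ m * A; have c0 : 0 <= c by rewrite mulr_ge0// exprn_ge0.
exists c => //.
pose Q i j : T := (c%:C * (i == j)%:R - a i * conjc (a j)) *: os_one T.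
have hB := hilb_sip KT.
have Qpos : ospos Q.
  move=> xi; pose eta := \sum_j conjc (a j) *: xi j.
  have -> : \sum_x \sum_y hilb_ip KT (os_val (Q x y) (xi y)) (xi x) =
      (c * \sum_x hq (xi x) - hq eta)%:C.
    have qE x : (hq x)%:C = hilb_ip KT x x by rewrite (sipqE hB).
    rewrite (_ : _%:C = c%:C * (\sum_x (hq (xi x))%:C) - (hq eta)%:C); last first.
      by rewrite rmorphB rmorphM rmorph_sum.
    rewrite mulr_sumr qE {2}/eta (sip_sumr hB) -sumrB.
    apply: eq_bigr => i _; rewrite qE /eta (sip_sum hB).
    rewrite (eq_bigr (fun y => c%:C * (i == y)%:R * hilb_ip KT (xi y) (xi i)
      - a i * conjc (a y) * hilb_ip KT (xi y) (xi i))); last first.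
      by move=> y _; rewrite -mulrBl /Q ip_osZ.
    rewrite sumrB; congr (_ - _).
      rewrite (bigD1 i)//= big1 ?addr0.
        by rewrite eqxx mulr1.
      by move=> j /negPf ji; rewrite eq_sym ji mulr0 mul0r.
    by apply: eq_bigr => j _; rewrite (sipZ hB) (sipZr hB) conjcK /= mulrA [a i * _]mulrC.
  rewrite ler0c subr_ge0; apply: (le_trans (hq_sum_le _ _)).
  rewrite /c -mulrA ler_wpM2l ?exprn_ge0// mulr_sumr; apply: ler_sum => j _.
  rewrite /hq (sipqZ hB) -/(hq _) ReC ImC sqrrN ler_wpM2r ?hq_ge0//.
  rewrite /A (bigD1 j)//= lerDl; apply: sumr_ge0 => k _; rewrite addr_ge0// sqr_ge0//.
exists 'I_1, 'I_n, (fun _ _ => os_one S), Q, (fun i z => (i == z.2)%:R); split=> //.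
  by apply/spos_ospos; exact: spos_one.
move=> i j; rewrite tmxDE tmxNE tmxZE /tunit /dyad scalerA -scalerBl.
have E (B : finType) (W : zmodType) (G : 'I_1 * B -> W) : \sum_z G z = \sum_x G (ord0, x).
  by rewrite sum_pair big_ord1.
rewrite E (bigD1 i)//= [X in _ = _ + X]big1 ?addr0; last first.
  by move=> k /negPf ki; rewrite eq_sym ki; apply: big1 => z _; rewrite mul0r scale0r.
rewrite E (bigD1 j)//= [X in _ = _ + X]big1 ?addr0; last first.
  by move=> k /negPf ki; rewrite [j == k]eq_sym ki conjc0 mulr0 scale0r.
by rewrite !eqxx conjc1 mul1r scale1r /Q tensZr.
Qed.

Lemma dyad_dominated a s t : spos s -> spos t -> exists2 r : R, 0 <= r &
  mcone (r%:C *: tunit - dyad a s t).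
Proof.
move=> hs ht; have [c c0 hc] := unit_dominates a.
have [p p0 hp] := opnorm_le_exists (os_val s); have [q q0 hq'] := opnorm_le_exists (os_val t).
have p0' := ltW p0; have q0' := ltW q0.
have sp := spos_sub_norm p0' hp (spos_star hs).
have tq := spos_sub_norm q0' hq' (spos_star ht).
(* Move from s (x) t to p 1 (x) t and then to p q 1 (x) 1 in the order, one
   factor at a time. *)
exists (p * q * c); first by rewrite !mulr_ge0.
have -> : (p * q * c)%:C *: tunit - dyad a s t =
    (p * q)%:C *: (c%:C *: tunit - dyad a (os_one S) (os_one T)) +
    (q%:C *: dyad a (p%:C *: os_one S - s) (os_one T) + dyad a s (q%:C *: os_one T - t)).
  have E1 : dyad a (p%:C *: os_one S - s) (os_one T) =
      p%:C *: @dyad R S T n a (os_one S) (os_one T) - dyad a s (os_one T) by rewrite dyadDl dyadZl dyadNl.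
  have E2 : dyad a s (q%:C *: os_one T - t) = q%:C *: @dyad R S T n a s (os_one T) - dyad a s t.
    by rewrite dyadDr dyadZr dyadNr.
  by rewrite E1 E2 !rmorphM; exact: telescope_scale.
apply: mcone_add; first by apply: mcone_scale => //; exact: mulr_ge0.
apply: mcone_add; last exact: mcone_dyad.
by apply: mcone_scale => //; apply: mcone_dyad => //; exact: spos_one.
Qed.

Lemma rspan_dominated w : rspan w -> exists2 r : R, 0 <= r & mcone (r%:C *: tunit - w).
Proof.
elim=> [|r a s t {}w hs ht _ [r1 r10 h1]].
  by exists 0 => //; rewrite scale0r subr0; exact: mcone0.
have [r2 r20 h2] : exists2 r2 : R, 0 <= r2 & mcone (r2%:C *: tunit - r%:C *: dyad a s t).
  have [r0|r0] := leP 0 r.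
    have [c c0 hc] := dyad_dominated a hs ht; exists (r * c); first exact: mulr_ge0.
    by rewrite rmorphM -scalerA -scalerBr; exact: mcone_scale.
  exists 0 => //; rewrite scale0r sub0r -scaleNr -rmorphN; apply: mcone_scale.
    by rewrite oppr_ge0 ltW.
  exact: mcone_dyad.
exists (r2 + r1); first exact: addr_ge0.
by rewrite rmorphD scalerDl opprD addrACA; exact: mcone_add.
Qed.


Lemma mcone_separation (u : tmx) (eps : R) : rspan u -> 0 < eps ->
  ~ mcone (u + eps%:C *: tunit) ->
  exists L : tmx -> R[i], [/\ linear L, forall d, mcone d -> 0 <= L d & Re (L u) < 0].
Proof.
apply: (@order_unit_separation R tmx (@mcone R S T n) (@rspan R S T n) tunit).
- exact: mcone_add.
- by move=> r d; exact: mcone_scale.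
- by move=> d hd; apply: hermt_rspanP; exact: hermt_mcone.
- exact: mcone_unit.
- exact: rspan_add.
- by move=> r d; exact: rspan_scale.
- by move=> k h1 h2; apply: hermt_i; exact: hermt_rspan.
- exact: cspanT.
- exact: rspan_dominated.
Qed.

End MaxConeSeparation.

(** * Operators on completions *)

Section HilbertConvergence.
Variables (R : realType) (H : hilbert R).
Local Notation ip := (hilb_ip H).
Local Notation hB := (hilb_sip H).

Lemma ip_cvg (A : bop H) (x y : H) (xs ys : nat -> H) :
  (forall n, hq (x - xs n) <= dlt R n) -> (forall n, hq (y - ys n) <= dlt R n) ->
  Re (ip (A (xs n)) (ys n)) @[n --> \oo] --> Re (ip (A x) y) /\
  Im (ip (A (xs n)) (ys n)) @[n --> \oo] --> Im (ip (A x) y).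
Proof.
move=> hx hy; have [C C0 hC] := bop_bounded A.
pose M := 2 * (C * (2 * hq y + 2) + hq (A x)).
have y0 := hq_ge0 y; have Ax0 := hq_ge0 (A x).
have M0 : 0 <= M by rewrite !mulr_ge0 ?addr_ge0// ?mulr_ge0// addr_ge0// mulr_ge0.
have hys n : hq (ys n) <= 2 * hq y + 2.
  have := sipq_par hB y (ys n - y); rewrite addrC subrK -!/(hq _) => h.
  have d1 : dlt R n <= 1 by rewrite /dlt invf_le1 ?ltr0n// ler1n.
  have := hy n; rewrite {1}/hq (sipqBC hB) -/(hq _) => k; lra.
have split_ip n : ip (A x) y - ip (A (xs n)) (ys n) =
    ip (A (x - xs n)) (ys n) + ip (A x) (y - ys n).
  have bopB : A (x - xs n) = A x - A (xs n).
    by rewrite bopD -scaleN1r bopZ scaleN1r.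
  by rewrite bopB (sipB hB) (sipBr hB) [RHS]addrC addrA subrK.
have bnd n : hq (A (x - xs n)) * hq (ys n) <= C * (2 * hq y + 2) * dlt R n.
  apply: (@le_trans _ _ (C * dlt R n * (2 * hq y + 2))); last by rewrite mulrAC.
  apply: ler_pM; rewrite ?hq_ge0//; apply: (le_trans (hC _)).
  by rewrite ler_wpM2l.
have bnd' n : hq (A x) * hq (y - ys n) <= hq (A x) * dlt R n by rewrite ler_wpM2l.
have err (p : R[i] -> R) : (forall z w, p (z + w) = p z + p w) ->
    (forall u v, p (ip u v) ^+ 2 <= hq u * hq v) ->
    p (ip (A (xs n)) (ys n)) @[n --> \oo] --> p (ip (A x) y).
  move=> pD pb.
  have pN z : p (- z) = - p z.
    have p0 : p 0 = 0 by apply: (@addrI _ (p 0)); rewrite -pD !addr0.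
    by apply: (@addrI _ (p z)); rewrite -pD !subrr.
  suff h : p (ip (A x) y) - p (ip (A (xs n)) (ys n)) @[n --> \oo] --> 0.
    have k : p (ip (A x) y) - (p (ip (A x) y) - p (ip (A (xs n)) (ys n)))
        @[n --> \oo] --> p (ip (A x) y) - 0 by apply: cvgB => //; exact: cvg_cst.
    by move: k; rewrite subr0; under eq_fun do rewrite subKr.
  apply: sqr_cvg0 => eps eps0.
  have [|N hN] := @dlt_small R (eps / (M + 1)); first by rewrite divr_gt0//; lra.
  exists N => n /hN hn; rewrite -pN -pD split_ip pD.
  have k1 := pb (A (x - xs n)) (ys n); have k2 := pb (A x) (y - ys n).
  have k3 := bnd n; have k4 := bnd' n; have d0 := dlt_gt0 R n.
  apply: (@le_lt_trans _ _ (M * dlt R n)); last first.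
    by move: hn; rewrite ltr_pdivlMr; [nra|lra].
  rewrite /M; move: (p _) (p (ip (A x) _)) k1 k2 => a b k1 k2.
  have := sqr_ge0 (a - b); nra.
by split; [exact: (err _ (@ReD R) (sip_CS hB))|exact: (err _ (@ImD R) (sip_CSi hB))].
Qed.

End HilbertConvergence.

Section CompletionOperators.
Variables (R : realType) (E : lmodType R[i]) (B : E -> E -> R[i]).
Hypothesis hB : semi_ip B.
Local Notation H := (completion hB).
Local Notation q := (fun x => Re (B x x)).

Definition cemb (e : E) : H := emb hB e.

Lemma cip_emb (f : H) e : hilb_ip H f (cemb e) = (f : compl_elt B) e.
Proof. exact: compl_ip_emb. Qed.

Lemma cip_emb2 e e' : hilb_ip H (cemb e) (cemb e') = B e e'.
Proof. exact: cip_emb. Qed.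

Lemma cemb_dense (f : H) (eps : R) : 0 < eps -> exists e, hq (f - cemb e) <= eps.
Proof.
move=> eps0.
have E1 n : hq (f - cemb (rep hB f n)) =
    compl_re hB f f - 2 * Re ((f : compl_elt B) (rep hB f n)) + q (rep hB f n).
  rewrite /hq (sipqB (hilb_sip H)) cip_emb; congr (_ + _).
  by rewrite cip_emb2.
have c0 : hq (f - cemb (rep hB f n)) @[n --> \oo] --> (0 : R).
  under eq_fun do rewrite E1.
  rewrite (_ : 0 = compl_re hB f f - 2 * compl_re hB f f + compl_re hB f f); last by ring.
  apply: cvgD; last exact: compl_q_cvg.
  apply: cvgB; first exact: cvg_cst.
  by apply: cvgM; [exact: cvg_cst|exact: compl_re_cvg].
move/cvgrPdist_lt : c0 => /(_ _ eps0)[N _ hN].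
exists (rep hB f N); have := hN N (leqnn _); rewrite /= sub0r normrN ger0_norm ?hq_ge0//.
exact: ltW.
Qed.

(** Positivity of a matrix of operators needs testing on the dense subspace
    only; the quadratic form is continuous. *)
Lemma completion_fpos (X : finType) (F : X -> X -> bop H) :
  (forall e : X -> E, 0 <= \sum_x \sum_y hilb_ip H (F x y (cemb (e y))) (cemb (e x))) ->
  fpos F.
Proof.
move=> hF xi.
have /choice[e he] (p : nat * X) : exists e, hq (xi p.2 - cemb e) <= dlt R p.1.
  by apply: cemb_dense; exact: dlt_gt0.
have [U [UU FU]] := ultraFilterLemma (@eventually_filter : ProperFilter \oo).
pose z n := \sum_x \sum_y hilb_ip H (F x y (cemb (e (n, y)))) (cemb (e (n, x))).
apply: (zcvg_ge0 (F := U) (z := z)); last by move=> n; exact: (hF (fun x => e (n, x))).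
apply: zcvg_sum => x; apply: zcvg_sum => y.
have [h1 h2] := @ip_cvg R H (F x y) (xi y) (xi x) (fun n => cemb (e (n, y)))
  (fun n => cemb (e (n, x))) (fun n => he (n, y)) (fun n => he (n, x)).
by split=> A hA; apply: FU; [exact: h1|exact: h2].
Qed.

Lemma completion_bop_ext (F G : bop H) :
  (forall e e', hilb_ip H (F (cemb e)) (cemb e') = hilb_ip H (G (cemb e)) (cemb e')) -> F = G.
Proof.
have key (F' G' : bop H) : (forall e, F' (cemb e) = G' (cemb e)) -> adj F' = adj G'.
  move=> h; apply/val_inj/funext => f; apply: (@compl_ext R E B) => y.
  have := adjP' F' f (cemb y); rewrite h -adjP' !cip_emb; exact.
move=> h; rewrite -[F]adjK -[G]adjK; apply: key => e.
apply: (@compl_ext R E B) => y; rewrite -!cip_emb.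
by rewrite !adjP' ![hilb_ip H (cemb e) _](sipC (hilb_sip H)) h.
Qed.

(** A bounded form on [E] defines an operator on the completion: the image of
    a functional [f] is y |-> <f, psi y>, where [psi y] is the functional x
    |-> conj (b x y) that the adjoint should assign to [y]. *)
Lemma completion_op (b : E -> E -> R[i]) (C : R) : 0 <= C ->
  (forall a x y z, b (a *: x + y) z = a * b x z + b y z) ->
  (forall x y z, b x (y + z) = b x y + b x z) ->
  (forall a x y, b x (a *: y) = conjc a * b x y) ->
  (forall x y, Re (b x y) ^+ 2 <= C * q x * q y) ->
  exists A : bop H, forall x y, hilb_ip H (A (cemb x)) (cemb y) = b x y.
Proof.
move=> C0 bl bD bZ bb; have iB := compl_ip_semi hB.
have b0 z : b 0 z = 0 by have := bl (-1) 0 0 z; rewrite scaler0 addr0 mulN1r addNr.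
have psiP y : (fun x => conjc (b x y)) \in bdd_antilin B.
  apply/asboolP; split=> [x x'|a x|].
  - by rewrite -[x]scale1r bl mul1r scale1r conjD.
  - by rewrite -[a *: x]addr0 bl b0 addr0 conjM.
  - exists (C * q y) => [|x]; first by rewrite mulr_ge0// (sipq_ge0 hB).
    by rewrite ReC mulrAC.
pose psi y : compl_elt B := ComplElt (psiP y).
have psiD y z : psi (y + z) = psi y + psi z.
  by apply: compl_ext => x; rewrite compl_addE /= bD conjD.
have psiZ a y : psi (a *: y) = a *: psi y.
  by apply: compl_ext => x; rewrite compl_scaleE /= bZ conjM conjcK.
have psiq y : compl_re hB (psi y) (psi y) <= C * q y.
  apply: compl_re_le => [|x]; first by rewrite mulr_ge0// (sipq_ge0 hB).
  by rewrite /= ReC mulrAC.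
have AP (f : compl_elt B) : (fun y => compl_ip hB f (psi y)) \in bdd_antilin B.
  apply/asboolP; split=> [x y|a x|].
  - by rewrite psiD (sipDr iB).
  - by rewrite psiZ (sipZr iB).
  - exists (compl_re hB f f * C) => [|x]; first by rewrite mulr_ge0// compl_re_ge0.
    apply: (le_trans (sip_CS iB _ _)).
    by rewrite -mulrA; apply: ler_wpM2l; [exact: compl_re_ge0|exact: psiq].
pose A (f : H) : H := ComplElt (AP f).
have lA : linear A.
  move=> a f g; apply: (@compl_ext R E B) => y.
  exact: (let: And3 h _ _ := iB in h a f g (psi y)).
have Aop : A \in @bounded_op R H.
  apply: (@bounded_opP R H A C lA) => f.
  apply: compl_re_le => [|y]; first by rewrite mulr_ge0// compl_re_ge0.
  apply: (le_trans (sip_CS iB f (psi y))).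
  rewrite [leRHS]mulrAC [leRHS]mulrC; apply: ler_wpM2l; last exact: psiq.
  exact: compl_re_ge0.
exists (Bop Aop) => x y; rewrite cip_emb.
rewrite -[LHS]/(compl_ip hB (emb hB x) (psi y)) (sipC iB) compl_ip_emb /=.
exact: conjcK.
Qed.

End CompletionOperators.

(** * A GNS construction for functionals on the cone D_n *)

Section BopAlgebra.
Variables (R : realType) (H : hilbert R).
Implicit Types A B C : bop H.

Lemma bop_compA A B C : bop_comp A (bop_comp B C) = bop_comp (bop_comp A B) C.
Proof. exact/val_inj. Qed.
Lemma bop_comp1 A : bop_comp A (bop1 H) = A. Proof. exact/val_inj. Qed.
Lemma bop_1comp A : bop_comp (bop1 H) A = A. Proof. exact/val_inj. Qed.
Lemma bop_compPl c A B C : bop_comp (c *: A + B) C = c *: bop_comp A C + bop_comp B C.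
Proof. exact/val_inj. Qed.
Lemma bop_compPr c A B C : bop_comp C (c *: A + B) = c *: bop_comp C A + bop_comp C B.
Proof. by apply/val_inj/funext => x; exact: bop_linear. Qed.
Lemma bop_comp0l A : bop_comp 0 A = 0. Proof. exact/val_inj. Qed.
Lemma bop_comp0r A : bop_comp A 0 = 0.
Proof. by apply/val_inj/funext => x; exact: bop0. Qed.
Lemma adj0 : adj (0 : bop H) = 0.
Proof. by apply: bop_ext => x y; rewrite adjP' (sip0r (hilb_sip H)) (sip0 (hilb_sip H)). Qed.
Lemma fullP c A B : full (c *: A + B) = c *: full A + full B.
Proof. exact/val_inj. Qed.

Lemma fpos_one (X : finType) : fpos (fun _ _ : X => bop1 H).
Proof.
move=> xi; have hB := hilb_sip H; have := hq_ge0 (\sum_x xi x).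
rewrite -ler0c /hq -(sipqE hB) (sip_sumr hB); congr (0 <= _).
by apply: eq_bigr => x _; rewrite (sip_sum hB).
Qed.

End BopAlgebra.

Lemma op_product_sum (R : realType) (S T : opsys R) (H : hilbert R)
    (f : {linear S -> fullsys H}) (g : {linear T -> fullsys H}) (l : seq (S * T)) :
  op_product f g (\sum_(p <- l) tens p.1 p.2) =
  \sum_(p <- l) bop_comp (os_val (f p.1)) (os_val (g p.2)).
Proof.
by rewrite /op_product linear_sum; apply: eq_bigr => p _; exact: tensor_liftE.
Qed.

(** A functional [L] on the matrices over B(K) (x) T that is nonnegative on
    D_n defines the semi-inner product of families [e, e'] of operators given
    by applying [L] to the matrix with entries [adj (e' i) (e j) (x) 1]. On
    its completion B(K) acts by left multiplication and T through the second
    tensor factor; the two actions commute, and [L] is the vector functional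
    of the families that have a single entry 1. *)
Section TensorGNS.
Variables (R : realType) (K : hilbert R) (T : opsys R) (n : nat).
Local Notation tmx := (@tmx R (fullsys K) T n).
Local Notation E := ('I_n -> bop K).
Implicit Types (a b : bop K) (t : T) (e : E).

Definition gns_tens a t e e' : tmx :=
  fun i j => tens (full (bop_comp (adj (e' i)) (bop_comp a (e j)))) t.

Lemma gns_tensPa c a a' t e e' : gns_tens (c *: a + a') t e e' = c *: gns_tens a t e e' + gns_tens a' t e e'.
Proof.
apply/funext => i; apply/funext => j; rewrite tmxDE tmxZE /gns_tens.
by rewrite bop_compPl bop_compPr fullP tensDl tensZl.
Qed.

Lemma gns_tensPt c a t t' e e' : gns_tens a (c *: t + t') e e' = c *: gns_tens a t e e' + gns_tens a t' e e'.
Proof.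
by apply/funext => i; apply/funext => j; rewrite tmxDE tmxZE /gns_tens tensDr tensZr.
Qed.

Lemma gns_tensPe c a t e1 e2 e' : gns_tens a t (c *: e1 + e2) e' = c *: gns_tens a t e1 e' + gns_tens a t e2 e'.
Proof.
apply/funext => i; apply/funext => j; rewrite tmxDE tmxZE /gns_tens.
by rewrite -[(_ + _) j]/(c *: e1 j + e2 j) !bop_compPr fullP tensDl tensZl.
Qed.

Lemma gns_tensPe' c a t e e1 e2 :
  gns_tens a t e (c *: e1 + e2) = conjc c *: gns_tens a t e e1 + gns_tens a t e e2.
Proof.
apply/funext => i; apply/funext => j; rewrite tmxDE tmxZE /gns_tens.
by rewrite -[(_ + _) i]/(c *: e1 i + e2 i) adjD adjZ bop_compPl fullP tensDl tensZl.
Qed.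

Definition smul a e : E := fun i => bop_comp a (e i).

Lemma gns_tens_smul a b t e e' : gns_tens (bop_comp b a) t e e' = gns_tens b t (smul a e) e'.
Proof. by apply/funext => i; apply/funext => j; rewrite /gns_tens /smul -bop_compA. Qed.

Lemma gns_tens_smul' a b t e e' : gns_tens (bop_comp (adj b) a) t e e' = gns_tens a t e (smul b e').
Proof. by apply/funext => i; apply/funext => j; rewrite /gns_tens /smul adjM !bop_compA. Qed.

(** The matrix [adj (e x i) P_xy (e y j)], indexed by the pairs (i, x), is
    positive with [P]; contracting it with [Q] over equal indices x gives the
    sum. *)
Lemma mcone_gns_tens (X : finType) (P : X -> X -> bop K) (Q : X -> X -> T) (e : X -> E) :
  fpos P -> ospos Q -> mcone (\sum_x \sum_y gns_tens (P x y) (Q x y) (e y) (e x)).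
Proof.
move=> hP hQ.
exists ('I_n * X)%type, X.
exists (fun z z' => full (bop_comp (adj (e z.2 z.1)) (bop_comp (P z.2 z'.2) (e z'.2 z'.1)))), Q.
exists (fun i z => ((z.1.1 == i) && (z.1.2 == z.2))%:R); split=> //.
  move=> xi; pose eta x := \sum_i e x i (xi (i, x)).
  have := hP eta; congr (0 <= _); have hB := hilb_sip K.
  have S2 (G : 'I_n * X -> R[i]) : \sum_z G z = \sum_x \sum_i G (i, x).
    by rewrite exchange_big sum_pair.
  rewrite S2; apply: eq_bigr => x _.
  under eq_bigr => y _ do rewrite {2}/eta (sip_sumr hB).
  rewrite exchange_big; apply: eq_bigr => i _; rewrite S2; apply: eq_bigr => y _.
  rewrite /eta bop_sum (sip_sum hB); apply: eq_bigr => j _.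
  by rewrite /= adjP'.
move=> i j; rewrite !fct_sumE.
have S3 (W : zmodType) (G : ('I_n * X) * X -> W) (k : 'I_n) :
    (forall z, ~~ ((z.1.1 == k) && (z.1.2 == z.2)) -> G z = 0) ->
    \sum_z G z = \sum_x G ((k, x), x).
  move=> h; rewrite !sum_pair.
  rewrite (bigD1 k)//= [X in _ + X]big1 ?addr0; last first.
    move=> l /negPf lk; apply: big1 => x _; apply: big1 => y _.
    by apply: h; rewrite /= lk.
  apply: eq_bigr => x _; rewrite (bigD1 x)//= big1 ?addr0// => y /negPf yx.
  by apply: h; rewrite /= eqxx eq_sym yx.
rewrite (S3 _ _ i); last first.
  by move=> z /negPf h; apply: big1 => z' _; rewrite h mul0r scale0r.
apply: eq_bigr => x _; rewrite !fct_sumE (S3 _ _ j); last first.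
  by move=> z /negPf h; rewrite h conjc0 mulr0 scale0r.
by apply: eq_bigr => y _; rewrite /= !eqxx conjc1 mul1r scale1r.
Qed.

Variable L : {linear tmx -> R[i]}.
Hypothesis Lpos : forall d, mcone d -> 0 <= L d.

Definition gform a t e e' : R[i] := L (gns_tens a t e e').

Lemma LP c (u v : tmx) : L (c *: u + v) = c * L u + L v.
Proof. by rewrite linearD linC. Qed.

Lemma gformPa c a a' t e e' : gform (c *: a + a') t e e' = c * gform a t e e' + gform a' t e e'.
Proof. by rewrite /gform gns_tensPa LP. Qed.
Lemma gformPt c a t t' e e' : gform a (c *: t + t') e e' = c * gform a t e e' + gform a t' e e'.
Proof. by rewrite /gform gns_tensPt LP. Qed.
Lemma gformPe c a t e1 e2 e' :
  gform a t (c *: e1 + e2) e' = c * gform a t e1 e' + gform a t e2 e'.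
Proof. by rewrite /gform gns_tensPe LP. Qed.
Lemma gformPe' c a t e e1 e2 :
  gform a t e (c *: e1 + e2) = conjc c * gform a t e e1 + gform a t e e2.
Proof. by rewrite /gform gns_tensPe' LP. Qed.
Lemma gformDe' a t e e1 e2 : gform a t e (e1 + e2) = gform a t e e1 + gform a t e e2.
Proof. by rewrite -[e1]scale1r gformPe' conjc1 mul1r scale1r. Qed.
Lemma gform0e a t e' : gform a t 0 e' = 0.
Proof. by have := gformPe (-1) a t 0 0 e'; rewrite scaler0 addr0 mulN1r addNr. Qed.
Lemma gform0e' a t e : gform a t e 0 = 0.
Proof.
by have := gformPe' (-1) a t e 0 0; rewrite scaler0 addr0 conjN conjc1 mulN1r addNr.
Qed.
Lemma gformZe c a t e e' : gform a t (c *: e) e' = c * gform a t e e'.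
Proof. by rewrite -[c *: e]addr0 gformPe gform0e addr0. Qed.
Lemma gformZe' c a t e e' : gform a t e (c *: e') = conjc c * gform a t e e'.
Proof. by rewrite -[c *: e']addr0 gformPe' gform0e' addr0. Qed.

Lemma gform_pos (X : finType) (P : X -> X -> bop K) (Q : X -> X -> T) (e : X -> E) :
  fpos P -> ospos Q -> 0 <= \sum_x \sum_y gform (P x y) (Q x y) (e y) (e x).
Proof.
move=> hP hQ; have := Lpos (mcone_gns_tens e hP hQ); rewrite linear_sum.
by congr (0 <= _); apply: eq_bigr => x _; rewrite linear_sum.
Qed.

Local Notation one := (bop1 K).
Local Notation oneT := (os_one T).
Local Notation B := (gform one oneT).

Lemma gform1_pos (P : bop K) e : (forall x, 0 <= hilb_ip K (P x) x) ->
  0 <= gform P oneT e e.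
Proof.
move=> hP.
have h1 : fpos (fun _ _ : 'I_1 => P) by move=> xi; rewrite !big_ord1.
have h2 : ospos (fun _ _ : 'I_1 => oneT) by apply/spos_ospos; exact: spos_one.
by have := gform_pos (fun=> e) h1 h2; rewrite !big_ord1.
Qed.

Lemma gform_semi : semi_ip B.
Proof.
have B0 e : 0 <= B e e.
  apply: gform1_pos => x; rewrite (sipqE (hilb_sip K)) ler0c; exact: hq_ge0.
split=> [c e1 e2 e'|e e'|//]; first exact: gformPe.
apply: (real_form_herm (F := B)) => [x y z|x y z|c x y|c x y|x].
- by rewrite -[x]scale1r gformPe mul1r scale1r.
- exact: gformDe'.
- exact: gformZe.
- exact: gformZe'.
- by have /ge0cP[] := B0 x.
Qed.

Local Notation q := (fun e => Re (B e e)).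

Lemma gform_smul a e e' : gform a oneT e e' = B (smul a e) e'.
Proof. by rewrite /gform -gns_tens_smul bop_1comp. Qed.

(** Left multiplication by [a] is bounded since [adj a a <= r^2]. *)
Lemma gform_bound_left a : exists2 C : R, 0 <= C & forall e e',
  Re (gform a oneT e e') ^+ 2 <= C * q e * q e'.
Proof.
have [r r0 hr] := opnorm_le_exists a; have r0' := ltW r0.
exists (r ^+ 2) => [|e e']; first exact: exprn_ge0.
rewrite gform_smul; apply: (le_trans (sip_CS gform_semi _ _)).
apply: ler_wpM2r; first exact: (sipq_ge0 gform_semi).
have -> : B (smul a e) (smul a e) = gform (bop_comp (adj a) a) oneT e e.
  by rewrite /gform gns_tens_smul' -gns_tens_smul bop_1comp.
pose P := (-1 : R[i]) *: bop_comp (adj a) a + (r ^+ 2)%:C *: one.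
have := @gform1_pos P e; rewrite /P gformPa mulN1r.
have -> : gform ((r ^+ 2)%:C *: one) oneT e e = (r ^+ 2)%:C * B e e.
  have g0 : gform 0 oneT e e = 0.
    by have := gformPa (-1) 0 0 oneT e e; rewrite scaler0 addr0 mulN1r addNr.
  by rewrite -[_ *: one]addr0 gformPa g0 addr0.
move=> h; have {h} /ge0cP[+ _] : 0 <= - gform (bop_comp (adj a) a) oneT e e + (r ^+ 2)%:C * B e e.
  apply: h => x; have hB := hilb_sip K.
  have -> : hilb_ip K (((-1 : R[i]) *: bop_comp (adj a) a + (r ^+ 2)%:C *: one) x) x =
      (r ^+ 2 * hq x - hq (a x))%:C.
    rewrite bop_add (sipD hB) bop_scale (sipZ hB) ip_rZ1 mulN1r.
    by rewrite -[bop_comp _ _ x]/(adj a (a x)) adjP' (sipqE hB (a x)) rmorphB addrC.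
  rewrite ler0c subr_ge0.
  by have /(opnorm_leP _ r0') := hr; exact.
by rewrite !reim mul0r subr0 addrC subr_ge0.
Qed.

(** The 2 x 2 criterion for [t], applied to the families [e1] and [s e2] for
    all real [s]; the discriminant of the resulting quadratic polynomial is
    the estimate. *)
Lemma gform_bound_right t : exists2 C : R, 0 <= C & forall e e',
  Re (gform one t e e') ^+ 2 <= C * q e * q e'.
Proof.
have [r r0 hr] := opnorm_le_exists (os_val t); have r0' := ltW r0.
exists (r ^+ 2) => [|e2 e1]; first exact: exprn_ge0.
have Qpos : ospos (mx2 (r%:C *: oneT) t (os_star t) (r%:C *: oneT)).
  have /pos2_fpos h := pos2_norm r0' hr.
  by move=> xi; have := h xi; congr (0 <= _); rewrite !big_bool.
have gr e : gform one (r%:C *: oneT) e e = r%:C * B e e.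
  have g0 : gform one 0 e e = 0.
    by have := gformPt (-1) one 0 0 e e; rewrite scaler0 addr0 mulN1r addNr.
  by rewrite -[_ *: oneT]addr0 gformPt g0 addr0.
have pos f1 f2 : 0 <= r%:C * B f1 f1 + gform one t f2 f1 +
    (gform one (os_star t) f1 f2 + r%:C * B f2 f2).
  have := gform_pos (fun x : bool => if x then f1 else f2) (@fpos_one R K _) Qpos.
  by rewrite !big_bool /= !gr.
have imB e : Im (B e e) = 0 by exact: sipImxx gform_semi e.
have imp f1 f2 : Im (gform one t f2 f1) + Im (gform one (os_star t) f1 f2) = 0.
  have /ge0cP[_] := pos f1 f2; rewrite !ImD !ImM !imB !Im_real; lra.
have rep : Re (gform one t e2 e1) = Re (gform one (os_star t) e1 e2).
  have := imp e1 ('i *: e2); rewrite gformZe gformZe' conjc_i !reim !zsimp; lra.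
rewrite (_ : r ^+ 2 * q e2 * q e1 = (r * q e1) * (r * q e2)); last by rewrite /=; ring.
apply: sip_discr => [||s]; try by rewrite mulr_ge0// (sipq_ge0 gform_semi).
have /ge0cP[+ _] := pos e1 (s%:C *: e2).
rewrite !gformZe !gformZe' conjc_real !reim imB -rep.
by congr (0 <= _); ring.
Qed.

Local Notation H := (completion gform_semi).

Lemma gns_op (b : E -> E -> R[i]) a t : (forall e e', b e e' = gform a t e e') ->
  (exists2 C : R, 0 <= C & forall e e', Re (b e e') ^+ 2 <= C * q e * q e') ->
  exists A : bop H, forall e e',
    hilb_ip H (A (cemb gform_semi e)) (cemb gform_semi e') = gform a t e e'.
Proof.
move=> hb [C C0 hC].
have [||||A hA] := @completion_op R _ _ gform_semi b C C0.
- by move=> c x y z; rewrite !hb gformPe.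
- by move=> x y z; rewrite !hb gformDe'.
- by move=> c x y; rewrite !hb gformZe'.
- exact: hC.
- by exists A => e e'; rewrite hA hb.
Qed.

Lemma gns_rep_linear (W : lmodType R[i]) (F : W -> bop H) (b : W -> E -> E -> R[i]) :
  (forall w e e', hilb_ip H (F w (cemb gform_semi e)) (cemb gform_semi e') = b w e e') ->
  (forall c w w' e e', b (c *: w + w') e e' = c * b w e e' + b w' e e') ->
  linear (fun w => full (F w)).
Proof.
move=> hF bl c w w'; apply/val_inj/completion_bop_ext => e e'.
rewrite (ip_osD (c *: full (F w))) (ip_osZ c (full (F w))).
by rewrite [LHS]hF bl -!hF.
Qed.

(** Conclusion of the construction. Complete positivity of both actions is
    [gform_pos] with one of the two matrices constant and equal to 1. *)
Lemma gns (u : tmx) : c_cone (\matrix_(i, j) u i j) -> 0 <= L u.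
Proof.
move=> hu.
have /choice[F0 hF0] a := gns_op (fun e e' => erefl) (gform_bound_left a).
have /choice[G0 hG0] t := gns_op (fun e e' => erefl) (gform_bound_right t).
have lf : linear (fun s : fullsys K => full (F0 (os_val s)) : fullsys H).
  apply: (@gns_rep_linear (fullsys K) (fun s => F0 (os_val s))
    (fun s => gform (os_val s) oneT)) => [s e e'|c s s' e e']; first exact: hF0.
  exact: gformPa.
have lg : linear (fun t => full (G0 t) : fullsys H).
  apply: (@gns_rep_linear T G0 (gform one)) => [t e e'|c t t' e e']; first exact: hG0.
  exact: gformPt.
have [f fE] := mk_linear lf; have [g gE] := mk_linear lg.
have fcp : cp f.
  move=> m A /ospos_ord hA; apply/ospos_ord; apply: completion_fpos => e.
  have hQ : ospos (fun _ _ : 'I_m => oneT) by exact: (@fpos_one R (os_hilb T)).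
  have := gform_pos e hA hQ; congr (0 <= _).
  by apply: eq_bigr => x _; apply: eq_bigr => y _; rewrite mxE fE hF0.
have gcp : cp g.
  move=> m A /ospos_ord hA; apply/ospos_ord; apply: completion_fpos => e.
  have := gform_pos e (@fpos_one R K _) hA; congr (0 <= _).
  by apply: eq_bigr => x _; apply: eq_bigr => y _; rewrite mxE gE hG0.
pose ce := cemb gform_semi.
have hH := hilb_sip H.
have F_emb a e : F0 a (ce e) = ce (smul a e).
  apply: (@compl_ext R _ B) => y; rewrite -(cip_emb (F0 a (ce e))) -(cip_emb (ce (smul a e))) hF0.
  by rewrite cip_emb2 gform_smul.
have Fadj_emb a e : adj (F0 a) (ce e) = ce (smul (adj a) e).
  apply: (@compl_ext R _ B) => y; rewrite -(cip_emb (adj (F0 a) (ce e))) -(cip_emb (ce (smul (adj a) e))) adjP' F_emb !cip_emb2.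
  rewrite -(gform_smul (adj a)) /gform -(gns_tens_smul' _ _ _ e y); congr (L _).
  by rewrite bop_comp1.
have fg a t e e' : hilb_ip H (F0 a (G0 t (ce e))) (ce e') = gform a t e e'.
  rewrite adjP Fadj_emb hG0 /gform -gns_tens_smul' adjK; congr (L _).
  by rewrite bop_comp1.
have gf a t e e' : hilb_ip H (G0 t (F0 a (ce e))) (ce e') = gform a t e e'.
  by rewrite F_emb hG0 /gform -gns_tens_smul bop_1comp.
have comm s t : bop_comp (os_val (f s)) (os_val (g t)) =
    bop_comp (os_val (g t)) (os_val (f s)).
  rewrite fE gE; apply: completion_bop_ext => e e'.
  by rewrite [LHS]fg [RHS]gf.
(* These families pick out the entries of u, so that L is the sum of its
   vector functionals. *)
pose dl (j : 'I_n) : E := fun i => if i == j then one else 0.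
have := hu H f g fcp gcp comm (fun j => ce (dl j)); congr (0 <= _).
pose w i j : tmx := fun k l => ((k == i) && (l == j))%:R *: u i j.
have wE i j : hilb_ip H (map_mx (op_product f g) (\matrix_(i, j) u i j) i j (ce (dl j)))
    (ce (dl i)) = L (w i j).
  rewrite !mxE; have [l hl] := tensor_sum (u i j).
  have -> : w i j = \sum_(p <- l) gns_tens (os_val p.1) p.2 (dl j) (dl i).
    apply/funext => k; apply/funext => m; rewrite !fct_sumE /w hl scaler_sumr.
    apply: eq_bigr => p _; rewrite /gns_tens /dl.
    have z0 : full (0 : bop K) = 0 by exact/val_inj.
    have [_|_] := eqVneq k i; last first.
      by rewrite adj0 bop_comp0l z0 tens0l scale0r.
    have [_|_] := eqVneq m j; last first.
      by rewrite !bop_comp0r z0 tens0l scale0r.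
    by rewrite adj1 bop_1comp bop_comp1 fullK scale1r.
  rewrite hl op_product_sum bop_sumE (sip_sum hH) linear_sum; apply: eq_bigr => p _.
  by rewrite fE gE [LHS]fg.
rewrite (eq_bigr (fun i => \sum_j L (w i j))); last first.
  by move=> i _; apply: eq_bigr => j _; exact: wE.
have -> : u = \sum_i \sum_j w i j.
  apply/funext => k; apply/funext => l; rewrite !fct_sumE (bigD1 k)//= !fct_sumE (bigD1 l)//=.
  rewrite {1}/w !eqxx scale1r [X in _ + X + _]big1 ?addr0; last first.
    by move=> j /negPf jl; rewrite /w [l == j]eq_sym jl andbF scale0r.
  rewrite big1 ?addr0// => i /negPf ik; rewrite !fct_sumE; apply: big1 => j _.
  by rewrite /w [k == i]eq_sym ik scale0r.
by rewrite linear_sum; apply: eq_bigr => i _; rewrite linear_sum.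
Qed.

End TensorGNS.

(** * Hermitian elements and the maximal commuting cone *)

Section SchurPositivity.
Variable R : realType.

(** A positive semidefinite kernel is a Gram matrix in the completion of the
    functions on [W]; coordinates with respect to an orthonormal family of the
    finitely many vectors involved give a finite factorization. *)
Lemma psd_factor (W : finType) (N : W -> W -> R[i]) :
  (forall c : W -> R[i], 0 <= \sum_w \sum_w' N w w' * (c w' * conjc (c w))) ->
  exists m (r : 'I_m -> W -> R[i]), forall w w',
    N w w' = \sum_k r k w * conjc (r k w').
Proof.
move=> hN; pose B (c d : W -> R[i]) := \sum_w \sum_w' N w w' * (c w' * conjc (d w)).
have Bl a c c' d : B (a *: c + c') d = a * B c d + B c' d.
  rewrite /B mulr_sumr -big_split; apply: eq_bigr => w _.
  rewrite mulr_sumr -big_split; apply: eq_bigr => w' _.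
  by rewrite -[(a *: c + c') w']/(a * c w' + c' w') /=; ring.
have Bl' a c d d' : B c (a *: d + d') = conjc a * B c d + B c d'.
  rewrite /B mulr_sumr -big_split; apply: eq_bigr => w _.
  rewrite mulr_sumr -big_split; apply: eq_bigr => w' _.
  by rewrite -[(a *: d + d') w]/(a * d w + d' w) /= conjD conjM; ring.
have B0 d : B 0 d = 0 by have := Bl (-1) 0 0 d; rewrite scaler0 addr0 mulN1r addNr.
have B0' d : B d 0 = 0.
  by have := Bl' (-1) d 0 0; rewrite scaler0 addr0 conjN conjc1 mulN1r addNr.
have Bs : semi_ip B.
  split=> [//|c d|c]; last exact: hN.
  apply: (@real_form_herm R _ B) => [x y z|x y z|a x y|a x y|x].
  - by have := Bl 1 x y z; rewrite scale1r mul1r.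
  - by have := Bl' 1 x y z; rewrite scale1r conjc1 mul1r.
  - by have := Bl a x 0 y; rewrite B0 !addr0.
  - by have := Bl' a x y 0; rewrite B0' !addr0.
  - by have /ge0cP[] := hN x.
pose d (w : W) : W -> R[i] := fun v => (v == w)%:R.
have Bd w w' : B (d w') (d w) = N w w'.
  rewrite /B (bigD1 w)//= [X in _ + X]big1 ?addr0; last first.
    by move=> v /negPf vw; apply: big1 => v' _; rewrite /d vw conjc0 !mulr0.
  rewrite (bigD1 w')//= big1 ?addr0 /d ?eqxx ?conjc1 ?mulr1// => v /negPf ->.
  by rewrite mul0r mulr0.
pose e w := cemb Bs (d w); have hH := hilb_sip (completion Bs).
have [es [_ hes]] := gram_schmidt [seq e w | w <- enum W].
exists (size es), (fun k w => conjc (hilb_ip _ (e w) (nth 0 es k))) => w w'.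
rewrite -Bd -(cip_emb2 Bs) -/(e w) -/(e w').
rewrite -{1}(hes (e w')); last by apply: map_f; rewrite mem_enum.
rewrite /fproj (sip_sum hH) (big_nth 0) big_mkord; apply: eq_bigr => k _.
by rewrite (sipZ hH) conjcK mulrC -(sipC hH).
Qed.

End SchurPositivity.

Section ProductFunctionals.
Variables (R : realType) (S T : opsys R) (n : nat).
Local Notation tmx := (@tmx R S T n).
Local Notation KS := (os_hilb S).
Local Notation KT := (os_hilb T).

(** The vector functional of the sum of the vectors x (x) y (x) i in the
    tensor product of the two Hilbert spaces with the index space, written out
    so that this tensor product need not be formed. *)
Definition vfun (Z : finType) (i : Z -> 'I_n) (x : Z -> KS) (y : Z -> KT) (v : tmx) : R[i] :=
  \sum_Z1 \sum_Z2 pfun (x Z2) (x Z1) (y Z2) (y Z1) (v (i Z1) (i Z2)).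

Lemma vfun_linear (Z : finType) (i : Z -> 'I_n) x y : linear (vfun i x y).
Proof.
move=> c u v; rewrite -[c *: vfun i x y u]/(c * vfun i x y u) /vfun mulr_sumr -big_split.
apply: eq_bigr => Z1 _; rewrite mulr_sumr -big_split; apply: eq_bigr => Z2 _.
by rewrite tmxDE tmxZE pfunD pfunZ.
Qed.

(** The product of two positive semidefinite kernels is positive semidefinite
    (Schur): factor the one coming from [Q] and absorb its coordinates in the
    vectors for [P]. *)
Lemma vfun_mcone (Z : finType) (i : Z -> 'I_n) x y v : mcone v -> 0 <= vfun i x y v.
Proof.
move=> [X [Y [P [Q [a [hP hQ hv]]]]]]; have hS := hilb_sip KS; have hT := hilb_sip KT.
pose N (w w' : Z * Y) := hilb_ip KT (os_val (Q w.2 w'.2) (y w'.1)) (y w.1).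
have hN (c : Z * Y -> R[i]) : 0 <= \sum_w \sum_w' N w w' * (c w' * conjc (c w)).
  have := hQ (fun t => \sum_z c (z, t) *: y z); congr (0 <= _).
  rewrite [RHS]sum_pair [RHS]exchange_big; apply: eq_bigr => t _.
  under [LHS]eq_bigr => t' _ do rewrite (sip_sumr hT).
  rewrite exchange_big; apply: eq_bigr => z _.
  rewrite [RHS]sum_pair [RHS]exchange_big; apply: eq_bigr => t' _.
  rewrite bop_sum (sip_sum hT); apply: eq_bigr => z' _.
  by rewrite bopZ (sipZ hT) (sipZr hT) /N /=; ring.
have [m [r hr]] := psd_factor hN.
pose om k z1 := \sum_(w : Z * Y) conjc (a (i w.1) (z1, w.2) * r k w) *: x w.1.
suff -> : vfun i x y v = \sum_k \sum_z1 \sum_z1'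
    hilb_ip KS (os_val (P z1 z1') (om k z1')) (om k z1).
  by apply: sumr_ge0 => k _; exact: hP.
pose G Z1 Z2 (z z' : X * Y) k :=
  (a (i Z1) z * conjc (a (i Z2) z')) * (hilb_ip KS (os_val (P z.1 z'.1) (x Z2)) (x Z1) *
    (r k (Z1, z.2) * conjc (r k (Z2, z'.2)))).
transitivity (\sum_Z1 \sum_Z2 \sum_z \sum_z' \sum_k G Z1 Z2 z z' k).
  apply: eq_bigr => Z1 _; apply: eq_bigr => Z2 _; rewrite hv pfun_sum.
  apply: eq_bigr => z _; rewrite pfun_sum; apply: eq_bigr => z' _.
  rewrite pfunZ pfunE -[X in _ * (_ * X)]/(N (Z1, z.2) (Z2, z'.2)) hr.
  by rewrite !mulr_sumr.
have mv (A1 A2 A3 : finType) (F : A1 -> A2 -> A3 -> R[i]) :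
    \sum_x \sum_y \sum_z F x y z = \sum_z \sum_x \sum_y F x y z.
  by under eq_bigr do rewrite exchange_big; rewrite exchange_big.
transitivity (\sum_k \sum_Z1 \sum_Z2 \sum_z \sum_z' G Z1 Z2 z z' k).
  under eq_bigr => Z1 _ do under eq_bigr => Z2 _ do rewrite mv.
  by rewrite mv.
apply: eq_bigr => k _.
transitivity (\sum_z \sum_z' \sum_Z1 \sum_Z2 G Z1 Z2 z z' k).
  by rewrite mv; apply: eq_bigr => z _; rewrite mv.
rewrite sum_pair; apply: eq_bigr => z1 _.
under eq_bigr => z2 _ do rewrite sum_pair.
rewrite exchange_big; apply: eq_bigr => z1' _.
rewrite /om bop_sum (sip_sum hS) sum_pair.
under [RHS]eq_bigr => Z2 _.
  under eq_bigr => z2' _ do rewrite bopZ (sipZ hS) (sip_sumr hS) sum_pair.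
  over.
rewrite /=.
transitivity (\sum_z2 \sum_z2' \sum_Z2 \sum_Z1 G Z1 Z2 (z1, z2) (z1', z2') k).
  by apply: eq_bigr => z2 _; apply: eq_bigr => z2' _; rewrite exchange_big.
rewrite exchange_big /= mv; apply: eq_bigr => Z2 _.
apply: eq_bigr => z2' _.
rewrite mulr_sumr exchange_big; apply: eq_bigr => Z1 _; rewrite mulr_sumr.
apply: eq_bigr => z2 _; rewrite (sipZr hS) conjcK /G /= !conjM; ring.
Qed.

(** Polarization with families of two vectors: reality of the functionals at
    x, x' and at i x, x' gives the conjugate symmetry of the coefficients. *)
Lemma hermt_of_vfun (u : tmx) :
  (forall (i : bool -> 'I_n) x y, 0 <= vfun i x y u) -> hermt u.
Proof.
move=> hu i j x x' y y'.
pose p i j x x' y y' := pfun x x' y y' (u i j).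
have hu' i1 i2 x1 x2 y1 y2 : Im (p i1 i1 x1 x1 y1 y1) + Im (p i1 i2 x2 x1 y2 y1) +
   (Im (p i2 i1 x1 x2 y1 y2) + Im (p i2 i2 x2 x2 y2 y2)) = 0.
  pose fi (b : bool) := if b then i1 else i2; pose fx (b : bool) := if b then x1 else x2.
  pose fy (b : bool) := if b then y1 else y2.
  have bb (F : bool -> bool -> R[i]) :
      \sum_a \sum_b F a b = F true true + F true false + (F false true + F false false).
    by rewrite !big_bool.
  have E := bb (fun a b => p (fi a) (fi b) (fx b) (fx a) (fy b) (fy a)).
  have : 0 <= \sum_a \sum_b p (fi a) (fi b) (fx b) (fx a) (fy b) (fy a) := hu fi fx fy.
  rewrite {}E /fi /fx /fy; move: (p i1 i1 _ _ _ _) (p i1 i2 _ _ _ _).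
  move: (p i2 i1 _ _ _ _) (p i2 i2 _ _ _ _) => c d a b /ge0cP[_].
  by rewrite !ImD.
have px0 i1 i2 z y1 y2 : p i1 i2 0 z y1 y2 = 0.
  rewrite /p; have [l ->] := tensor_sum (u i1 i2); rewrite pfun_sum.
  by apply: big1 => q _; rewrite pfunE bop0 (sip0 (hilb_sip _)) mul0r.
have px0' i1 i2 z y1 y2 : p i1 i2 z 0 y1 y2 = 0.
  rewrite /p; have [l ->] := tensor_sum (u i1 i2); rewrite pfun_sum.
  by apply: big1 => q _; rewrite pfunE (sip0r (hilb_sip _)) mul0r.
have pxZ c i1 i2 z z' y1 y2 : p i1 i2 (c *: z) z' y1 y2 = c * p i1 i2 z z' y1 y2.
  rewrite /p; have [l ->] := tensor_sum (u i1 i2); rewrite !pfun_sum mulr_sumr.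
  by apply: eq_bigr => q _; rewrite !pfunE bopZ (sipZ (hilb_sip _)) mulrA.
have pxZ' c i1 i2 z z' y1 y2 : p i1 i2 z (c *: z') y1 y2 = conjc c * p i1 i2 z z' y1 y2.
  rewrite /p; have [l ->] := tensor_sum (u i1 i2); rewrite !pfun_sum mulr_sumr.
  by apply: eq_bigr => q _; rewrite !pfunE (sipZr (hilb_sip _)) mulrA.
rewrite -/(p j i x' x y' y) -/(p i j x x' y y'); clearbody p.
have diag i1 x1 y1 : Im (p i1 i1 x1 x1 y1 y1) = 0.
  by have := hu' i1 i1 x1 0 y1 y1; rewrite !px0 !px0' !Im0 !addr0.
have cross i1 i2 x1 x2 y1 y2 : Im (p i1 i2 x2 x1 y2 y1) + Im (p i2 i1 x1 x2 y1 y2) = 0.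
  by have := hu' i1 i2 x1 x2 y1 y2; rewrite !diag add0r addr0.
apply: cext; rewrite ?ReC ?ImC; last by have := cross i j x' x y' y; lra.
have := cross i j x' ('i *: x) y' y; rewrite pxZ pxZ' conjc_i !reim !zsimp; lra.
Qed.

End ProductFunctionals.

Section MaximalCommuting.
Variables (R : realType) (K : hilbert R) (T : opsys R) (n : nat).

(** A c-positive [u] is hermitian since [gns] applies to the functionals
    [vfun]; this places [u] in the real form on which separation works, and
    [gns] applied to a separating functional gives a contradiction. *)
Lemma c_cone_fullsys (u : 'M[tensor (fullsys K) T]_n) : c_cone u -> max_cone u.
Proof.
move=> hu; pose v : tmx (fullsys K) T n := fun i j => u i j.
have hv : c_cone (\matrix_(i, j) v i j).
  by rewrite (_ : \matrix_(i, j) _ = u)//; apply/matrixP => i j; rewrite mxE.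
have vh : rspan v.
  apply/hermt_rspanP/hermt_of_vfun => i x y.
  have [L LE] := mk_linear (vfun_linear i x y).
  rewrite -LE; apply: gns => // d hd; rewrite LE; exact: vfun_mcone.
move=> eps eps0; apply/precone_of_mcone.
rewrite (_ : (fun i j => _) = (v + eps%:C *: @tunit R (fullsys K) T n)); last first.
  apply/funext => i; apply/funext => j; rewrite !mxE tmxDE tmxZE /tunit scalerA.
  by rewrite mulr_natr.
apply: contrapT => /(mcone_separation vh eps0)[L0 [lL Lpos Lneg]].
have [L LE] := mk_linear lL.
have /ge0cP[+ _] : 0 <= L v by apply: gns => // d hd; rewrite LE; exact: Lpos.
by rewrite LE leNgt Lneg.
Qed.

End MaximalCommuting.

(** * The commuting cone is contained in the el-cone *)

Section TensorMapping.
Variables (R : realType) (T : opsys R) (n : nat).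
Implicit Types S I J : opsys R.

Lemma tens_mapl_tens S I (k : {linear S -> I}) s t : @tens_mapl R S T I k (tens s t) = tens (k s) t.
Proof. exact: tensor_liftE. Qed.

Lemma tens_mapl_sum S I (k : {linear S -> I}) X (r : seq X) (F : X -> tensor S T) :
  @tens_mapl R S T I k (\sum_(x <- r) F x) = \sum_(x <- r) @tens_mapl R S T I k (F x).
Proof. exact: linear_sum. Qed.

Definition tmap S I (k : {linear S -> I}) (v : tmx S T n) : tmx I T n :=
  fun i j => @tens_mapl R S T I k (v i j).

Lemma tmapD S I (k : {linear S -> I}) v w : tmap k (v + w) = tmap k v + tmap k w.
Proof. by apply/funext => i; apply/funext => j; rewrite tmxDE /tmap /tens_mapl tmxDE linearD. Qed.
Lemma tmapZ S I (k : {linear S -> I}) c v : tmap k (c *: v) = c *: tmap k v.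
Proof. by apply/funext => i; apply/funext => j; rewrite tmxZE /tmap /tens_mapl tmxZE linearZ_LR. Qed.
Lemma tmap0 S I (k : {linear S -> I}) : tmap k 0 = 0.
Proof. by rewrite -(scale0r 0) tmapZ !scale0r. Qed.
Lemma tmapN S I (k : {linear S -> I}) v : tmap k (- v) = - tmap k v.
Proof. by rewrite -scaleN1r tmapZ scaleN1r. Qed.

Lemma tmapB S I (k : {linear S -> I}) v w : tmap k (v - w) = tmap k v - tmap k w.
Proof. by rewrite tmapD tmapN. Qed.

Lemma tmap_dyad S I (k : {linear S -> I}) a s t : tmap k (dyad a s t) = dyad a (k s) t.
Proof.
apply/funext => i; apply/funext => j.
by rewrite /tmap /dyad /tens_mapl linearZ_LR; congr (_ *: _); exact: tens_mapl_tens.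
Qed.

Lemma tmap_unit S I (k : {linear S -> I}) : k (os_one S) = os_one I ->
  tmap k (@tunit R S T n) = @tunit R I T n.
Proof.
move=> k1; apply/funext => i; apply/funext => j.
by rewrite /tmap /tunit /tens_mapl linearZ_LR; congr (_ *: _); rewrite -k1; exact: tens_mapl_tens.
Qed.

Lemma tens_mapl_comp S I J (k : {linear S -> I}) (h : {linear I -> J}) (m : {linear S -> J}) z :
  (forall s, h (k s) = m s) ->
  @tens_mapl R I T J h (@tens_mapl R S T I k z) = @tens_mapl R S T J m z.
Proof.
move=> E; have [l ->] := tensor_sum z; rewrite (tens_mapl_sum k l) (tens_mapl_sum h l) (tens_mapl_sum m l).
by apply: eq_bigr => p _; rewrite !tens_mapl_tens E.
Qed.

Lemma tmap_comp S I J (k : {linear S -> I}) (h : {linear I -> J}) (m : {linear S -> J}) v :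
  (forall s, h (k s) = m s) -> tmap h (tmap k v) = tmap m v.
Proof. by move=> E; apply/funext => i; apply/funext => j; exact: tens_mapl_comp. Qed.

Lemma tmap_mcone S I (k : {linear S -> I}) v : cp k -> mcone v -> mcone (tmap k v).
Proof.
move=> kc [X [Y [P [Q [a [hP hQ hv]]]]]].
exists X, Y, (fun x y => k (P x y)), Q, a; split=> //; first exact: (cp_ospos kc).
move=> i j; rewrite /tmap hv /tens_mapl linear_sum; apply: eq_bigr => z _.
rewrite linear_sum; apply: eq_bigr => z' _; rewrite linearZ_LR; congr (_ *: _).
exact: tens_mapl_tens.
Qed.

Lemma tmap_rspan S I (k : {linear S -> I}) v : cp k -> rspan v -> rspan (tmap k v).
Proof.
move=> kc; elim=> [|r a s t w hs ht _ IH]; first by rewrite tmap0; exact: rspan0.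
by rewrite tmapD tmapZ tmap_dyad; apply: rspan_cons => //; exact: cp_spos.
Qed.

Definition tmx_of S (u : 'M[tensor S T]_n) : tmx S T n := fun i j => u i j.

Lemma max_coneP S (u : 'M[tensor S T]_n) :
  max_cone u <-> forall eps : R, 0 < eps -> mcone (tmx_of u + eps%:C *: @tunit R S T n).
Proof.
have E (eps : R) : (fun i j => (u + Defs.tens_scalar_mx S T n eps%:C) i j) =
    tmx_of u + eps%:C *: @tunit R S T n :> tmx S T n.
  apply/funext => i; apply/funext => j; rewrite !mxE tmxDE tmxZE /tunit scalerA.
  by rewrite mulr_natr.
split=> h eps eps0; first by rewrite -E; apply: mcone_of_precone; exact: h.
by apply: precone_of_mcone; rewrite E; exact: h.
Qed.

Lemma tmx_of_map S I (k : {linear S -> I}) (u : 'M[tensor S T]_n) :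
  tmx_of (map_mx (@tens_mapl R S T I k) u) = tmap k (tmx_of u).
Proof. by apply/funext => i; apply/funext => j; rewrite /tmx_of mxE. Qed.

Lemma op_product_mapl S I (H : hilbert R) (k : {linear S -> I}) (f : {linear I -> fullsys H})
    (f' : {linear S -> fullsys H}) (g : {linear T -> fullsys H}) z :
  (forall s, f' s = f (k s)) ->
  op_product f g (@tens_mapl R S T I k z) = op_product f' g z.
Proof.
move=> E; have [l ->] := tensor_sum z.
rewrite op_product_sum (tens_mapl_sum k l) /op_product linear_sum; apply: eq_bigr => p _.
by rewrite tens_mapl_tens E; exact: tensor_liftE.
Qed.

Lemma mk_comp S I J (k : {linear S -> I}) (h : {linear I -> J}) :
  exists m : {linear S -> J}, forall s, m s = h (k s).
Proof. by apply: (@mk_linear _ S J) => a x y; rewrite !linearP. Qed.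

End TensorMapping.

Section CommutingToEnvelope.
Variable R : realType.
Implicit Types S T I : opsys R.

Lemma cp_id S (i : {linear S -> S}) : i =1 id -> cp i.
Proof. by move=> E m A; congr os_pos; apply/matrixP => x y; rewrite mxE E. Qed.

Lemma c_cone_map S I T n (k : {linear S -> I}) (u : 'M[tensor S T]_n) : cp k ->
  c_cone u -> c_cone (map_mx (@tens_mapl R S T I k) u).
Proof.
move=> kc hu H f g fc gc comm; have [f' f'E] := mk_comp k f.
have := hu H f' g (cp_comp kc fc f'E) gc; rewrite (_ : map_mx _ (map_mx _ u) = map_mx (op_product f' g) u).
  by apply => s t; rewrite f'E.
by apply/matrixP => i j; rewrite !mxE; exact: op_product_mapl.
Qed.

(** c-positivity is inherited by B(K) containing the injective envelope, gives
    max-positivity there, and returns to the envelope [I] through the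
    completely positive map [Phi] extending the identity of [I]. *)
Lemma c_cone_el_cone S T n (u : 'M[tensor S T]_n) : c_cone u -> el_cone u.
Proof.
move=> hu; have [I [k kenv]] := injective_envelope_exists S.
exists I, k; split=> //; have [kuco Iinj _] := kenv.
have iu := incl_uco I; have [j jE] := mk_comp k (incl I).
have jc : cp j := cp_comp (uco_cp kuco) (uco_cp iu) jE.
have [i0 i0E] : exists i0 : {linear I -> I}, i0 =1 id by apply: (@mk_linear _ I I).
have [Phi Phic PhiE] := Iinj _ _ _ i0 iu (cp_id i0E).
have Phi1 : Phi (os_one _) = os_one I by rewrite -iu.1 PhiE i0E.
have /max_coneP h := c_cone_fullsys (c_cone_map jc hu).
apply/max_coneP => eps eps0; have := tmap_mcone Phic (h eps eps0).
rewrite tmapD tmapZ tmap_unit// !tmx_of_map (tmap_comp (m := k))// => s.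
by rewrite jE PhiE i0E.
Qed.

End CommutingToEnvelope.

(** * The el-cone is contained in the commuting cone for limits *)

Section ApproximationIdentities.
Variables (R : realType) (V : lmodType R[i]).
Implicit Types (x y z u : V) (a b c : R[i]).

Lemma scale_split a b u y z : (a * b) *: u - z = a *: (b *: u - y) + (a *: y - z).
Proof. by rewrite scalerBr scalerA addrA subrK. Qed.

Lemma scale_peel a b c u y : a *: u + y = (a - b * c) *: u + (b *: (c *: u) + y).
Proof. by rewrite addrA scalerA -scalerDl subrK. Qed.

Lemma perturb_identity a b u x y :
  (x + a *: u) + (b *: u - (x - y)) = y + b *: u + a *: u.
Proof.
rewrite opprB [b *: u + _]addrCA [x + a *: u]addrC addrACA [a *: u + y]addrC.
by rewrite [x + (b *: u - x)]addrC subrK -addrA [a *: u + _]addrC addrA.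
Qed.

Lemma double_add a u x y : (a + a) *: u + (x + y) = (a *: u + x) + (a *: u + y).
Proof. by rewrite scalerDl addrACA. Qed.

Lemma double_sub a u x y : (a + a) *: u - (x + y) = (a *: u - x) + (a *: u - y).
Proof. by rewrite opprD double_add. Qed.

Lemma approx_identity a (x y z v w : V) :
  x - y = z -> a *: x + v - (a *: y + w) = a *: z + (v - w).
Proof. by move=> <-; rewrite opprD addrACA scalerBr. Qed.

End ApproximationIdentities.

Section CompleteOrderEmbeddings.
Variable R : realType.
Implicit Types S T I : opsys R.

(** The norm is read off the 2 x 2 matrix order. *)
Lemma uco_norm S I (k : {linear S -> I}) s (r : R) : uco_embedding k -> 0 < r ->
  opnorm_le (os_val (k s)) r -> opnorm_le (os_val s) r.
Proof.
move=> kuco r0 h; have r0' := ltW r0.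
have hI : ospos (fun x y => k (mx2 (r%:C *: os_one S) s (os_star s) (r%:C *: os_one S) x y)).
  have /pos2_fpos h2 := pos2_norm r0' h.
  move=> xi; have := h2 xi; rewrite !big_bool /= (cp_star _ (uco_cp kuco)).
  by rewrite linearZ_LR kuco.1.
have hS : pos2 (os_val (r%:C *: os_one S)) (os_val s) (os_val (os_star s))
    (os_val (r%:C *: os_one S)).
  apply/pos2_fpos => xi; have := uco_ospos kuco hI xi.
  by rewrite !big_bool.
have bd xi : Re (hilb_ip _ (os_val (r%:C *: os_one S) xi) xi) <= r * hq xi.
  by rewrite [hilb_ip _ _ _]ip_rZ1.
exact: (pos2_bound r0 hS bd bd).
Qed.

Lemma uco_inj S I (k : {linear S -> I}) s : uco_embedding k -> k s = 0 -> s = 0.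
Proof.
move=> kuco k0; apply/val_inj/(@opnorm_le_eq0 _ _ _ 1) => // e e0.
rewrite mul1r; apply: (uco_norm kuco e0); rewrite k0.
by move=> x; rewrite [X in `|X|](_ : _ = 0)// normr0 mulr_ge0// ler0c ltW.
Qed.

Lemma tmap_inj S T I n (k : {linear S -> I}) (v : tmx S T n) : uco_embedding k ->
  tmap k v = 0 -> v = 0.
Proof.
move=> kuco k0; apply/funext => i; apply/funext => j.
have [l zE] := tensor_sum (v i j).
have vl (W : opsys R) (h : {linear S -> W}) (x : os_hilb W * os_hilb W) :
    exists g : {linear S -> R[i]}, g =1 (fun s => hilb_ip _ (os_val (h s) x.1) x.2).
  by apply: (@mk_linear R[i] S R[i]) => a s t; rewrite linearP ip_osD ip_osZ.
have vlT (x : os_hilb T * os_hilb T) :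
    exists g : {linear T -> R[i]}, g =1 (fun s => hilb_ip _ (os_val s x.1) x.2).
  by apply: (@mk_linear R[i] T R[i]) => a s t; rewrite ip_osD ip_osZ.
have /choice[a ha] := vl I k; have /choice[b hb] := vlT.
have sep (W : opsys R) (s : W) :
    (forall x, hilb_ip _ (os_val s x.1) x.2 = 0) -> s = 0.
  move=> h; apply/val_inj/bop_ext => x y; rewrite [LHS](h (x, y)); exact/esym/ip_os0.
apply: (tensor_separation _ _ zE) => [s hs|t ht|x y].
- by apply: (uco_inj kuco); apply: sep => x; rewrite -ha.
- by apply: sep => x; rewrite -hb.
have E : @tens_mapl R S T I k (v i j) = 0 by have := congr1 (fun w => w i j) k0.
have := congr1 (pfun x.1 x.2 y.1 y.2) E; rewrite zE (tens_mapl_sum k l) pfun_sum.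
rewrite (_ : pfun _ _ _ _ 0 = 0); last by exact: linear0.
move=> h; rewrite -[RHS]h; apply: eq_bigr => p _; rewrite tens_mapl_tens ha hb.
exact/esym/pfunE.
Qed.

(** Write [v = h + i m] with [h], [m] in the real span. The image of [i m] is
    the difference of two hermitian elements, so that the image of [m]
    vanishes by [hermt_i], and [tmap k] is injective. *)
Lemma rspan_reflect S T I n (k : {linear S -> I}) (v : tmx S T n) : uco_embedding k ->
  hermt (tmap k v) -> rspan v.
Proof.
move=> kuco hv; have [h [m [hh hm vE]]] := cspanT v; have kc := uco_cp kuco.
suff m0 : m = 0 by rewrite vE m0 scaler0 addr0.
apply: (tmap_inj kuco); apply: hermt_i; first by apply: hermt_rspan; exact: tmap_rspan.
have -> : 'i *: tmap k m = tmap k v - tmap k h by rewrite vE tmapD tmapZ addrC addKr.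
apply: hermtD => //; apply: hermt_rspan; apply: rspan_opp; exact: tmap_rspan.
Qed.

End CompleteOrderEmbeddings.

Section VectorFunctionals.
Variables (R : realType) (S T : opsys R) (n : nat) (H : hilbert R).
Variables (f : {linear S -> fullsys H}) (g : {linear T -> fullsys H}) (xi : 'I_n -> H).
Local Notation ip := (hilb_ip H).
Local Notation hH := (hilb_sip H).

Definition vec_fun (v : tmx S T n) : R[i] :=
  \sum_i \sum_j ip (op_product f g (v i j) (xi j)) (xi i).

Lemma vec_funP c v w : vec_fun (c *: v + w) = c * vec_fun v + vec_fun w.
Proof.
rewrite /vec_fun mulr_sumr -big_split; apply: eq_bigr => i _.
rewrite mulr_sumr -big_split; apply: eq_bigr => j _.
rewrite tmxDE tmxZE (_ : op_product f g (_ + _) =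
  c *: op_product f g (v i j) + op_product f g (w i j)); last exact: linearP.
by rewrite bop_add bop_scale (sipD hH) (sipZ hH).
Qed.

(** On a dyad the functional is a matrix coefficient of [f d], with fixed
    vectors depending on [a] and [t]. *)
Lemma vec_fun_bound (a : 'I_n -> R[i]) (t : T) : cp f -> exists2 C : R, 0 <= C &
  forall d e, 0 <= e -> opnorm_le (os_val d) e ->
    `|Re (vec_fun (dyad a d t))| <= C * e /\ `|Im (vec_fun (dyad a d t))| <= C * e.
Proof.
move=> fc; have [C C0 hC] := cp_bounded fc.
pose z := \sum_i conjc (a i) *: xi i; pose y := os_val (g t) z.
have E d : vec_fun (dyad a d t) = ip (os_val (f d) y) z.
  rewrite /vec_fun /z (sip_sumr hH); apply: eq_bigr => i _.
  rewrite /y /z !bop_sum (sip_sum hH); apply: eq_bigr => j _.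
  rewrite (_ : op_product f g _ = (a i * conjc (a j)) *: bop_comp (os_val (f d)) (os_val (g t))).
    by rewrite bop_scale !bopZ !(sipZ hH) (sipZr hH) conjcK mulrCA mulrA.
  by rewrite /op_product linearZ_LR; congr (_ *: _); exact: tensor_liftE.
have D0 : 0 <= hq y * hq z by rewrite mulr_ge0 ?hq_ge0.
exists (C * (hq y * hq z + 1)) => [|d e e0 hd]; first by rewrite mulr_ge0 ?ltW//; lra.
rewrite E; have /(opnorm_leP _ (mulr_ge0 (ltW C0) e0))/(_ y) hf := hC d e e0 hd.
have k : hq (os_val (f d) y) * hq z <= (C * (hq y * hq z + 1) * e) ^+ 2.
  apply: (@le_trans _ _ ((C * e) ^+ 2 * (hq y * hq z))).
    by rewrite mulrA ler_wpM2r ?hq_ge0.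
  rewrite [C * _ * e]mulrAC [leRHS]exprMn ler_wpM2l ?sqr_ge0//; nra.
have r0 : 0 <= C * (hq y * hq z + 1) * e by rewrite !mulr_ge0 ?(ltW C0)//; lra.
have ab (b : R) : b ^+ 2 <= hq (os_val (f d) y) * hq z -> `|b| <= C * (hq y * hq z + 1) * e.
  move=> h; rewrite -ler_sqr ?nnegrE// real_normK ?num_real//.
  exact: le_trans h k.
by split; apply: ab; [exact: (sip_CS hH)|exact: (sip_CSi hH)].
Qed.

End VectorFunctionals.

(** Used with A the error of an approximation, B the value at the approximant
    and D the value at the unit. *)
Lemma scalar_squeeze (R : realType) (A B D : R[i]) (e : R) : 0 < e ->
  `|Re A| <= e -> `|Im A| <= e ->
  0 <= Re (B + e%:C * D) /\ Im (B + e%:C * D) = 0 ->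
  - (e * (`|Re D| + `|Im D| + 1)) <= Re (A + B) /\
  `|Im (A + B)| <= e * (`|Re D| + `|Im D| + 1).
Proof.
move=> e0; rewrite !ReD !ImD ReM ImM Re_real Im_real !mul0r subr0 addr0.
rewrite !ler_norml => /andP[a1 a2] /andP[b1 b2] [c1 c2].
have d1 := ler_norm (Re D); have d2 := ler_norm (Im D).
have d3 := ler_norm (- Im D); rewrite normrN in d3.
have := normr_ge0 (Im D); have := normr_ge0 (Re D).
move: `|Re D| `|Im D| d1 d2 d3 => p q d1 d2 d3 p0 q0; split; first by nra.
by apply/andP; split; nra.
Qed.

Section InductiveLimits.
Variables (R : realType) (S_ : nat -> opsys R) (u : forall n, {linear S_ n -> S_ n.+1}).
Variables (S : opsys R) (l : forall n, {linear S_ n -> S}).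
Hypotheses (l_emb : forall n, uco_embedding (l n))
  (l_compat : forall n x, l n x = l n.+1 (u n x))
  (l_closure : @os_set R S = op_closure (\bigcup_n range (fun x => os_val (l n x)))).

Lemma stage_map m m' : (m <= m')%N -> exists h : {linear S_ m -> S_ m'},
  forall x, l m' (h x) = l m x.
Proof.
elim: m' => [|m' IH].
  rewrite leqn0 => /eqP ->.
  have [h hE] : exists h : {linear S_ 0 -> S_ 0}, h =1 id by exact: (@mk_linear _ (S_ 0) (S_ 0)).
  by exists h => x; rewrite hE.
rewrite leq_eqVlt => /predU1P[->|/IH[h hE]].
  have [h hE] : exists h : {linear S_ m'.+1 -> S_ m'.+1}, h =1 id.
    exact: (@mk_linear _ (S_ m'.+1) (S_ m'.+1)).
  by exists h => x; rewrite hE.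
by have [h' h'E] := mk_comp h (u m'); exists h' => x; rewrite h'E -l_compat hE.
Qed.

(** Averaging an approximation with its adjoint keeps it in the stage and does
    not increase the error. *)
Lemma herm_approx (s : S) (e : R) : os_star s = s -> 0 < e ->
  exists m (x : S_ m), os_star (l m x) = l m x /\ opnorm_le (os_val (s - l m x)) e.
Proof.
move=> hs e0; have [m [x hx]] := op_closure_approx l_closure s e0.
exists m, ((2^-1)%:C *: (x + os_star x)).
have lE : l m ((2^-1)%:C *: (x + os_star x)) = (2^-1)%:C *: (l m x + os_star (l m x)).
  by rewrite linearZ_LR linearD (cp_star _ (uco_cp (l_emb m))).
rewrite lE; split; first by rewrite os_starZ conjc_real os_starD os_starK addrC.
pose d := s - l m x; have hd : opnorm_le (os_val d) e by [].
have hd' : opnorm_le (os_val (os_star d)) e by apply: opnorm_le_adj => //; exact: ltW.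
have -> : s - (2^-1)%:C *: (l m x + os_star (l m x)) = (2^-1)%:C *: (d + os_star d).
  rewrite /d os_starD os_starN hs addrACA -opprD scalerBr; congr (_ - _).
  rewrite scalerDr -scalerDl -rmorphD; have -> : 2^-1 + 2^-1 = 1 :> R by field.
  by rewrite rmorph1 scale1r.
move=> y; rewrite os_valZ os_valD bop_scale bop_add normrZ.
have n2 : `|(2^-1)%:C : R[i]| = (2^-1)%:C by rewrite ger0_norm// ler0c invr_ge0.
rewrite n2; apply: (@le_trans _ _ ((2^-1)%:C * (e%:C * `|y| + e%:C * `|y|))).
  rewrite ler_wpM2l ?ler0c ?invr_ge0//; apply: (le_trans (ler_normD _ _)).
  by apply: lerD; [exact: hd|exact: hd'].
rewrite -mulrDl -rmorphD mulrA -rmorphM (_ : 2^-1 * (e + e) = e)//; by field.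
Qed.

(** The error of replacing [s] by a hermitian element within [d] of it is
    dominated, in the order of D_n, by [d] times a multiple of the unit
    depending only on [a] and [t], because [d 1 - y] is positive for a
    hermitian [y] of norm at most [d]. The terms of [w] are treated one after
    the other, moving to the later of two stages. *)
Lemma rspan_approx (T : opsys R) (n : nat) (F : tmx S T n -> R[i]) (w : tmx S T n) :
  (forall c v v', F (c *: v + v') = c * F v + F v') ->
  (forall a t, exists2 C : R, 0 <= C & forall d e, 0 <= e -> opnorm_le (os_val d) e ->
    `|Re (F (dyad a d t))| <= C * e /\ `|Im (F (dyad a d t))| <= C * e) ->
  rspan w -> forall e : R, 0 < e -> exists m (v : tmx (S_ m) T n),
    [/\ mcone (e%:C *: @tunit R S T n + (w - tmap (l m) v)),
        mcone (e%:C *: @tunit R S T n - (w - tmap (l m) v)),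
        `|Re (F (w - tmap (l m) v))| <= e & `|Im (F (w - tmap (l m) v))| <= e].
Proof.
move=> FP Fb; have F0 : F 0 = 0.
  by have := FP (-1) 0 0; rewrite scaler0 addr0 mulN1r addNr.
have FD v v' : F (v + v') = F v + F v' by have := FP 1 v v'; rewrite scale1r mul1r.
have FZ c v : F (c *: v) = c * F v by have := FP c v 0; rewrite !addr0 F0 addr0.
elim=> [|r a s t {}w hs ht _ IH] e e0.
  exists 0%N, 0; rewrite tmap0 subr0 addr0 subr0 F0 !normr0.
  have De : mcone (e%:C *: @tunit R S T n).
    by apply: mcone_scale; [exact: ltW|exact: mcone_unit].
  by split=> //; exact: ltW.
have e2 : 0 < e / 2 by lra.
have [m1 [v1 [h1 h2 h3 h4]]] := IH _ e2.
have [C C0 hC] := Fb a t.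
have [c c0 hc] := dyad_dominated a (@spos_one R S) ht.
(* The constant d is small enough for the order error |r| c d and the
   functional error |r| C d to be at most e / 2 each. *)
pose M := 2 * (`|r| * (C + c) + 1).
have rC0 : 0 <= `|r| * (C + c) by rewrite mulr_ge0 ?addr_ge0.
have M0 : 0 < M by rewrite /M; lra.
pose d := e / M; have d0 : 0 < d by rewrite divr_gt0.
have rd : `|r| * (C + c) * d <= e / 2.
  have : d * M = e by rewrite /d mulfVK// gt_eqF.
  rewrite /M; move: (`|r| * (C + c)) rC0 => b b0; nra.
have [m2 [x [hx hdx]]] := herm_approx (spos_star hs) d0.
pose m := maxn m1 m2.
have [k1 k1E] := stage_map (leq_maxl m1 m2); have [k2 k2E] := stage_map (leq_maxr m1 m2).
exists m, (r%:C *: dyad a (k2 x) t + tmap k1 v1).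
pose y := s - l m2 x.
have hy : opnorm_le (os_val y) d by [].
have ys : os_star y = y.
  by rewrite /y os_starD os_starN hx (spos_star hs).
have dyadB : dyad a s t - dyad a (l m2 x) t = dyad a y t.
  by rewrite /y dyadDl dyadNl.
have E : r%:C *: dyad a s t + w - tmap (l m) (r%:C *: dyad a (k2 x) t + tmap k1 v1) =
    r%:C *: dyad a y t + (w - tmap (l m1) v1).
  rewrite tmapD tmapZ tmap_dyad k2E (tmap_comp (m := l m1))//.
  exact: approx_identity.
have Yd (z : S) : os_star z = z -> opnorm_le (os_val z) d ->
    mcone ((d * c)%:C *: @tunit R S T n - dyad a z t).
  move=> zs hz; have hp := spos_sub_norm (ltW d0) hz zs.
  have -> : (d * c)%:C *: @tunit R S T n - dyad a z t =
      d%:C *: (c%:C *: @tunit R S T n - dyad a (os_one S) t) + dyad a (d%:C *: os_one S - z) t.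
    have -> : dyad a (d%:C *: os_one S - z) t = d%:C *: @dyad R S T n a (os_one S) t - dyad a z t.
      by rewrite dyadDl dyadZl dyadNl.
    by rewrite rmorphM; exact: scale_split.
  apply: mcone_add; last exact: mcone_dyad.
  by apply: mcone_scale => //; exact: ltW.
have Ny : opnorm_le (os_val (- y)) d.
  by move=> z; rewrite os_valN bop_opp normrN; exact: hy.
have Nys : os_star (- y) = - y.
  by rewrite os_starN ys.
have D1 := Yd y ys hy; have D2 := Yd (- y) Nys Ny.
rewrite dyadNl opprK in D2.
have D3 (p : R) : `|p| = `|r| ->
    mcone ((e / 2)%:C *: @tunit R S T n + p%:C *: dyad a y t).
  move=> pr.
  have -> : (e / 2)%:C *: @tunit R S T n + p%:C *: dyad a y t =
     (e / 2 - `|r| * (d * c))%:C *: @tunit R S T n +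
     (`|r|%:C *: ((d * c)%:C *: @tunit R S T n) + p%:C *: dyad a y t).
    have -> : (e / 2 - `|r| * (d * c))%:C = (e / 2)%:C - `|r|%:C * (d * c)%:C.
      by rewrite rmorphB [X in _ - X]rmorphM.
    exact: scale_peel.
  apply: mcone_add.
    apply: mcone_scale; last exact: mcone_unit.
    have : 0 <= `|r| * C * d by apply: mulr_ge0; [exact: mulr_ge0|exact: ltW].
    move: rd; rewrite mulrDr mulrDl [d * c]mulrC [`|r| * (c * d)]mulrA.
    move: (`|r| * C * d) (`|r| * c * d) => b1 b2 h b10; lra.
  have D1' := mcone_scale (normr_ge0 r) D1; have D2' := mcone_scale (normr_ge0 r) D2.
  rewrite [_ *: (_ - _)]scalerBr in D1'; rewrite [_ *: (_ + _)]scalerDr in D2'.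
  have [p0|p0] := leP 0 p.
    have pE : p = `|r| by rewrite -pr ger0_norm.
    rewrite pE; exact: D2'.
  have pE : p%:C = - `|r|%:C by rewrite -pr ltr0_norm// rmorphN opprK.
  rewrite pE scaleNr; exact: D1'.
have eE : e%:C = (e / 2)%:C + (e / 2)%:C by rewrite -rmorphD; congr (_%:C); field.
have [b1 b2] := hC y d (ltW d0) hy.
have FE : F (r%:C *: dyad a y t + (w - tmap (l m1) v1)) =
  r%:C * F (dyad a y t) + F (w - tmap (l m1) v1) by exact: FP.
have half (b : R) : `|b| <= C * d -> `|r * b| <= e / 2.
  move=> hb; rewrite normrM; apply: le_trans rd.
  rewrite -mulrA ler_wpM2l//; apply: (le_trans hb).
  by rewrite ler_wpM2r ?(ltW d0)// lerDl.
rewrite E; split.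
- rewrite eE double_add; apply: mcone_add; [exact: D3|exact: h1].
- rewrite eE double_sub; apply: mcone_add; last exact: h2.
  rewrite -scaleNr -rmorphN; apply: D3; exact: normrN.
- rewrite FE ReD ReM Re_real Im_real mul0r subr0; apply: (le_trans (ler_normD _ _)).
  by have := half _ b1; lra.
- rewrite FE ImD ImM Re_real Im_real mul0r addr0; apply: (le_trans (ler_normD _ _)).
  by have := half _ b2; lra.
Qed.

(** The approximant [x] of [u] over a stage [S_ m] satisfies [u - e <= x <= u
    + e] in the order of D_n over [S], hence over the envelope [I] of [S],
    where [u] is positive. The map [psi] carries the positivity of [x + e] to
    the envelope of [S_ m]; nuclearity of [S_ m] makes [x + e] c-positive, so
    that the vector functional of [u] is nonnegative up to an error of order
    [e]. *)
Lemma el_cone_c_cone (T : opsys R) (n : nat) (v : 'M[tensor S T]_n) :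
  (forall m (w : 'M[tensor (S_ m) T]_n), el_cone w -> c_cone w) ->
  el_cone v -> c_cone v.
Proof.
move=> hnuc [I [k [kenv /max_coneP hk]]]; have [kuco Iinj _] := kenv.
move=> H f g fc gc comm xi; rewrite tmx_of_map in hk.
pose w := tmx_of v.
have hw : rspan w.
  apply: (rspan_reflect kuco); have := hermt_mcone (hk 1 ltr01).
  rewrite scale1r => h; rewrite -[tmap k _](addrK (@tunit R I T n)).
  by apply: hermtD => //; apply: hermt_rspan; apply: rspan_opp; exact: rspan_unit.
pose F := vec_fun f g xi.
have FP c x y : F (c *: x + y) = c * F x + F y by exact: vec_funP.
have Fb a t := vec_fun_bound g xi a t fc.
pose N := `|Re (F (@tunit R S T n))| + `|Im (F (@tunit R S T n))| + 1.
have N0 : 0 < N by rewrite /N ltr_wpDl.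
have key (e : R) : 0 < e -> - (e * N) <= Re (F w) /\ `|Im (F w)| <= e * N.
  move=> e0; have [m [x [h1 h2 h3 h4]]] := rspan_approx FP Fb hw e0.
  have [Im' [km kmenv]] := injective_envelope_exists (S_ m).
  have [kmuco Iminj _] := kmenv.
  have [kl klE] := mk_comp (l m) k.
  have kluco : uco_embedding kl.
    split=> [|p A]; first by rewrite klE (l_emb m).1 kuco.1.
    rewrite ((l_emb m).2 p A) (kuco.2 p (map_mx (l m) A)).
    by rewrite (_ : map_mx kl A = map_mx k (map_mx (l m) A))//; apply/matrixP => i j; rewrite !mxE klE.
  have [psi psic psiE] := Iminj _ _ _ km kluco (uco_cp kmuco).
  have psi1 : psi (os_one I) = os_one Im' by rewrite -kluco.1 psiE kmuco.1.
  pose x' := x + e%:C *: @tunit R (S_ m) T n.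
  have x'dyad : el_cone (\matrix_(i, j) x' i j).
    exists Im', km; split=> //; apply/max_coneP => eps eps0; rewrite tmx_of_map.
    have -> : tmx_of (\matrix_(i, j) x' i j) = x'.
      by apply/funext => i; apply/funext => j; rewrite /tmx_of mxE.
    have E2 : tmap k (e%:C *: @tunit R S T n - (w - tmap (l m) x)) =
        e%:C *: @tunit R I T n - (tmap k w - tmap kl x).
      by rewrite tmapB tmapB tmapZ (tmap_unit _ _ kuco.1) (tmap_comp (m := kl)).
    have := tmap_mcone (uco_cp kuco) h2; rewrite E2.
    move=> /(mcone_add (hk eps eps0)); rewrite perturb_identity => /(tmap_mcone psic).
    rewrite tmapD tmapD tmapZ tmapZ (tmap_unit _ _ psi1) (tmap_comp (m := km))//.
    by rewrite /x' tmapD tmapZ (tmap_unit _ _ kmuco.1).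
  have := hnuc m _ x'dyad H.
  have [f' f'E] := mk_comp (l m) f.
  move=> /(_ f' g (cp_comp (uco_cp (l_emb m)) fc f'E) gc).
  have comm' s t : bop_comp (os_val (f' s)) (os_val (g t)) =
      bop_comp (os_val (g t)) (os_val (f' s)) by rewrite f'E.
  move=> /(_ comm' xi).
  have -> : \sum_i \sum_j hilb_ip H (map_mx (op_product f' g) (\matrix_(i, j) x' i j) i j (xi j)) (xi i)
      = F (tmap (l m) x').
    apply: eq_bigr => i _; apply: eq_bigr => j _; rewrite !mxE.
    by rewrite (op_product_mapl (f := f) (f' := f') (k := l m)).
  rewrite /x' tmapD tmapZ (tmap_unit _ _ (l_emb m).1) => /ge0cP.
  have FD y z : F (y + z) = F y + F z by have := FP 1 y z; rewrite scale1r mul1r.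
  have F0 : F 0 = 0 by have := FP (-1) 0 0; rewrite scaler0 addr0 mulN1r addNr.
  have FZ c y : F (c *: y) = c * F y by have := FP c y 0; rewrite !addr0 F0 addr0.
  have wE : F w = F (w - tmap (l m) x) + F (tmap (l m) x) by rewrite -FD subrK.
  have -> : F (tmap (l m) x + e%:C *: @tunit R S T n) =
    F (tmap (l m) x) + e%:C * F (@tunit R S T n) by rewrite FD FZ.
  by rewrite wE; exact: scalar_squeeze.
have {}key : 0 <= F w.
  apply/ge0cP; split.
    apply/ler_addgt0Pr => e e0; have [|h _] := key (e / N); first by rewrite divr_gt0.
    by rewrite divfK ?gt_eqF// in h; lra.
  apply/eqP; rewrite -normr_le0; apply/ler_addgt0Pr => e e0.
  have [|_ h] := key (e / N); first by rewrite divr_gt0.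
  by rewrite divfK ?gt_eqF// in h; rewrite add0r.
move: key; congr (0 <= _); apply: eq_bigr => i _; apply: eq_bigr => j _.
by rewrite mxE.
Qed.

End InductiveLimits.

Theorem theorem4p6 (R : realType) (S_ : nat -> opsys R)
    (u : forall n : nat, {linear S_ n -> S_ n.+1})
    (u_emb : forall n : nat, uco_embedding (u n))
    (S : opsys R) (l : forall n : nat, {linear S_ n -> S})
    (S_lim : is_inductive_limit u l) :
  ((forall n : nat, nuclear (@el_cone R) (@c_cone R) (S_ n)) ->
     nuclear (@el_cone R) (@c_cone R) S) /\
  ((forall n : nat, has_DCEP (S_ n)) -> has_DCEP S).
Proof.
have [l_emb l_compat l_closure _] := S_lim; split=> [hnuc T n v|].
  split; last exact: c_cone_el_cone.
  apply: (el_cone_c_cone l_emb l_compat l_closure) => m w.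
  by have [] := hnuc m T n w.
exact: (DCEP_limit S_lim).
Qed.
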